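(* Let $X$ be a locally compact, $\sigma$-compact Hausdorff space and let $\mathcal{E}$ and $\mathcal{F}$ be two (F) Banach bundles over $X$, each of which is subhomogeneous, conditionally of finite type, and such that for every $d$ the set of points of $X$ over which its fiber has dimension $\le d$ is a $G_\delta$ subset of $X$. Then the canonical morphisms $$\Gamma_0(\mathcal{E})\otimes_{C_0(X)}\Gamma_0(\mathcal{F})\longrightarrow\Gamma_0(\mathcal{E})\,\widehat{\otimes}_{C_0(X)}\,\Gamma_0(\mathcal{F})\longrightarrow\Gamma_0(\mathcal{E}\,\widehat{\otimes}_X\,\mathcal{F})$$ are all bijective, where the leftmost tensor product is the purely algebraic one.
   Context: An (H) Banach bundle over $X$ is a continuous open surjection $\pi:\mathcal{E}\to X$ whose fibers $\mathcal{E}_x:=\pi^{-1}(x)$ are complex Banach spaces, such that: scalar multiplication and fiberwise addition are continuous; the norm $\mathcal{E}\to\mathbb{R}$ is upper semicontinuous; and for every $x\in X$ the sets $\{s : \pi(s)\in U,\ \|s\|<\varepsilon\}$ ($U$ a neighborhood of $x$, $\varepsilon>0$) form a fundamental system of neighborhoods of $0_x\in\mathcal{E}_x$. It is (F) if moreover the norm is continuous. $C_0(X)$ denotes continuous complex functions on $X$ vanishing at infinity; $\Gamma_0(\mathcal{E})$ is the Banach $C_0(X)$-module of continuous sections vanishing at infinity, with the supremum norm. $\sigma$-compact means a countable union of compact subspaces. $\mathcal{E}$ is subhomogeneous if $\sup_x\dim\mathcal{E}_x<\infty$. Writing $X_d:=\{x : \dim\mathcal{E}_x=d\}$, a subhomogeneous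 $\mathcal{E}$ is conditionally of finite type if for each $d$ the space $X_d$ has a finite cover by (relatively) open sets $U$ over each of which $\mathcal{E}$ is trivial, i.e. $\mathcal{E}|_U\cong U\times E$ via a fiberwise linear homeomorphism over $U$, for a Banach space $E$. A $G_\delta$ set is a countable intersection of open sets. For Banach $A$-modules $M,N$ ($A$ a commutative Banach algebra), $M\widehat{\otimes}_{A}N$ is the quotient of the projective Banach-space tensor product $M\widehat{\otimes}N$ by the closed span of the elements $am\otimes n-m\otimes an$, $a\in A$. $\mathcal{E}\widehat{\otimes}_X\mathcal{F}$ is the (H) bundle with fiber the projective tensor product $\mathcal{E}_x\widehat{\otimes}\mathcal{F}_x$ at $x$, topologized so that $x\mapsto\sigma(x)\otimes\tau(x)$ is a continuous section for all $\sigma\in\Gamma_0(\mathcal{E})$, $\tau\in\Gamma_0(\mathcal{F})$. The canonical morphisms send $\sigma\otimes\tau$ to $\sigma\otimes\tau$ and then to $x\mapsto\sigma(x)\otimes\tau(x)$. *)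

(* Defs.v *)
From HB Require Import structures.
From mathcomp Require Import all_boot all_order all_algebra complex lra.
From mathcomp Require Import all_classical all_reals all_analysis.
From mathcomp Require Import borel_hierarchy.

Set Implicit Arguments.
Unset Strict Implicit.
Unset Printing Implicit Defensive.

Import Order.TTheory GRing.Theory Num.Theory numFieldNormedType.Exports.

Local Open Scope quotient_scope.
Local Open Scope classical_set_scope.
Local Open Scope ring_scope.
Local Open Scope complex_scope.


Section submodule.
Context {K : comNzRingType} {V : lmodType K}.

Record submodule := Submodule {
  submodule_set :> V -> Prop;
  submodule0 : submodule_set 0;
  submoduleD : forall u v,
    submodule_set u -> submodule_set v -> submodule_set (u + v);
  submoduleZ : forall a v, submodule_set v -> submodule_set (a *: v) }.

Lemma submoduleN (S : submodule) v : S v -> S (- v).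
Proof. by rewrite -scaleN1r; apply: submoduleZ. Qed.

Lemma submoduleB (S : submodule) u v : S u -> S v -> S (u - v).
Proof. by move=> Su Sv; apply: submoduleD => //; apply: submoduleN. Qed.

(* The intersection of all submodules containing A. *)
Definition span_set (A : set V) : set V :=
  [set v | forall S : submodule, (forall u, A u -> S u) -> S v].

Lemma span_set0 A : span_set A 0.
Proof. by move=> S _; apply: submodule0. Qed.

Lemma span_setD A u v : span_set A u -> span_set A v -> span_set A (u + v).
Proof. by move=> Au Av S AS; apply: submoduleD; [apply: Au|apply: Av]. Qed.

Lemma span_setZ A a v : span_set A v -> span_set A (a *: v).
Proof. by move=> Av S AS; apply/submoduleZ/Av. Qed.

Definition span (A : set V) : submodule :=
  Submodule (@span_set0 A) (@span_setD A) (@span_setZ A).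

End submodule.
Arguments submodule {K} V.

Section quotient.
Context {K : comNzRingType} {V : lmodType K} (S : submodule V).

Definition quot_rel : rel V := fun u v => `[< S (u - v) >].

Lemma quot_rel_refl : reflexive quot_rel.
Proof. by move=> u; apply/asboolP; rewrite subrr; apply: submodule0. Qed.

Lemma quot_rel_sym : symmetric quot_rel.
Proof.
move=> u v; apply/asboolP/asboolP => /submoduleN;
  by rewrite opprB.
Qed.

Lemma quot_rel_trans : transitive quot_rel.
Proof.
move=> v u w /asboolP uv /asboolP vw; apply/asboolP.
by have := submoduleD uv vw; rewrite addrA subrK.
Qed.

Canonical quot_equiv :=
  EquivRel quot_rel quot_rel_refl quot_rel_sym quot_rel_trans.

Definition lquot := {eq_quot quot_rel}.

HB.instance Definition _ := Choice.on lquot.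

Definition to_quot (v : V) : lquot := \pi_{eq_quot quot_rel} v.
Definition quot_repr (q : lquot) : V := repr (q : {eq_quot quot_rel}).

Lemma quot_reprK : cancel quot_repr to_quot.
Proof. exact: reprK. Qed.

Lemma to_quotP u v : to_quot u = to_quot v <-> S (u - v).
Proof.
by split=> [/eqP|uv]; [rewrite /to_quot piE => /asboolP|];
   last by apply/eqP; rewrite /to_quot piE; apply/asboolP.
Qed.

Lemma quot_repr_to v : S (quot_repr (to_quot v) - v).
Proof. by apply/to_quotP; rewrite quot_reprK. Qed.

Lemma lquotW (P : lquot -> Prop) : (forall v, P (to_quot v)) -> forall q, P q.
Proof. by move=> Pv q; rewrite -[q]quot_reprK. Qed.

Definition quot_zero : lquot := to_quot 0.
Definition quot_add (p q : lquot) := to_quot (quot_repr p + quot_repr q).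
Definition quot_opp (p : lquot) := to_quot (- quot_repr p).
Definition quot_scale (a : K) (p : lquot) := to_quot (a *: quot_repr p).

Lemma to_quotD u v : to_quot (u + v) = quot_add (to_quot u) (to_quot v).
Proof.
apply/esym/to_quotP; rewrite opprD addrACA.
by apply: submoduleD; apply: quot_repr_to.
Qed.

Lemma to_quotN u : to_quot (- u) = quot_opp (to_quot u).
Proof.
apply/esym/to_quotP; rewrite -opprD; apply/submoduleN; exact: quot_repr_to.
Qed.

Lemma to_quotZ a u : to_quot (a *: u) = quot_scale a (to_quot u).
Proof.
by apply/esym/to_quotP; rewrite -scalerBr; apply/submoduleZ/quot_repr_to.
Qed.

Lemma quot_addA : associative quot_add.
Proof.
by elim/lquotW => u; elim/lquotW => v; elim/lquotW => w; rewrite -!to_quotD addrA.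
Qed.
Lemma quot_addC : commutative quot_add.
Proof. by elim/lquotW => u; elim/lquotW => v; rewrite -!to_quotD addrC. Qed.
Lemma quot_add0 : left_id quot_zero quot_add.
Proof. by elim/lquotW => u; rewrite -to_quotD add0r. Qed.
Lemma quot_addN : left_inverse quot_zero quot_opp quot_add.
Proof. by elim/lquotW => u; rewrite -to_quotN -to_quotD addNr. Qed.

HB.instance Definition _ :=
  GRing.isZmodule.Build lquot quot_addA quot_addC quot_add0 quot_addN.

Let to_quot_add u v : to_quot (u + v) = to_quot u + to_quot v.
Proof. exact: to_quotD. Qed.

Lemma quot_scaleA a b q : quot_scale a (quot_scale b q) = quot_scale (a * b) q.
Proof. by elim/lquotW: q => u; rewrite -!to_quotZ scalerA. Qed.
Lemma quot_scale1 : left_id 1 quot_scale.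
Proof. by elim/lquotW => u; rewrite -!to_quotZ scale1r. Qed.
Lemma quot_scaleDr : right_distributive quot_scale +%R.
Proof.
move=> a; elim/lquotW => u; elim/lquotW => v.
by rewrite -to_quot_add -!to_quotZ -to_quot_add scalerDr.
Qed.
Lemma quot_scaleDl q : {morph quot_scale^~ q : a b / a + b}.
Proof.
move=> a b; elim/lquotW: q => u.
by rewrite -!to_quotZ -to_quot_add scalerDl.
Qed.

HB.instance Definition _ := GRing.Zmodule_isLmodule.Build K lquot
  quot_scaleA quot_scale1 quot_scaleDr quot_scaleDl.

Lemma to_quot_is_linear : linear to_quot.
Proof. by move=> a u v; rewrite to_quotD to_quotZ. Qed.

HB.instance Definition _ :=
  GRing.isLinear.Build K V lquot _ to_quot to_quot_is_linear.

End quotient.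

Section tensor.
Context {K : comNzRingType} (M N : lmodType K).

(* The algebraic tensor product is presented by generators and relations: the
   sequence [:: (m1, n1); ...; (mk, nk)] stands for m1 (x) n1 + ... + mk (x) nk
   (scalars are absorbed in the first factor), and tensor_eq is the congruence
   generated by bilinearity. *)
Inductive tensor_eq : seq (M * N) -> seq (M * N) -> Prop :=
| tensor_eq_refl s : tensor_eq s s
| tensor_eq_sym s t : tensor_eq s t -> tensor_eq t s
| tensor_eq_trans s t u : tensor_eq s t -> tensor_eq t u -> tensor_eq s u
| tensor_eq_cat s s' t t' :
    tensor_eq s s' -> tensor_eq t t' -> tensor_eq (s ++ t) (s' ++ t')
| tensor_eq_catC s t : tensor_eq (s ++ t) (t ++ s)
| tensor_eq_Dl m m' n : tensor_eq [:: (m + m', n)] [:: (m, n); (m', n)]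
| tensor_eq_Dr m n n' : tensor_eq [:: (m, n + n')] [:: (m, n); (m, n')]
| tensor_eq_Z a m n : tensor_eq [:: (a *: m, n)] [:: (m, a *: n)]
| tensor_eq_0 n : tensor_eq [:: (0, n)] [::].

Definition tensor_rel : rel (seq (M * N)) := fun s t => `[< tensor_eq s t >].

Lemma tensor_rel_refl : reflexive tensor_rel.
Proof. by move=> s; apply/asboolP; apply: tensor_eq_refl. Qed.

Lemma tensor_rel_sym : symmetric tensor_rel.
Proof. by move=> s t; apply/asboolP/asboolP; apply: tensor_eq_sym. Qed.

Lemma tensor_rel_trans : transitive tensor_rel.
Proof.
move=> t s u /asboolP st /asboolP tu; apply/asboolP.
exact: tensor_eq_trans tu.
Qed.

Canonical tensor_equiv :=
  EquivRel tensor_rel tensor_rel_refl tensor_rel_sym tensor_rel_trans.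

Definition tensor := {eq_quot tensor_rel}.

HB.instance Definition _ := Choice.on tensor.

Definition to_tensor (s : seq (M * N)) : tensor := \pi_{eq_quot tensor_rel} s.
Definition tensor_repr (t : tensor) : seq (M * N) :=
  repr (t : {eq_quot tensor_rel}).

Definition tens (m : M) (n : N) : tensor := to_tensor [:: (m, n)].

Lemma tensor_reprK : cancel tensor_repr to_tensor.
Proof. exact: reprK. Qed.

Lemma to_tensorP s t : to_tensor s = to_tensor t <-> tensor_eq s t.
Proof.
by split=> [/eqP|st]; [rewrite /to_tensor piE => /asboolP|];
   last by apply/eqP; rewrite /to_tensor piE; apply/asboolP.
Qed.

Lemma tensor_repr_to s : tensor_eq (tensor_repr (to_tensor s)) s.
Proof. by apply/to_tensorP; rewrite tensor_reprK. Qed.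

Lemma tensorW (P : tensor -> Prop) :
  (forall s, P (to_tensor s)) -> forall t, P t.
Proof. by move=> Ps t; rewrite -[t]tensor_reprK. Qed.

Definition seq_scale (a : K) (s : seq (M * N)) := [seq (a *: p.1, p.2) | p <- s].

Lemma tensor_eq_consD (p : M * N) s t : tensor_eq s t -> tensor_eq (p :: s) (p :: t).
Proof. by move=> st; apply: (@tensor_eq_cat [:: p] [:: p]) => //; exact: tensor_eq_refl. Qed.

Lemma tensor_eq_scale a s t :
  tensor_eq s t -> tensor_eq (seq_scale a s) (seq_scale a t).
Proof.
elim=> {s t}.
- by move=> s; apply: tensor_eq_refl.
- by move=> s t _; apply: tensor_eq_sym.
- by move=> s t u _ st _; apply: tensor_eq_trans.
- by move=> s s' t t' _ h1 _ h2; rewrite /seq_scale !map_cat; apply: tensor_eq_cat.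
- by move=> s t; rewrite /seq_scale !map_cat; apply: tensor_eq_catC.
- by move=> m m' n /=; rewrite scalerDr; apply: tensor_eq_Dl.
- by move=> m n n' /=; apply: tensor_eq_Dr.
- by move=> b m n /=; rewrite scalerA mulrC -scalerA; apply: tensor_eq_Z.
- by move=> n /=; rewrite scaler0; apply: tensor_eq_0.
Qed.

Definition tensor_zero : tensor := to_tensor [::].
Definition tensor_add (t u : tensor) := to_tensor (tensor_repr t ++ tensor_repr u).
Definition tensor_scale (a : K) (t : tensor) := to_tensor (seq_scale a (tensor_repr t)).
Definition tensor_opp (t : tensor) := tensor_scale (-1) t.

Lemma to_tensorD s t : to_tensor (s ++ t) = tensor_add (to_tensor s) (to_tensor t).
Proof.
by apply/esym/to_tensorP; apply: tensor_eq_cat; apply: tensor_repr_to.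
Qed.

Lemma to_tensorZ a s : to_tensor (seq_scale a s) = tensor_scale a (to_tensor s).
Proof. by apply/esym/to_tensorP/tensor_eq_scale/tensor_repr_to. Qed.

Lemma tensor_addA : associative tensor_add.
Proof.
by elim/tensorW => u; elim/tensorW => v; elim/tensorW => w; rewrite -!to_tensorD catA.
Qed.
Lemma tensor_addC : commutative tensor_add.
Proof.
elim/tensorW => u; elim/tensorW => v; rewrite -!to_tensorD.
by apply/to_tensorP/tensor_eq_catC.
Qed.
Lemma tensor_add0 : left_id tensor_zero tensor_add.
Proof. by elim/tensorW => u; rewrite -to_tensorD. Qed.

Lemma tensor_scaleDl t : {morph tensor_scale^~ t : a b / a + b >-> tensor_add a b}.
Proof.
move=> a b; elim/tensorW: t => s; rewrite -!to_tensorZ -to_tensorD.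
apply/to_tensorP; elim: s => [|[m n] s IH] /=; first exact: tensor_eq_refl.
rewrite scalerDl.
apply: (@tensor_eq_trans _
  ([:: (a *: m, n); (b *: m, n)] ++ (seq_scale a s ++ seq_scale b s))).
  by apply: (@tensor_eq_cat [:: _]) => //; apply: tensor_eq_Dl.
rewrite /=; apply: tensor_eq_consD.
rewrite -cat_cons -(cat1s _ (seq_scale b s)) catA.
apply: tensor_eq_cat; last exact: tensor_eq_refl.
by rewrite -cat1s; apply: tensor_eq_catC.
Qed.

Lemma tensor_scale0 t : tensor_scale 0 t = tensor_zero.
Proof.
elim/tensorW: t => s; rewrite -to_tensorZ; apply/to_tensorP.
elim: s => [|[m n] s IH] /=; first exact: tensor_eq_refl.
rewrite scale0r; apply: (@tensor_eq_cat [:: _] [::]) => //.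
exact: tensor_eq_0.
Qed.

Lemma tensor_scale1 : left_id 1 tensor_scale.
Proof.
elim/tensorW => s; rewrite -to_tensorZ; congr to_tensor.
by elim: s => [|[m n] s IH] //=; rewrite IH scale1r.
Qed.

Lemma tensor_addN : left_inverse tensor_zero tensor_opp tensor_add.
Proof.
move=> t; rewrite -[X in tensor_add _ X]tensor_scale1 /tensor_opp.
by rewrite -tensor_scaleDl addNr tensor_scale0.
Qed.

HB.instance Definition _ := GRing.isZmodule.Build tensor
  tensor_addA tensor_addC tensor_add0 tensor_addN.

Lemma to_tensor_cat s t : to_tensor (s ++ t) = to_tensor s + to_tensor t.
Proof. exact: to_tensorD. Qed.

Lemma tensor_scaleA a b t : tensor_scale a (tensor_scale b t) = tensor_scale (a * b) t.
Proof.
elim/tensorW: t => s; rewrite -!to_tensorZ /seq_scale -map_comp; congr to_tensor.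
by apply: eq_map => p /=; rewrite scalerA.
Qed.

Lemma tensor_scaleDr : right_distributive tensor_scale +%R.
Proof.
move=> a; elim/tensorW => u; elim/tensorW => v.
by rewrite -to_tensor_cat -!to_tensorZ -to_tensor_cat /seq_scale map_cat.
Qed.

HB.instance Definition _ := GRing.Zmodule_isLmodule.Build K tensor
  tensor_scaleA tensor_scale1 tensor_scaleDr tensor_scaleDl.

Lemma to_tensor_sum s : to_tensor s = \sum_(p <- s) tens p.1 p.2.
Proof.
elim: s => [|[m n] s IH]; first by rewrite big_nil.
by rewrite big_cons -IH -to_tensor_cat.
Qed.

Lemma tensor_sum t : t = \sum_(p <- tensor_repr t) tens p.1 p.2.
Proof. by rewrite -to_tensor_sum tensor_reprK. Qed.

Lemma tensDl m m' n : tens (m + m') n = tens m n + tens m' n.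
Proof. by rewrite -to_tensor_cat; apply/to_tensorP/tensor_eq_Dl. Qed.

Lemma tensDr m n n' : tens m (n + n') = tens m n + tens m n'.
Proof. by rewrite -to_tensor_cat; apply/to_tensorP/tensor_eq_Dr. Qed.

Lemma tensZl a m n : tens (a *: m) n = a *: tens m n.
Proof. by rewrite [RHS]/GRing.scale/= -to_tensorZ. Qed.

Lemma tensZr a m n : tens m (a *: n) = a *: tens m n.
Proof. by rewrite -tensZl; apply/esym/to_tensorP/tensor_eq_Z. Qed.

End tensor.

Record bilinear_map (K : comNzRingType) (M N W : lmodType K) (f : M -> N -> W)
    : Prop := {
  bilDl : forall m m' n, f (m + m') n = f m n + f m' n;
  bilDr : forall m n n', f m (n + n') = f m n + f m n';
  bilZl : forall a m n, f (a *: m) n = a *: f m n;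
  bilZr : forall a m n, f m (a *: n) = a *: f m n }.

Lemma tens_bilinear (K : comNzRingType) (M N : lmodType K) :
  bilinear_map (@tens K M N).
Proof.
by split; [exact: tensDl|exact: tensDr|exact: tensZl|exact: tensZr].
Qed.

Definition tensor_lift (K : comNzRingType) (M N W : lmodType K)
    (f : M -> N -> W) (t : tensor M N) : W :=
  \sum_(p <- tensor_repr t) f p.1 p.2.

Section tensor_lift.
Context (K : comNzRingType) (M N W : lmodType K) (f : M -> N -> W).
Context (f_bil : bilinear_map f).

Lemma tensor_eq_lift s t : tensor_eq s t ->
  \sum_(p <- s) f p.1 p.2 = \sum_(p <- t) f p.1 p.2.
Proof.
have f0 n : f 0 n = 0 by rewrite -(scale0r 0) (bilZl f_bil) scale0r.
elim=> {s t} //.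
- by move=> s t u _ -> _ ->.
- by move=> s s' t t' _ h1 _ h2; rewrite !big_cat/= h1 h2.
- by move=> s t; rewrite !big_cat/= addrC.
- by move=> m m' n; rewrite !big_cons !big_nil !addr0 (bilDl f_bil).
- by move=> m n n'; rewrite !big_cons !big_nil !addr0 (bilDr f_bil).
- by move=> a m n; rewrite !big_cons !big_nil !addr0 (bilZl f_bil) (bilZr f_bil).
- by move=> n; rewrite !big_cons !big_nil f0 addr0.
Qed.

Lemma tensor_lift_to s : tensor_lift f (to_tensor s) = \sum_(p <- s) f p.1 p.2.
Proof. by apply: tensor_eq_lift; apply: tensor_repr_to. Qed.

Lemma tensor_lift_tens m n : tensor_lift f (tens m n) = f m n.
Proof. by rewrite tensor_lift_to big_cons big_nil addr0. Qed.

Lemma tensor_lift_linear : linear (tensor_lift f).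
Proof.
move=> a u v; elim/(@tensorW K M N): u => s; elim/(@tensorW K M N): v => t.
have -> : a *: to_tensor s = to_tensor (seq_scale a s).
  by rewrite [LHS]/GRing.scale/= -to_tensorZ.
rewrite -to_tensor_cat !tensor_lift_to big_cat/=; congr (_ + _).
rewrite big_map scaler_sumr; apply: eq_bigr => p _ /=.
by rewrite (bilZl f_bil).
Qed.

End tensor_lift.


(* Naming R[i] makes all its structures (field, norm, topology) be inferred
   along one path, starting from numClosedFieldType. *)
Definition C (R : realType) : numClosedFieldType := R[i].

Section real_to_complex.
Context {R : realType}.
Implicit Types x y : R.

Definition toC (x : R) : C R := x%:C.
Definition ReC (z : C R) : R := complex.Re (z : R[i]).

Lemma toCK x : ReC (toC x) = x.
Proof. by []. Qed.

Lemma toC_inj : injective toC.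
Proof. by move=> x y; apply: complexI. Qed.

Lemma toC_le x y : (toC x <= toC y) = (x <= y).
Proof. exact: lecR. Qed.

Lemma toC_lt x y : (toC x < toC y) = (x < y).
Proof. exact: ltcR. Qed.

Lemma toC0 : toC 0 = 0.
Proof. by []. Qed.

Lemma toCD x y : toC (x + y) = toC x + toC y.
Proof. exact: (rmorphD (real_complex R)). Qed.

Lemma toCM x y : toC (x * y) = toC x * toC y.
Proof. exact: (rmorphM (real_complex R)). Qed.

Lemma ReCK (z : C R) : 0 <= z -> toC (ReC z) = z.
Proof.
move=> z0; apply/esym; have : (0 : R[i]) <= z by exact: z0.
by case: z {z0} => a b; rewrite lecE/= => /andP[/eqP-> _].
Qed.

Lemma ReC_gt0 (z : C R) : 0 < z -> 0 < ReC z.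
Proof. by move=> z0; rewrite -toC_lt ReCK ?ltW. Qed.

Lemma ReC1 : ReC 1 = 1.
Proof. by []. Qed.

End real_to_complex.

Section rnorm.
Context {R : realType} {V : normedModType (C R)}.
Implicit Types u v : V.

(* The norm of a normed module over C R takes its values in C R; rnorm is the
   same norm, seen in R. *)
Definition rnorm v : R := ReC `|v|.

Lemma rnormE v : `|v| = toC (rnorm v).
Proof. by rewrite /rnorm ReCK. Qed.

Lemma rnorm_ge0 v : 0 <= rnorm v.
Proof. by rewrite -toC_le -rnormE toC0. Qed.

Lemma rnorm0 : rnorm 0 = 0.
Proof. by rewrite /rnorm normr0. Qed.

Lemma rnorm_eq0 v : rnorm v = 0 -> v = 0.
Proof. by move=> v0; apply/normr0_eq0; rewrite rnormE v0. Qed.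

Lemma rnormD u v : rnorm (u + v) <= rnorm u + rnorm v.
Proof. by rewrite -toC_le toCD -!rnormE; apply: ler_normD. Qed.

Lemma rnormN v : rnorm (- v) = rnorm v.
Proof. by rewrite /rnorm normrN. Qed.

Lemma rnormB u v : rnorm (u - v) = rnorm (v - u).
Proof. by rewrite /rnorm distrC. Qed.

End rnorm.

Lemma rnormZ {R : realType} {V : normedModType (C R)} (a : C R) (v : V) :
  rnorm (a *: v) = rnorm a * rnorm v.
Proof. by apply: toC_inj; rewrite toCM -!rnormE normrZ. Qed.

Lemma rnorm1 {R : realType} : rnorm (1 : C R) = 1.
Proof. by rewrite /rnorm normr1 ReC1. Qed.

Lemma nbhs_rnormP {R : realType} {V : normedModType (C R)} (v : V) (W : set V) :
  nbhs v W <-> exists2 e : R, 0 < e & forall w, rnorm (v - w) < e -> W w.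
Proof.
split=> [/nbhs_normP[e/= e0 eW]|[e e0 eW]].
  exists (ReC e); first exact: ReC_gt0.
  move=> w vw; apply: eW => /=.
  by rewrite -(ReCK (ltW e0)) rnormE toC_lt.
apply/nbhs_normP; exists (toC e) => /=; first by rewrite -toC0 toC_lt.
by move=> w /=; rewrite rnormE toC_lt; apply: eW.
Qed.

Definition rcauchy {R : realType} {T : zmodType} (p : T -> R) (u : nat -> T) :=
  forall e, 0 < e -> exists k : nat, forall m n : nat,
    (k <= m)%N -> (k <= n)%N -> p (u m - u n) < e.

Definition rcvg {R : realType} {T : zmodType} (p : T -> R) (u : nat -> T) (l : T) :=
  forall e, 0 < e -> exists k : nat, forall n : nat, (k <= n)%N -> p (u n - l) < e.

Lemma rnorm_complete {R : realType} {V : normedModType (C R)} :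
  (forall u : nat -> V, rcauchy (@rnorm _ V) u -> exists l, rcvg (@rnorm _ V) u l) ->
  forall F : set_system V, ProperFilter F -> cauchy F -> cvg F.
Proof.
move=> V_cvg F FF /cauchyP Fc.
pose h (n : nat) : R := n.+1%:R^-1.
have h0 n : 0 < h n by rewrite invr_gt0 ltr0n.
have hh e : 0 < e -> exists k : nat, forall n, (k <= n)%N -> h n < e.
  move=> e0; exists (Num.bound e^-1) => n kn.
  rewrite /h -[e]invrK ltf_pV2 ?posrE ?invr_gt0 ?ltr0n//.
  apply: (lt_le_trans (archi_boundP _)); first by rewrite invr_ge0 ltW.
  by rewrite ler_nat; apply: leq_trans kn _.
have /choice[u Fu] : forall n, exists x : V, F [set y | rnorm (x - y) < h n].
  move=> n; have [|x Fx] := Fc (toC (h n)); first by rewrite -toC0 toC_lt.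
  exists x; apply: filterS Fx => y; rewrite -ball_normE/=.
  by rewrite rnormE toC_lt.
have u_near m n : rnorm (u m - u n) < h m + h n.
  have [y [ym yn]] := filter_ex (filterI (Fu m) (Fu n)).
  rewrite -[_ - _](subrKA y); apply: le_lt_trans (rnormD _ _) _.
  by apply: ltrD => //; rewrite rnormB.
have [e e0|l ul] := V_cvg u.
  have [k kh] := hh (e / 2) (divr_gt0 e0 (ltr0n _ 2)).
  exists k => m n km kn; apply: lt_trans (u_near m n) _.
  by rewrite [e]splitr ltrD ?kh.
apply/cvg_ex; exists l => W /nbhs_rnormP[e e0 eW].
have e20 : 0 < e / 2 by rewrite divr_gt0.
have [k kh] := hh _ e20; have [k' k'l] := ul _ e20.
apply: filterS (Fu (maxn k k')) => y uy; apply: eW.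
rewrite -[_ - _](subrKA (u (maxn k k'))) [e]splitr; apply: le_lt_trans (rnormD _ _) _.
apply: ltrD; first by rewrite rnormB k'l// leq_maxr.
by apply: lt_trans uy _; rewrite kh// leq_maxl.
Qed.

Record seminorm (R : realType) (V : lmodType (C R)) := Seminorm {
  seminorm_fun :> V -> R;
  seminormD : forall u v, seminorm_fun (u + v) <= seminorm_fun u + seminorm_fun v;
  seminormZ : forall a v, seminorm_fun (a *: v) = rnorm a * seminorm_fun v }.

Section seminorm.
Context {R : realType} {V : lmodType (C R)} (p : seminorm V).

Lemma seminorm0 : p 0 = 0.
Proof. by rewrite -(scale0r 0) seminormZ rnorm0 mul0r. Qed.

Lemma seminormN v : p (- v) = p v.
Proof. by rewrite -scaleN1r seminormZ rnormN rnorm1 mul1r. Qed.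

Lemma seminormB u v : p (u - v) = p (v - u).
Proof. by rewrite -seminormN opprB. Qed.

Lemma seminorm_ge0 v : 0 <= p v.
Proof.
have := seminormD p v (- v); rewrite subrr seminorm0 seminormN -mulr2n.
by rewrite pmulrn_lge0.
Qed.

Lemma seminorm_dist u v : `|p u - p v| <= p (u - v).
Proof.
rewrite ler_norml; apply/andP; split; last first.
  by rewrite lerBlDr; apply: le_trans (seminormD _ _ _); rewrite subrK.
rewrite lerNl opprB lerBlDr seminormB.
by apply: le_trans (seminormD _ _ _); rewrite subrK.
Qed.

Definition cauchy_pred : {pred nat -> V} := [pred u | `[< rcauchy p u >]].

Lemma cauchy_pred_closed : submod_closed cauchy_pred.
Proof.
split=> [|a u v /asboolP uc /asboolP vc]; apply/asboolP => e e0.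
  by exists 0 => m n _ _; rewrite subrr seminorm0.
have a0 := rnorm_ge0 a.
have e20 : 0 < e / 2 by rewrite divr_gt0.
have [|k ku] := uc (e / 2 / (rnorm a + 1)).
  by rewrite divr_gt0// ltr_wpDl.
have [k' kv] := vc _ e20.
exists (maxn k k') => m n; rewrite !geq_max => /andP[km k'm] /andP[kn k'n].
have -> : (a *: u + v) m - (a *: u + v) n = a *: (u m - u n) + (v m - v n).
  by rewrite scalerBr opprD addrACA.
apply: le_lt_trans (seminormD _ _ _) _; rewrite seminormZ [e]splitr.
apply: ler_ltD; last exact: kv.
apply: (@le_trans _ _ ((rnorm a + 1) * p (u m - u n))).
  by rewrite ler_wpM2r ?seminorm_ge0// lerDl.
by rewrite mulrC -ler_pdivlMr ?ltr_wpDl// ltW// ku.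
Qed.

HB.instance Definition _ :=
  GRing.isSubmodClosed.Build (C R) (nat -> V) cauchy_pred cauchy_pred_closed.

Record cauchy_seq := CauchySeq {
  cauchy_fun :> nat -> V;
  _ : cauchy_fun \in cauchy_pred }.

HB.instance Definition _ := [isSub for cauchy_fun].
HB.instance Definition _ := [Choice of cauchy_seq by <:].
HB.instance Definition _ := [SubChoice_isSubLmodule of cauchy_seq by <:].

Lemma cauchy_seqP (u : cauchy_seq) : rcauchy p u.
Proof. by case: u => u /= /asboolP. Qed.

Lemma cauchy_seqD (u v : cauchy_seq) n : (u + v) n = u n + v n.
Proof. by []. Qed.
Lemma cauchy_seqN (u : cauchy_seq) n : (- u) n = - u n.
Proof. by []. Qed.
Lemma cauchy_seqZ a (u : cauchy_seq) n : (a *: u) n = a *: u n.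
Proof. by []. Qed.

Definition null_set : set cauchy_seq := [set u | rcvg p u 0].

Lemma null_set0 : null_set 0.
Proof. by move=> e e0; exists 0 => n _; rewrite subrr seminorm0. Qed.

Lemma null_setD u v : null_set u -> null_set v -> null_set (u + v).
Proof.
move=> u0 v0 e e0; have e20 : 0 < e / 2 by rewrite divr_gt0.
have [k ku] := u0 _ e20; have [k' kv] := v0 _ e20.
exists (maxn k k') => n; rewrite geq_max => /andP[kn k'n].
rewrite cauchy_seqD subr0 [e]splitr; apply: le_lt_trans (seminormD _ _ _) _.
by rewrite ltrD// -[X in p X]subr0 ?ku ?kv.
Qed.

Lemma null_setZ a u : null_set u -> null_set (a *: u).
Proof.
move=> u0 e e0; have a0 := rnorm_ge0 a.
have [|k ku] := u0 (e / (rnorm a + 1)); first by rewrite divr_gt0// ltr_wpDl.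
exists k => n kn; rewrite cauchy_seqZ subr0 seminormZ.
apply: (@le_lt_trans _ _ ((rnorm a + 1) * p (u n))).
  by rewrite ler_wpM2r ?seminorm_ge0// lerDl.
by rewrite mulrC -ltr_pdivlMr ?ltr_wpDl// -[X in p X]subr0 ku.
Qed.

Definition null_seqs : submodule cauchy_seq :=
  Submodule null_set0 null_setD null_setZ.

(* The Hausdorff completion of V for the seminorm p: Cauchy sequences modulo
   sequences tending to 0, with norm the limit of p along the sequence. *)
Definition completion := lquot null_seqs.

HB.instance Definition _ := GRing.Lmodule.on completion.

Definition completion_norm (q : completion) : R :=
  limn (fun n => p (quot_repr q n)).

Definition to_completion (u : cauchy_seq) : completion := to_quot null_seqs u.

Lemma seminorm_cvg (u : cauchy_seq) : cvgn (fun n => p (u n)).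
Proof.
apply/cauchy_cvgP/cauchy_ballP => e e0; rewrite !near_simpl.
have [k ku] := cauchy_seqP u e0.
exists ([set n | (k <= n)%N], [set n | (k <= n)%N]) => /=.
  by split; exists k.
move=> [m n]/= [km kn]; rewrite /ball/=.
by apply: le_lt_trans (seminorm_dist _ _) _; apply: ku.
Qed.

Lemma null_lim (u v : cauchy_seq) : null_seqs (u - v) ->
  limn (fun n => p (u n)) = limn (fun n => p (v n)).
Proof.
move=> uv; apply/cvg_lim => //.
have : (fun n => p (v n)) @ \oo --> limn (fun n => p (v n)) by apply: seminorm_cvg.
move=> /cvgrPdist_lt vl; apply/cvgrPdist_lt => e e0.
have e20 : 0 < e / 2 by rewrite divr_gt0.
have [k kuv] := uv _ e20.
near=> n.
rewrite -(subrKA (p (v n))) [e]splitr.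
apply: le_lt_trans (ler_normD _ _) _; apply: ltrD.
  by near: n; apply: vl.
apply: le_lt_trans (seminorm_dist _ _) _; rewrite seminormB.
rewrite -[X in p X]subr0; apply: kuv.
by near: n; exists k.
Unshelve. all: by end_near. Qed.

Lemma completion_normE u :
  completion_norm (to_completion u) = limn (fun n => p (u n)).
Proof. by apply: null_lim; apply: quot_repr_to. Qed.

Lemma completionW (P : completion -> Prop) :
  (forall u, P (to_completion u)) -> forall q, P q.
Proof. exact: lquotW. Qed.

Lemma to_completionD u v :
  to_completion (u + v) = to_completion u + to_completion v.
Proof. exact: to_quotD. Qed.

Lemma to_completionZ a u : to_completion (a *: u) = a *: to_completion u.
Proof. exact: to_quotZ. Qed.

Lemma completion_normD u v :
  completion_norm (u + v) <= completion_norm u + completion_norm v.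
Proof.
elim/completionW: u => u; elim/completionW: v => v.
rewrite -to_completionD !completion_normE -limD//; try exact: seminorm_cvg.
apply: ler_lim; first exact: seminorm_cvg.
  by apply: is_cvgD; apply: seminorm_cvg.
by apply: nearW => n; apply: seminormD.
Qed.

Lemma completion_normZ a u :
  completion_norm (a *: u) = rnorm a * completion_norm u.
Proof.
elim/completionW: u => u.
rewrite -to_completionZ !completion_normE.
transitivity (limn (fun n => rnorm a * p (u n))).
  by congr (limn _); apply/funext => n; rewrite cauchy_seqZ seminormZ.
by apply: cvg_lim => //; apply: cvgMr; apply: seminorm_cvg.
Qed.

Lemma completion_norm_eq0 u : completion_norm u = 0 -> u = 0.
Proof.
elim/completionW: u => u; rewrite completion_normE => u0.
apply/(@to_quotP _ _ null_seqs); rewrite subr0 => e e0.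
have : (fun n => p (u n)) @ \oo --> limn (fun n => p (u n)) by apply: seminorm_cvg.
rewrite u0 => /cvgrPdist_lt/(_ _ e0)[k _ ku]; exists k => n kn.
rewrite subr0; have := ku _ kn; rewrite sub0r normrN ger0_norm//.
exact: seminorm_ge0.
Qed.

Let cnorm (u : completion) : (C R) := toC (completion_norm u).

Let cnormD u v : cnorm (u + v) <= cnorm u + cnorm v.
Proof. by rewrite /cnorm -toCD toC_le completion_normD. Qed.

Let cnormZ a u : cnorm (a *: u) = `|a| * cnorm u.
Proof. by rewrite /cnorm completion_normZ toCM -rnormE. Qed.

Let cnorm_eq0 u : cnorm u = 0 -> u = 0.
Proof. by move/toC_inj/completion_norm_eq0. Qed.

HB.instance Definition _ :=
  Lmodule_isNormed.Build (C R) completion cnormD cnormZ cnorm_eq0.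

Lemma completion_rnormE (q : completion) : rnorm q = completion_norm q.
Proof. exact: toCK. Qed.

Lemma const_cauchy v : (fun _ : nat => v) \in cauchy_pred.
Proof.
by apply/asboolP => e e0; exists 0 => m n _ _; rewrite subrr seminorm0.
Qed.

Definition compl (v : V) : completion := to_completion (CauchySeq (const_cauchy v)).

Lemma compl_linear : linear compl.
Proof.
move=> a u v; rewrite /compl -to_completionZ -to_completionD.
by congr to_completion; apply/val_inj.
Qed.

HB.instance Definition _ := GRing.isLinear.Build (C R) V completion _ compl compl_linear.

Lemma compl_norm v : rnorm (compl v) = p v.
Proof.
rewrite completion_rnormE completion_normE; apply: cvg_lim => //.
exact: (@cvg_cst R (p v)).
Qed.

Lemma compl_cvg (u : cauchy_seq) : rcvg (@rnorm _ completion)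
  (fun n => compl (u n)) (to_completion u).
Proof.
move=> e e0; have e20 : 0 < e / 2 by rewrite divr_gt0.
have [k ku] := cauchy_seqP u e20; exists k => n kn.
have -> : compl (u n) - to_completion u =
    to_completion (CauchySeq (const_cauchy (u n)) - u).
  by rewrite to_completionD; congr (_ + _); apply/esym/to_quotN.
rewrite completion_rnormE completion_normE; apply: (@le_lt_trans _ _ (e / 2)).
  apply: limr_le; first exact: seminorm_cvg.
  by exists k => // m /= km; apply/ltW; exact: ku.
by rewrite ltr_pdivrMr// ltr_pMr// ltr1n.
Qed.

Lemma compl_dense (q : completion) e : 0 < e -> exists v, rnorm (compl v - q) < e.
Proof.
move=> e0; elim/completionW: q => u; have [k ku] := compl_cvg u e0.
by exists (u k); apply: ku.
Qed.

Lemma completion_complete (F : set_system completion) :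
  ProperFilter F -> cauchy F -> cvg F.
Proof.
apply: rnorm_complete F => w w_cauchy.
pose h (n : nat) : R := n.+1%:R^-1.
have h0 n : 0 < h n by rewrite invr_gt0 ltr0n.
have hh e : 0 < e -> exists k : nat, forall n, (k <= n)%N -> h n < e.
  move=> e0; exists (Num.bound e^-1) => n kn.
  rewrite /h -[e]invrK ltf_pV2 ?posrE ?invr_gt0 ?ltr0n//.
  apply: (lt_le_trans (archi_boundP _)); first by rewrite invr_ge0 ltW.
  by rewrite ler_nat; apply: leq_trans kn _.
have /choice[v vw] : forall n, exists v, rnorm (compl v - w n) < h n.
  by move=> n; apply: compl_dense.
have e3 (e : R) : 0 < e -> 0 < e / 3 by move=> ?; rewrite divr_gt0.
have v_cauchy : v \in cauchy_pred.
  apply/asboolP => e e0.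
  have [k kw] := w_cauchy _ (e3 _ e0); have [k' kh] := hh _ (e3 _ e0).
  exists (maxn k k') => m n; rewrite !geq_max => /andP[km k'm] /andP[kn k'n].
  rewrite -compl_norm linearB/=.
  have -> : compl (v m) - compl (v n) =
    (compl (v m) - w m) + (w m - w n) + (w n - compl (v n)).
    by rewrite subrKA subrKA.
  have h1 := lt_trans (vw m) (kh _ k'm).
  have h2 := lt_trans (vw n) (kh _ k'n).
  have h3 := kw _ _ km kn; rewrite rnormB in h2.
  have := rnormD ((compl (v m) - w m) + (w m - w n)) (w n - compl (v n)).
  have := rnormD (compl (v m) - w m) (w m - w n).
  lra.
exists (to_completion (CauchySeq v_cauchy)) => e e0.
have e20 : 0 < e / 2 by rewrite divr_gt0.
have [k kv] := compl_cvg (CauchySeq v_cauchy) e20; have [k' kh] := hh _ e20.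
exists (maxn k k') => n; rewrite geq_max => /andP[kn k'n].
rewrite -(subrKA (compl (v n))) [e]splitr; apply: le_lt_trans (rnormD _ _) _.
apply: ltrD; last exact: kv.
by rewrite rnormB; apply: lt_trans (vw n) _; apply: kh.
Qed.

HB.instance Definition _ := Uniform_isComplete.Build completion completion_complete.

End seminorm.


Section ptensor.
Context {R : realType} (M N : normedModType (C R)).

Definition tensor_cost (s : seq (M * N)) : R :=
  \sum_(p <- s) rnorm p.1 * rnorm p.2.

Definition tensor_costs (t : tensor M N) : set R :=
  [set tensor_cost s | s in [set s | to_tensor s = t]].

(* The projective norm: the infimum of sum |mi| |ni| over all representations
   of t as sum mi (x) ni. *)
Definition proj_norm (t : tensor M N) : R := inf (tensor_costs t).

Lemma tensor_cost_ge0 s : 0 <= tensor_cost s.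
Proof. by apply: sumr_ge0 => p _; rewrite mulr_ge0 ?rnorm_ge0. Qed.

Lemma tensor_cost_cat s t : tensor_cost (s ++ t) = tensor_cost s + tensor_cost t.
Proof. by rewrite /tensor_cost big_cat. Qed.

Lemma tensor_cost_scale a s : tensor_cost (seq_scale a s) = rnorm a * tensor_cost s.
Proof.
rewrite /tensor_cost /seq_scale big_map big_distrr/=.
by apply: eq_bigr => p _; rewrite rnormZ mulrA.
Qed.

Lemma tensor_costs_inf t : has_inf (tensor_costs t).
Proof.
split; first by exists (tensor_cost (tensor_repr t)), (tensor_repr t); rewrite /= ?tensor_reprK.
by exists 0 => _ [s _ <-]; apply: tensor_cost_ge0.
Qed.

Lemma proj_norm_le s : proj_norm (to_tensor s) <= tensor_cost s.
Proof.
apply: ge_inf; first by have [] := tensor_costs_inf (to_tensor s).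
by exists s.
Qed.

Lemma proj_norm_ge0 t : 0 <= proj_norm t.
Proof.
apply: lb_le_inf; first by have [] := tensor_costs_inf t.
by move=> _ [s _ <-]; apply: tensor_cost_ge0.
Qed.

Lemma proj_norm_adherent t e : 0 < e ->
  exists2 s, to_tensor s = t & tensor_cost s < proj_norm t + e.
Proof.
move=> e0; have [_ [s st <-] se] := inf_adherent e0 (tensor_costs_inf t).
by exists s.
Qed.

Lemma proj_normD t u : proj_norm (t + u) <= proj_norm t + proj_norm u.
Proof.
apply/ler_addgt0Pr => e e0; have e20 : 0 < e / 2 by rewrite divr_gt0.
have [s <- se] := proj_norm_adherent t e20.
have [s' <- se'] := proj_norm_adherent u e20.
rewrite -to_tensor_cat; apply: le_trans (proj_norm_le _) _.
by rewrite tensor_cost_cat; lra.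
Qed.

Let proj_normZ_le a t : proj_norm (a *: t) <= rnorm a * proj_norm t.
Proof.
apply/ler_addgt0Pr => e e0; have a0 := rnorm_ge0 a.
have a10 : 0 < rnorm a + 1 by rewrite ltr_wpDl.
have ea0 : 0 < e / (rnorm a + 1) by rewrite divr_gt0.
have [s st se] := proj_norm_adherent t ea0.
rewrite -[in leLHS]st [X in proj_norm X]/GRing.scale/= -to_tensorZ.
apply: le_trans (proj_norm_le _) _; rewrite tensor_cost_scale.
apply: le_trans (ler_wpM2l a0 (ltW se)) _; rewrite mulrDr lerD2l.
by rewrite mulrCA ger_pMr// ler_pdivrMr// mul1r lerDl.
Qed.

Lemma proj_normZ a t : proj_norm (a *: t) = rnorm a * proj_norm t.
Proof.
apply/eqP; rewrite eq_le proj_normZ_le/=.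
have [->|a0] := eqVneq a 0; first by rewrite rnorm0 mul0r proj_norm_ge0.
have ra0 : 0 < rnorm a.
  rewrite lt_neqAle rnorm_ge0 andbT eq_sym.
  by apply: contra_neq a0 => /rnorm_eq0.
rewrite -ler_pdivlMl//.
have -> : (rnorm a)^-1 = rnorm a^-1.
  apply: (mulfI (lt0r_neq0 ra0)); rewrite divff ?lt0r_neq0//.
  by rewrite -rnormZ /GRing.scale/= divff// rnorm1.
by apply: le_trans (proj_normZ_le _ _); rewrite scalerA mulVf// scale1r.
Qed.

Definition proj_seminorm : seminorm (tensor M N) := Seminorm proj_normD proj_normZ.

Definition ptensor := completion proj_seminorm.

Definition ptens (m : M) (n : N) : ptensor := compl proj_seminorm (tens m n).

Lemma ptens_bilinear : bilinear_map ptens.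
Proof.
split.
- by move=> m m' n; rewrite /ptens tensDl linearD.
- by move=> m n n'; rewrite /ptens tensDr linearD.
- by move=> a m n; rewrite /ptens tensZl linearZ.
- by move=> a m n; rewrite /ptens tensZr linearZ.
Qed.

Lemma ptens_norm_le m n : rnorm (ptens m n) <= rnorm m * rnorm n.
Proof.
rewrite compl_norm; apply: le_trans (proj_norm_le _) _.
by rewrite /tensor_cost big_cons big_nil addr0.
Qed.

End ptensor.

Lemma rcvg_cvg {R : realType} {V : normedModType (C R)} (u : nat -> V) l :
  rcvg (@rnorm _ V) u l -> u @ \oo --> l.
Proof.
move=> ul W /nbhs_rnormP[e e0 eW]; have [k ku] := ul _ e0.
by exists k => // n /= kn; apply: eW; rewrite rnormB ku.
Qed.

Lemma rcauchy_cvg {R : realType} {V : completeNormedModType (C R)} (u : nat -> V) :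
  rcauchy (@rnorm _ V) u -> cvgn u.
Proof.
move=> uc; apply/cauchy_cvgP/cauchy_ballP => e e0; have [k ku] := uc _ (ReC_gt0 e0); rewrite !near_simpl.
exists ([set n | (k <= n)%N], [set n | (k <= n)%N]) => /=.
  by split; exists k.
move=> [m n]/= [km kn]; rewrite -ball_normE/=.
by rewrite -(ReCK (ltW e0)) rnormE toC_lt; apply: ku.
Qed.

Lemma cvg_rcvg {R : realType} {V : normedModType (C R)} (u : nat -> V) l :
  u @ \oo --> l -> rcvg (@rnorm _ V) u l.
Proof.
move=> ul e e0.
have [|k _ ku] := ul [set w | rnorm (l - w) < e].
  by apply/nbhs_rnormP; exists e.
by exists k => n kn; rewrite rnormB; apply: ku.
Qed.

(* The continuous linear map induced by a bounded bilinear f, computed on a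
   Cauchy sequence representing q; see ptensor_lift_ptens, ptensor_lift_linear
   and ptensor_lift_norm. *)
Definition ptensor_lift (R : realType) (M N : normedModType (C R))
    (G : completeNormedModType (C R)) (f : M -> N -> G) (q : ptensor M N) : G :=
  lim ((fun n => tensor_lift f (quot_repr q n)) @ \oo).

Section ptensor_lift.
Context {R : realType} (M N : normedModType (C R)).
Context (G : completeNormedModType (C R)) (f : M -> N -> G).
Context (f_bil : bilinear_map f).
Context (f_norm : forall m n, rnorm (f m n) <= rnorm m * rnorm n).

Lemma tensor_liftB t u :
  tensor_lift f (t - u) = tensor_lift f t - tensor_lift f u.
Proof. exact: (zmod_morphism_linear (tensor_lift_linear f_bil)). Qed.

Lemma tensor_lift_norm t : rnorm (tensor_lift f t) <= proj_norm t.
Proof.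
apply/ler_addgt0Pr => e e0; have [s <- se] := proj_norm_adherent t e0.
rewrite tensor_lift_to//; apply: le_trans (ltW se).
rewrite /tensor_cost; elim: s {se} => [|p s IH].
  by rewrite !big_nil rnorm0.
rewrite !big_cons; apply: le_trans (rnormD _ _) _.
by apply: lerD.
Qed.

Lemma tensor_lift_cauchy (u : cauchy_seq (proj_seminorm M N)) :
  cvgn (fun n => tensor_lift f (u n)).
Proof.
apply: rcauchy_cvg => e e0; have [k ku] := cauchy_seqP u e0; exists k => m n km kn.
rewrite -tensor_liftB; apply: le_lt_trans (tensor_lift_norm _) _.
exact: ku.
Qed.

Lemma ptensor_liftE (u : cauchy_seq (proj_seminorm M N)) :
  ptensor_lift f (to_completion u) = lim ((fun n => tensor_lift f (u n)) @ \oo).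
Proof.
apply/cvg_lim => //; set v := quot_repr _.
have vu : null_seqs _ (v - u) by apply: quot_repr_to.
have ul := cvg_rcvg (tensor_lift_cauchy (u := u)).
apply: rcvg_cvg => e e0; have e20 : 0 < e / 2 by rewrite divr_gt0.
have [k ku] := ul _ e20; have [k' kvu] := vu _ e20.
exists (maxn k k') => n; rewrite geq_max => /andP[kn k'n].
rewrite -(subrKA (tensor_lift f (u n))) [e]splitr; apply: le_lt_trans (rnormD _ _) _.
apply: ltrD; last exact: ku.
rewrite -tensor_liftB; apply: le_lt_trans (tensor_lift_norm _) _.
by have := kvu _ k'n; rewrite subr0.
Qed.

Lemma ptensor_lift_compl t : ptensor_lift f (compl _ t) = tensor_lift f t.
Proof.
rewrite ptensor_liftE; apply: cvg_lim => //.
exact: (@cvg_cst G (tensor_lift f t)).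
Qed.

Lemma ptensor_lift_ptens m n : ptensor_lift f (ptens m n) = f m n.
Proof. by rewrite ptensor_lift_compl tensor_lift_tens. Qed.

Lemma ptensor_lift_linear : linear (ptensor_lift f).
Proof.
move=> a x y; elim/(@completionW _ _ (proj_seminorm M N)): x => u.
elim/(@completionW _ _ (proj_seminorm M N)): y => v.
rewrite -to_completionZ -to_completionD !ptensor_liftE.
transitivity (lim ((fun n => a *: tensor_lift f (u n) + tensor_lift f (v n)) @ \oo)).
  by congr (lim (_ @ \oo)); apply/funext => n; rewrite -tensor_lift_linear.
apply: cvg_lim => //; apply: cvgD; last exact: tensor_lift_cauchy.
by apply: cvgZ; [apply: cvg_cst|apply: tensor_lift_cauchy].
Qed.

Lemma ptensor_lift_norm q : rnorm (ptensor_lift f q) <= rnorm q.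
Proof.
elim/(@completionW _ _ (proj_seminorm M N)): q => u; rewrite ptensor_liftE.
apply/ler_addgt0Pr => e e0; have e20 : 0 < e / 2 by rewrite divr_gt0.
have [k ku] := cvg_rcvg (tensor_lift_cauchy (u := u)) e20.
have [k' ku'] := compl_cvg u e20.
pose n := maxn k k'.
have := ku n (leq_maxl _ _); have := ku' n (leq_maxr _ _).
set l := lim _; set c := to_completion u => h1 h2.
rewrite rnormB in h2.
have h3 := rnormD (l - tensor_lift f (u n)) (tensor_lift f (u n)); rewrite subrK in h3.
have h4 := rnormD (compl _ (u n) - c) c; rewrite subrK compl_norm in h4.
have h5 := tensor_lift_norm (u n).
lra.
Qed.

End ptensor_lift.

Section closed_span.
Context {R : realType} {V : normedModType (C R)}.

Lemma closureP (A : set V) v :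
  closure A v <-> forall e : R, 0 < e -> exists2 a, A a & rnorm (v - a) < e.
Proof.
split=> [Av e e0|Av W /nbhs_rnormP[e e0 eW]].
  have [|a [Aa va]] := Av [set w | rnorm (v - w) < e]; last by exists a.
  by apply/nbhs_rnormP; exists e.
by have [a Aa va] := Av _ e0; exists a; split=> //; apply: eW.
Qed.

Section closure.
Context (S : submodule V).
Let cS : set V := closure [set v | S v].

Lemma closure_submodule0 : cS 0.
Proof. by apply: subset_closure; apply: submodule0. Qed.

Lemma closure_submoduleD u v : cS u -> cS v -> cS (u + v).
Proof.
move=> /closureP Su /closureP Sv; apply/closureP => e e0.
have e20 : 0 < e / 2 by rewrite divr_gt0.
have [a Sa ua] := Su _ e20; have [b Sb vb] := Sv _ e20.
exists (a + b); first exact: submoduleD.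
rewrite opprD addrACA [e]splitr; apply: le_lt_trans (rnormD _ _) _.
exact: ltrD.
Qed.

Lemma closure_submoduleZ a v : cS v -> cS (a *: v).
Proof.
move=> /closureP Sv; apply/closureP => e e0; have a0 := rnorm_ge0 a.
have [|b Sb vb] := Sv (e / (rnorm a + 1)); first by rewrite divr_gt0// ltr_wpDl.
exists (a *: b); first exact: submoduleZ.
rewrite -scalerBr rnormZ; apply: (@le_lt_trans _ _ ((rnorm a + 1) * rnorm (v - b))).
  by rewrite ler_wpM2r ?rnorm_ge0// lerDl.
by rewrite mulrC -ltr_pdivlMr// ltr_wpDl.
Qed.

Definition closure_submodule : submodule V :=
  Submodule closure_submodule0 closure_submoduleD closure_submoduleZ.

End closure.

Definition closed_span (A : set V) : submodule V := closure_submodule (span A).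

End closed_span.

Section balanced.
Context {R : realType} {A : Type} (M N : normedModType (C R)).
Context (aM : A -> M -> M) (aN : A -> N -> N).

Definition balancing (W : lmodType (C R)) (b : M -> N -> W) : set W :=
  [set w | exists a m n, w = b (aM a m) n - b m (aN a n)].

Definition brel : submodule (tensor M N) := span (balancing (@tens _ M N)).
Definition bprel : submodule (ptensor M N) := closed_span (balancing (@ptens _ M N)).

(* M (x)_A N, algebraic and completed, where A acts on M and N by aM and aN.
   The second is used only as a vector space, so it is given no norm. *)
Definition btensor := lquot brel.
Definition bptensor := lquot bprel.

Definition btens m n : btensor := to_quot brel (tens m n).
Definition bptens m n : bptensor := to_quot bprel (ptens m n).

(* Induced by M (x) N -> ptensor M N; see bcompl_to_quot. *)
Definition bcompl (q : btensor) : bptensor :=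
  to_quot bprel (compl (proj_seminorm M N) (quot_repr q)).

Lemma span_min (V : lmodType (C R)) (B : set V) (S : submodule V) v :
  (forall u, B u -> S u) -> span B v -> S v.
Proof. by move=> BS; apply. Qed.

Lemma bcompl_to_quot t : bcompl (to_quot brel t) = to_quot bprel (compl _ t).
Proof.
pose cs := bprel.
apply/(@to_quotP _ _ cs); rewrite -linearB/=.
have := quot_repr_to brel t.
move: (_ - t) => d dS.
pose S : submodule (tensor M N) := Submodule (submodule_set := cs \o compl _)
  ltac:(by rewrite /= linear0; exact: (submodule0 cs))
  ltac:(by move=> u v ? ?; rewrite /= linearD; exact: (submoduleD (s := cs)))
  ltac:(by move=> a v ?; rewrite /= linearZ; exact: (submoduleZ (s := cs))).
apply: (dS S) => _ [a [m [n ->]]] /=; rewrite linearB/=.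
by apply: subset_closure => S' /(_ _); apply; exists a, m, n.
Qed.

Lemma bcompl_btens m n : bcompl (btens m n) = bptens m n.
Proof. exact: bcompl_to_quot. Qed.

Lemma bcompl_linear : linear bcompl.
Proof.
move=> a x y; pose S := brel.
elim/(@lquotW _ _ S): x => u.
elim/(@lquotW _ _ S): y => v.
transitivity (bcompl (to_quot S (a *: u + v))).
  by congr bcompl; apply/esym/to_quot_is_linear.
rewrite !bcompl_to_quot.
have -> : compl (proj_seminorm M N) (a *: u + v) = a *: compl _ u + compl _ v.
  exact: compl_linear.
exact: to_quot_is_linear.
Qed.

End balanced.

(* Meaningful for f bounded bilinear and balanced; see bptensor_lift_to_quot. *)
Definition bptensor_lift (R : realType) (A : Type) (M N : normedModType (C R))
    (aM : A -> M -> M) (aN : A -> N -> N) (G : completeNormedModType (C R))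
    (f : M -> N -> G) (q : bptensor aM aN) : G :=
  ptensor_lift f (quot_repr q).

Section bptensor_lift.
Context {R : realType} {A : Type} (M N : normedModType (C R)).
Context (aM : A -> M -> M) (aN : A -> N -> N).
Context (G : completeNormedModType (C R)) (f : M -> N -> G).
Context (f_bil : bilinear_map f).
Context (f_norm : forall m n, rnorm (f m n) <= rnorm m * rnorm n).
Context (f_bal : forall a m n, f (aM a m) n = f m (aN a n)).

Let lift := ptensor_lift f.

Let lift_linear : linear lift.
Proof. exact: ptensor_lift_linear. Qed.

Let liftB p q : lift (p - q) = lift p - lift q.
Proof. exact: (zmod_morphism_linear lift_linear). Qed.

Let ker0 : lift 0 = 0.
Proof. by rewrite -(subrr 0) liftB subrr. Qed.

Let kerD p q : lift p = 0 -> lift q = 0 -> lift (p + q) = 0.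
Proof. by move=> p0 q0; rewrite -[p]scale1r lift_linear p0 q0 scaler0 addr0. Qed.

Let kerZ a p : lift p = 0 -> lift (a *: p) = 0.
Proof. by move=> p0; rewrite -[a *: p]addr0 lift_linear p0 scaler0 ker0 addr0. Qed.

Lemma bptensor_lift_to_quot q :
  bptensor_lift f (to_quot (bprel aM aN) q) =
  ptensor_lift f q.
Proof.
apply/eqP; rewrite -subr_eq0 -liftB.
have /closureP : bprel aM aN
  (quot_repr (to_quot (bprel aM aN) q) - q).
  exact: quot_repr_to.
move: (_ - q) => d dS; apply/eqP/rnorm_eq0/le_anti; rewrite rnorm_ge0 andbT.
apply/ler_addgt0Pr => e e0; rewrite add0r; have [c cS dc] := dS _ e0.
pose S := Submodule (submodule_set := fun q => lift q = 0) ker0 kerD kerZ.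
have c0 : lift c = 0.
  apply: (cS S) => _ [a [m [n ->]]] /=; rewrite liftB.
  by rewrite /lift !ptensor_lift_ptens// f_bal subrr.
rewrite -[lift d]subr0 -c0 -liftB; apply: le_trans (ltW dc).
exact: ptensor_lift_norm.
Qed.

Lemma bptensor_lift_bptens m n : bptensor_lift f (bptens aM aN m n) = f m n.
Proof. by rewrite bptensor_lift_to_quot ptensor_lift_ptens. Qed.

Lemma bptensor_lift_linear : linear (bptensor_lift f : bptensor aM aN -> G).
Proof.
move=> a x y; pose S := bprel aM aN.
elim/(@lquotW _ _ S): x => u.
elim/(@lquotW _ _ S): y => v.
transitivity (bptensor_lift f (to_quot S (a *: u + v) : bptensor aM aN)).
  by congr bptensor_lift; apply/esym/to_quot_is_linear.
by rewrite !bptensor_lift_to_quot ptensor_lift_linear.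
Qed.

End bptensor_lift.


(* The points of a bundle with fibers fib. This is {x & fib x}, redefined so
   that the disjoint-union topology of sigma types is never inferred on it. *)
Record points (R : realType) (X : Type) (fib : X -> completeNormedModType (C R)) :=
  Point { base : X; vec : fib base }.
Arguments Point {R X fib base} vec.
Arguments base {R X fib} p.
Arguments vec {R X fib} p.

Record bundle_topology (R : realType) (X : Type)
    (fib : X -> completeNormedModType (C R)) := BundleTopology {
  bopen : set_system (points fib);
  bopenT : bopen setT;
  bopenI : setI_closed bopen;
  bopen_bigU : forall (I : Type) (f : I -> set (points fib)),
    (forall i, bopen (f i)) -> bopen (\bigcup_i f i) }.

Record prebundle (R : realType) (X : Type) := Prebundle {
  fiber :> X -> completeNormedModType (C R);
  bundle_top : bundle_topology fiber }.

Definition total (R : realType) (X : Type) (E : prebundle R X) := points E.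

HB.instance Definition _ (R : realType) (X : Type) (E : prebundle R X) :=
  gen_eqMixin (total E).
HB.instance Definition _ (R : realType) (X : Type) (E : prebundle R X) :=
  gen_choiceMixin (total E).
HB.instance Definition _ (R : realType) (X : Type) (E : prebundle R X) :=
  isOpenTopological.Build (total E) (bopenT (bundle_top E))
    (@bopenI _ _ _ (bundle_top E)) (@bopen_bigU _ _ _ (bundle_top E)).

Definition upper_semicontinuous (R : realType) (T : topologicalType) (f : T -> R) :=
  forall t a, f t < a -> \forall u \near t, f u < a.

Section prebundle.
Context {R : realType} {X : topologicalType} (E : prebundle R X).

Definition to_total (x : X) (v : E x) : total E := Point v.

Definition proj (p : total E) : X := base p.

Definition fiber_norm (p : total E) : R := rnorm (vec p).

Definition fiber_scale (q : C R * total E) : total E :=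
  to_total (q.1 *: vec q.2).

(* The fibered square of E over X, topologized as a subspace of E x E. *)
Definition fiber_pairs := {x : X & (E x * E x)%type}.

Definition fiber_pair_incl (q : fiber_pairs) : total E * total E :=
  (to_total (projT2 q).1, to_total (projT2 q).2).

Definition fiber_add (q : initial_topology fiber_pair_incl) : total E :=
  to_total ((projT2 q).1 + (projT2 q).2).

(* Surjectivity of proj is automatic, each fiber containing its zero. *)
Record is_hbundle : Prop := IsHBundle {
  proj_continuous : continuous proj;
  proj_open : forall U : set (total E), open U -> open (proj @` U);
  fiber_scale_continuous : continuous fiber_scale;
  fiber_add_continuous : continuous fiber_add;
  fiber_norm_usc : upper_semicontinuous fiber_norm;
  nbhs_zero : forall (x : X) (W : set (total E)),
    nbhs (to_total (0 : E x)) W <->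
    exists U (e : R), [/\ nbhs x U, 0 < e &
      [set p | U (proj p) /\ fiber_norm p < e] `<=` W] }.

Definition is_fbundle : Prop := is_hbundle /\ continuous fiber_norm.

End prebundle.
Arguments to_total {R X} E {x} v.
Arguments proj {R X} E p.

Record hbundle (R : realType) (X : topologicalType) := HBundle {
  hbundle_pre :> prebundle R X;
  hbundleP : is_hbundle hbundle_pre }.

Definition vanishes_at_infinity (R : realType) (X : topologicalType) (f : X -> R) :=
  forall e, 0 < e -> exists2 K : set X, compact K & forall x, ~ K x -> f x < e.

Record C0 (R : realType) (X : topologicalType) := MkC0 {
  C0_fun :> X -> C R;
  C0_continuous : continuous C0_fun;
  C0_vanish : vanishes_at_infinity (fun x => rnorm (C0_fun x)) }.

Record Gamma0 (R : realType) (X : topologicalType) (E : hbundle R X) := MkGamma0 {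
  Gamma0_fun :> forall x, E x;
  Gamma0_continuous : continuous (fun x => to_total E (Gamma0_fun x));
  Gamma0_vanish : vanishes_at_infinity (fun x => rnorm (Gamma0_fun x)) }.

HB.instance Definition _ (R : realType) (X : topologicalType) (E : hbundle R X) :=
  gen_eqMixin (Gamma0 E).
HB.instance Definition _ (R : realType) (X : topologicalType) (E : hbundle R X) :=
  gen_choiceMixin (Gamma0 E).

Section Gamma0.
Context {R : realType} {X : topologicalType} (E : hbundle R X).
Implicit Types s t : Gamma0 E.

Let HE := hbundleP E.

Lemma Gamma0P s t : (forall x, s x = t x) -> s = t.
Proof.
case: s t => [s sc sv] [t tc tv] /= st.
have {}st : s = t by apply: functional_extensionality_dep.
by subst t; congr MkGamma0; apply: Prop_irrelevance.
Qed.

Lemma sectionD_continuous (s t : forall x, E x) :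
  continuous (fun x => to_total E (s x)) -> continuous (fun x => to_total E (t x)) ->
  continuous (fun x => to_total E (s x + t x)).
Proof.
move=> sc tc.
pose st (x : X) : initial_topology (@fiber_pair_incl _ _ E) :=
  existT (fun x => (E x * E x)%type) x (s x, t x).
have stc : continuous st.
  apply: continuous_comp_initial => x.
  exact: (cvg_pair (sc x) (tc x)).
move=> x; apply: (@continuous_comp _ _ _ st (@fiber_add _ _ E)); first exact: stc.
exact: (fiber_add_continuous HE).
Qed.

Lemma sectionZ_continuous (a : X -> C R) (s : forall x, E x) :
  continuous a -> continuous (fun x => to_total E (s x)) ->
  continuous (fun x => to_total E (a x *: s x)).
Proof.
move=> ac sc x.
pose st (x : X) : C R * total E := (a x, to_total E (s x)).
apply: (@continuous_comp _ _ _ st (@fiber_scale _ _ E)).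
  exact: (cvg_pair (ac x) (sc x)).
exact: (fiber_scale_continuous HE).
Qed.

Lemma section0_continuous : continuous (fun x => to_total E (0 : E x)).
Proof.
move=> x W /(nbhs_zero HE)[U [e [xU e0 UW]]].
apply: filterS xU => y Uy; apply: UW; split=> //.
by rewrite /fiber_norm/= rnorm0.
Qed.

Lemma section_limit_continuous (s : forall x, E x) :
  (forall e : R, 0 < e -> exists2 t : forall x, E x,
     continuous (fun x => to_total E (t x)) & forall x, rnorm (s x - t x) < e) ->
  continuous (fun x => to_total E (s x)).
Proof.
move=> s_lim.
have near_add x (v : E x) (W : set (total E)) : nbhs (to_total E v) W ->
    exists V e, [/\ nbhs (to_total E v) V, 0 < e &
      forall y (w z : E y), V (to_total E w) -> rnorm z < e -> W (to_total E (w + z))].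
  move=> vW.
  pose q0 : initial_topology (@fiber_pair_incl _ _ E) :=
    existT (fun x => (E x * E x)%type) x (v, 0).
  have [|_ [[B oB <-] Bq BW]] := @fiber_add_continuous _ _ _ HE q0 W.
    by rewrite /fiber_add/= addr0.
  have [[B1 B2]/= [B1v B20] B12] : nbhs (to_total E v, to_total E (0 : E x)) B.
    exact: (open_nbhs_nbhs (conj oB Bq)).
  have /(nbhs_zero HE)[U [e [xU e0 UB2]]] := B20.
  exists (B1 `&` (proj E) @^-1` U), e; split=> //.
    apply: filterI => //; exact: (proj_continuous HE).
  move=> y w z [B1w Uy] ze.
  have := BW (existT (fun x => (E x * E x)%type) y (w, z)); apply.
  by apply: B12; split=> //=; apply: UB2.
move=> x W /near_add[V [e [sV e0 VW]]].
have [V' [e' [sV' e'0 VV']]] := near_add _ _ _ (nbhs_interior sV).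
have ee0 : 0 < Num.min e e' by rewrite lt_min e0.
have [t tc st] := s_lim _ ee0.
have tV : nbhs (to_total E (t x)) V.
  have -> : t x = s x + (t x - s x) by rewrite addrC subrK.
  apply: VV'; first exact: (nbhs_singleton sV').
  by rewrite rnormB; apply: lt_le_trans (st x) _; rewrite ge_min lexx orbT.
have tVx : nbhs x [set y | V (to_total E (t y))] by exact: (tc x _ tV).
change (nbhs x [set y | W (to_total E (s y))]).
apply: filterS tVx => y /= Vy.
have -> : s y = t y + (s y - t y) by rewrite addrC subrK.
by apply: VW => //; apply: lt_le_trans (st y) _; rewrite ge_min lexx.
Qed.

Lemma vanish_le2 (f g h : X -> R) : vanishes_at_infinity f -> vanishes_at_infinity g ->
  (forall e, 0 < e -> exists2 d, 0 < d & forall x, f x < d -> g x < d -> h x < e) ->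
  vanishes_at_infinity h.
Proof.
move=> fv gv fgh e /fgh[d d0 dh].
have [K cK Kf] := fv _ d0; have [K' cK' Kg] := gv _ d0.
exists (K `|` K'); first exact: compactU.
by move=> x /not_orP[Kx K'x]; apply: dh; [apply: Kf|apply: Kg].
Qed.

Lemma Gamma0_add_vanish s t : vanishes_at_infinity (fun x => rnorm (s x + t x)).
Proof.
apply: (vanish_le2 (Gamma0_vanish s) (Gamma0_vanish t)) => e e0.
exists (e / 2); first by rewrite divr_gt0.
by move=> x sx tx; apply: le_lt_trans (rnormD _ _) _; rewrite [e]splitr ltrD.
Qed.

Lemma Gamma0_scale_vanish (a : C R) s : vanishes_at_infinity (fun x => rnorm (a *: s x)).
Proof.
apply: (vanish_le2 (Gamma0_vanish s) (Gamma0_vanish s)) => e e0.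
have a0 := rnorm_ge0 a; have a10 : 0 < rnorm a + 1 by rewrite ltr_wpDl.
exists (e / (rnorm a + 1)); first by rewrite divr_gt0.
move=> x sx _; rewrite rnormZ.
apply: (@le_lt_trans _ _ ((rnorm a + 1) * rnorm (s x))).
  by rewrite ler_wpM2r ?rnorm_ge0// lerDl.
by rewrite mulrC -ltr_pdivlMr.
Qed.

Lemma Gamma0_act_vanish (a : C0 R X) s : vanishes_at_infinity (fun x => rnorm (a x *: s x)).
Proof.
apply: (vanish_le2 (C0_vanish a) (Gamma0_vanish s)) => e e0.
exists (Num.min 1 e); first by rewrite lt_min ltr01.
move=> x; rewrite !lt_min => /andP[ax _] /andP[_ sx]; rewrite rnormZ.
by apply: le_lt_trans sx; rewrite ler_piMl ?rnorm_ge0// ltW.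
Qed.

Lemma Gamma0_zero_vanish : vanishes_at_infinity (fun x => rnorm (0 : E x)).
Proof.
by move=> e e0; exists set0; [exact: compact0|move=> x _; rewrite rnorm0].
Qed.

Definition Gamma0_zero : Gamma0 E := MkGamma0 section0_continuous Gamma0_zero_vanish.

Definition Gamma0_add s t : Gamma0 E :=
  MkGamma0 (sectionD_continuous (@Gamma0_continuous _ _ _ s) (@Gamma0_continuous _ _ _ t))
    (@Gamma0_add_vanish s t).

Definition Gamma0_scale (a : C R) s : Gamma0 E :=
  MkGamma0 (sectionZ_continuous (fun x => @cvg_cst _ a _ (nbhs x) _)
    (@Gamma0_continuous _ _ _ s)) (@Gamma0_scale_vanish a s).

Definition Gamma0_opp s : Gamma0 E := Gamma0_scale (-1) s.

Definition Gamma0_act (a : C0 R X) s : Gamma0 E :=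
  MkGamma0 (sectionZ_continuous (@C0_continuous _ _ a)
    (@Gamma0_continuous _ _ _ s)) (@Gamma0_act_vanish a s).

Lemma Gamma0_addA : associative Gamma0_add.
Proof. by move=> s t u; apply: Gamma0P => x /=; rewrite addrA. Qed.
Lemma Gamma0_addC : commutative Gamma0_add.
Proof. by move=> s t; apply: Gamma0P => x /=; rewrite addrC. Qed.
Lemma Gamma0_add0 : left_id Gamma0_zero Gamma0_add.
Proof. by move=> s; apply: Gamma0P => x /=; rewrite add0r. Qed.
Lemma Gamma0_addN : left_inverse Gamma0_zero Gamma0_opp Gamma0_add.
Proof. by move=> s; apply: Gamma0P => x /=; rewrite scaleN1r addNr. Qed.

HB.instance Definition _ := GRing.isZmodule.Build (Gamma0 E)
  Gamma0_addA Gamma0_addC Gamma0_add0 Gamma0_addN.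

Lemma Gamma0_scaleA a b s : Gamma0_scale a (Gamma0_scale b s) = Gamma0_scale (a * b) s.
Proof. by apply: Gamma0P => x /=; rewrite scalerA. Qed.
Lemma Gamma0_scale1 : left_id 1 Gamma0_scale.
Proof. by move=> s; apply: Gamma0P => x /=; rewrite scale1r. Qed.
Lemma Gamma0_scaleDr : right_distributive Gamma0_scale +%R.
Proof. by move=> a s t; apply: Gamma0P => x /=; rewrite scalerDr. Qed.
Lemma Gamma0_scaleDl s : {morph Gamma0_scale^~ s : a b / a + b}.
Proof. by move=> a b; apply: Gamma0P => x /=; rewrite scalerDl. Qed.

HB.instance Definition _ := GRing.Zmodule_isLmodule.Build (C R) (Gamma0 E)
  Gamma0_scaleA Gamma0_scale1 Gamma0_scaleDr Gamma0_scaleDl.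

Lemma Gamma0D s t x : (s + t) x = s x + t x. Proof. by []. Qed.
Lemma Gamma0Z a s x : (a *: s) x = a *: s x. Proof. by []. Qed.
Lemma Gamma0N s x : (- s) x = - s x.
Proof. by rewrite -[RHS]scaleN1r. Qed.
Lemma Gamma0B s t x : (s - t) x = s x - t x.
Proof. by rewrite Gamma0D Gamma0N. Qed.

(* sup of the empty set is 0, which is right when X is empty. *)
Definition sup_norm s : R := sup (range (fun x => rnorm (s x))).

Lemma Gamma0_bounded s : exists M, forall x, rnorm (s x) <= M.
Proof.
have [K /compact_near_coveringP cK Ks] := Gamma0_vanish s ltr01.
have [|n0 _ n0K] := cK nat \oo (fun n x => rnorm (s x) < n%:R) _.
  move=> x _; pose m := Num.bound (rnorm (s x)).
  have mx : rnorm (s x) < m%:R by apply/archi_boundP/rnorm_ge0.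
  have xnear : \forall y \near x, rnorm (s y) < m%:R.
    have /(_ _ mx) := @fiber_norm_usc _ _ _ HE (to_total E (s x)).
    exact: (@Gamma0_continuous _ _ _ s x).
  exists ([set y | rnorm (s y) < m%:R], [set n | (m <= n)%N]) => /=.
    by split=> //; exists m.
  move=> [y n]/= [ym mn]; apply: lt_le_trans ym _; by rewrite ler_nat.
exists (n0%:R + 1) => x; apply/ltW; have [Kx|Kx] := pselect (K x).
  by apply: lt_le_trans (n0K n0 (leqnn _) x Kx) _; rewrite lerDl.
by apply: lt_le_trans (Ks x Kx) _; rewrite lerDr.
Qed.

Lemma sup_norm_ub s x : rnorm (s x) <= sup_norm s.
Proof.
apply: ub_le_sup; last by exists x.
by have [M sM] := Gamma0_bounded s; exists M => _ [y _ <-].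
Qed.

Lemma sup_norm_le s M : 0 <= M -> (forall x, rnorm (s x) <= M) -> sup_norm s <= M.
Proof.
move=> M0 sM; rewrite /sup_norm; have [->|/set0P s0] := eqVneq (range (fun x => rnorm (s x))) set0.
  by rewrite sup0.
by apply: ge_sup => // _ [x _ <-].
Qed.

Lemma sup_norm_ge0 s : 0 <= sup_norm s.
Proof.
have [x|X0] := pselect (exists x : X, True); last first.
  rewrite /sup_norm; have -> : range (fun x => rnorm (s x)) = set0.
    by apply/seteqP; split=> // r [x _ _]; apply: X0; exists x.
  by rewrite sup0.
by case: x => x _; apply: le_trans (sup_norm_ub s x); apply: rnorm_ge0.
Qed.

Lemma sup_normD s t : sup_norm (s + t) <= sup_norm s + sup_norm t.
Proof.
apply: sup_norm_le => [|x]; first by rewrite addr_ge0 ?sup_norm_ge0.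
by apply: le_trans (rnormD _ _) _; rewrite lerD ?sup_norm_ub.
Qed.

Let sup_normZ_le a s : sup_norm (a *: s) <= rnorm a * sup_norm s.
Proof.
apply: sup_norm_le => [|x]; first by rewrite mulr_ge0 ?sup_norm_ge0 ?rnorm_ge0.
by rewrite rnormZ ler_wpM2l ?rnorm_ge0 ?sup_norm_ub.
Qed.

Lemma sup_normZ a s : sup_norm (a *: s) = rnorm a * sup_norm s.
Proof.
apply/eqP; rewrite eq_le sup_normZ_le/=.
have [->|a0] := eqVneq a 0; first by rewrite rnorm0 mul0r sup_norm_ge0.
have ra0 : 0 < rnorm a.
  rewrite lt_neqAle rnorm_ge0 andbT eq_sym.
  by apply: contra_neq a0 => /rnorm_eq0.
rewrite -ler_pdivlMl//.
have -> : (rnorm a)^-1 = rnorm a^-1.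
  apply: (mulfI (lt0r_neq0 ra0)); rewrite divff ?lt0r_neq0//.
  by rewrite -rnormZ /GRing.scale/= divff// rnorm1.
by apply: le_trans (sup_normZ_le _ _); rewrite scalerA mulVf// scale1r.
Qed.

Lemma sup_norm_eq0 s : sup_norm s = 0 -> s = 0.
Proof.
move=> s0; apply: Gamma0P => x; apply: rnorm_eq0; apply/le_anti.
by rewrite rnorm_ge0 andbT -s0 sup_norm_ub.
Qed.

Let snorm s : C R := toC (sup_norm s).

Let snormD s t : snorm (s + t) <= snorm s + snorm t.
Proof. by rewrite /snorm -toCD toC_le sup_normD. Qed.

Let snormZ a s : snorm (a *: s) = `|a| * snorm s.
Proof. by rewrite /snorm sup_normZ toCM -rnormE. Qed.

Let snorm_eq0 s : snorm s = 0 -> s = 0.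
Proof. by move/toC_inj/sup_norm_eq0. Qed.

HB.instance Definition _ :=
  Lmodule_isNormed.Build (C R) (Gamma0 E) snormD snormZ snorm_eq0.

Lemma Gamma0_rnormE s : rnorm s = sup_norm s.
Proof. exact: toCK. Qed.

Lemma Gamma0_complete (F : set_system (Gamma0 E)) :
  ProperFilter F -> cauchy F -> cvg F.
Proof.
apply: rnorm_complete F => u uc.
have ucx x : rcauchy (@rnorm _ (E x)) (fun n => u n x).
  move=> e e0; have [k ku] := uc _ e0; exists k => m n km kn.
  rewrite -Gamma0B; apply: le_lt_trans (sup_norm_ub _ _) _.
  by rewrite -Gamma0_rnormE ku.
pose l x : E x := lim ((fun n => u n x) @ \oo).
have ul e : 0 < e -> exists k : nat, forall n : nat, (k <= n)%N -> forall x, rnorm (u n x - l x) < e.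
  move=> e0; have e20 : 0 < e / 2 by rewrite divr_gt0.
  have [k ku] := uc _ e20; exists k => n kn x.
  have [k' ku'] := cvg_rcvg (rcauchy_cvg (ucx x)) e20.
  rewrite -(subrKA (u (maxn k k') x)) [e]splitr; apply: le_lt_trans (rnormD _ _) _.
  apply: ltrD; last by apply: ku'; exact: leq_maxr.
  rewrite -Gamma0B; apply: le_lt_trans (sup_norm_ub _ _) _.
  by rewrite -Gamma0_rnormE ku// leq_maxl.
have lc : continuous (fun x => to_total E (l x)).
  apply: section_limit_continuous => e e0; have [k ku] := ul _ e0.
  exists (u k); first exact: Gamma0_continuous.
  by move=> x; rewrite rnormB ku.
have lv : vanishes_at_infinity (fun x => rnorm (l x)).
  move=> e e0; have e20 : 0 < e / 2 by rewrite divr_gt0.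
  have [k ku] := ul _ e20; have [K cK Ku] := Gamma0_vanish (u k) e20.
  exists K => // x Kx; rewrite -[l x](subrK (u k x)) [e]splitr.
  apply: le_lt_trans (rnormD _ _) _; apply: ltrD; last exact: Ku.
  by rewrite rnormB ku.
exists (MkGamma0 lc lv) => e e0; have e20 : 0 < e / 2 by rewrite divr_gt0.
have [k ku] := ul _ e20; exists k => n kn.
rewrite Gamma0_rnormE; apply: (@le_lt_trans _ _ (e / 2)).
  by apply: sup_norm_le => [|x]; [exact: ltW|rewrite Gamma0B ltW// ku].
by rewrite ltr_pdivrMr// ltr_pMr// ltr1n.
Qed.

HB.instance Definition _ := Uniform_isComplete.Build (Gamma0 E) Gamma0_complete.

End Gamma0.

(* An (H) bundle topology on the fibers ptensor (E x) (F x) for which all the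
   sections s (x) t are continuous. *)
Record tensor_bundle (R : realType) (X : topologicalType) (E F : hbundle R X) :=
  TensorBundle {
  tensor_top : bundle_topology (fun x => ptensor (E x) (F x));
  tensor_hbundleP : is_hbundle (Prebundle tensor_top);
  tensor_section_continuous : forall (s : Gamma0 E) (t : Gamma0 F),
    continuous (fun x => to_total (Prebundle tensor_top) (ptens (s x) (t x))) }.

Definition tensor_hbundle (R : realType) (X : topologicalType) (E F : hbundle R X)
  (T : tensor_bundle E F) : hbundle R X := HBundle (tensor_hbundleP T).
Coercion tensor_hbundle : tensor_bundle >-> hbundle.

Section canonical.
Context {R : realType} {X : topologicalType} (E F : hbundle R X).

Lemma tensor_section_vanish (s : Gamma0 E) (t : Gamma0 F) :
  vanishes_at_infinity (fun x => rnorm (ptens (s x) (t x))).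
Proof.
apply: (vanish_le2 (Gamma0_vanish s) (Gamma0_vanish t)) => e e0.
exists (Num.min 1 e); first by rewrite lt_min ltr01.
move=> x; rewrite !lt_min => /andP[sx _] /andP[_ tx].
apply: le_lt_trans (ptens_norm_le _ _) _; apply: le_lt_trans tx.
by rewrite ler_piMl ?rnorm_ge0// ltW.
Qed.

Definition tensor_section (T : tensor_bundle E F) (s : Gamma0 E) (t : Gamma0 F) :
    Gamma0 T :=
  @MkGamma0 R X T (fun x => ptens (s x) (t x)) (@tensor_section_continuous _ _ _ _ T s t)
    (tensor_section_vanish s t).

Definition Gamma0_tensor := btensor (@Gamma0_act _ _ E) (@Gamma0_act _ _ F).
Definition Gamma0_ptensor := bptensor (@Gamma0_act _ _ E) (@Gamma0_act _ _ F).

Definition canonical_completion : Gamma0_tensor -> Gamma0_ptensor := @bcompl _ _ _ _ _ _.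

Definition canonical_section (T : tensor_bundle E F) : Gamma0_ptensor -> Gamma0 T :=
  @bptensor_lift _ _ _ _ _ _ _ (tensor_section T).

Lemma tensor_section_bilinear (T : tensor_bundle E F) :
  bilinear_map (tensor_section T).
Proof.
have b x := @ptens_bilinear R (E x) (F x).
split=> *; apply: Gamma0P => x.
- exact: (bilDl (b x)).
- exact: (bilDr (b x)).
- exact: (bilZl (b x)).
- exact: (bilZr (b x)).
Qed.

Lemma tensor_section_norm (T : tensor_bundle E F) s t :
  rnorm (tensor_section T s t) <= rnorm s * rnorm t.
Proof.
rewrite !Gamma0_rnormE; apply: sup_norm_le => [|x].
  by rewrite mulr_ge0 ?sup_norm_ge0.
apply: le_trans (ptens_norm_le _ _) _.
by rewrite ler_pM ?rnorm_ge0 ?sup_norm_ub.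
Qed.

Lemma tensor_section_balanced (T : tensor_bundle E F) a s t :
  tensor_section T (Gamma0_act a s) t = tensor_section T s (Gamma0_act a t).
Proof.
apply: Gamma0P => x /=; have b := @ptens_bilinear R (E x) (F x).
by rewrite (bilZl b) (bilZr b).
Qed.

Lemma canonical_completion_linear : linear canonical_completion.
Proof. exact: bcompl_linear. Qed.

Lemma canonical_completion_btens s t :
  canonical_completion (btens _ _ s t) = bptens _ _ s t.
Proof. exact: bcompl_btens. Qed.

Lemma canonical_section_linear T : linear (canonical_section T).
Proof.
exact: (bptensor_lift_linear (tensor_section_bilinear T) (tensor_section_norm T)
  (tensor_section_balanced T)).
Qed.

Lemma canonical_section_bptens T s t :
  canonical_section T (bptens _ _ s t) = tensor_section T s t.
Proof.
exact: (bptensor_lift_bptens (tensor_section_bilinear T) (tensor_section_norm T)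
  (tensor_section_balanced T)).
Qed.

End canonical.

Definition has_dim (K : comNzRingType) (V : lmodType K) (d : nat) : Prop :=
  exists e : 'I_d -> V, forall v, exists! c : {ffun 'I_d -> K}, v = \sum_i c i *: e i.

Section finite_type.
Context {R : realType} {X : topologicalType} (E : prebundle R X).

Definition subhomogeneous : Prop :=
  exists n : nat, forall x, exists2 d, (d <= n)%N & has_dim (E x) d.

Definition stratum (d : nat) : set X := [set x | has_dim (E x) d].

Definition dim_le (d : nat) : set X :=
  [set x | exists2 k, (k <= d)%N & has_dim (E x) k].

Definition trivial_over (U : set X) : Prop :=
  exists (B : completeNormedModType (C R))
         (phi : forall x, E x -> B) (psi : forall x, B -> E x),
    [/\ forall x, U x -> linear (phi x),
        forall x, U x -> cancel (phi x) (psi x) /\ cancel (psi x) (phi x),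
        {within proj E @^-1` U,
          continuous (fun p : total E => (proj E p, phi _ (vec p)))} &
        {within U `*` [set: B],
          continuous (fun q : X * B => to_total E (psi q.1 q.2))}].

Definition conditionally_of_finite_type : Prop :=
  forall d, exists (n : nat) (U : 'I_n -> set X),
    [/\ forall i, exists2 O : set X, open O & U i = stratum d `&` O,
        stratum d = \bigcup_i U i &
        forall i, trivial_over (U i)].

End finite_type.

Definition sigma_compact (X : topologicalType) : Prop :=
  exists2 K : nat -> set X, (forall n, compact (K n)) & \bigcup_n K n = [set: X].

(* Main.v *)
(**
A section of a bundle is continuous as soon as near every point it is, up to
any e > 0, equal to a global section. This yields sections through every point,
extensions of sections from closed sets with control of the norm, and also a
description of the sections of the tensor product: those locally close to
finite sums of the s(x) (x) t(x).

Let Z_d be the closed set where dim E_x < d. A frame over a piece of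
Z_(d+1) \ Z_d can be made well conditioned by subtracting from its k-th vector
a nearly best approximation by the previous ones, chosen continuously; the
coordinates e_i* are then bounded by a constant depending only on d, even
near Z_d, where the frame may degenerate. Let u be a section of the tensor
product vanishing on Z_d and g a continuous majorant of |u|. On Z_(d+1),
  u = sum_i (sqrt g e_i) (x) (e_i* (x) 1)(u) / sqrt g,
and both factors are dominated by sqrt g, so they vanish at Z_d and extend to
global sections; subtracting the resulting finite sum leaves a section
vanishing on Z_(d+1). Induction on d shows that u is a finite sum of s_k (x) t_k
of total cost at most C |u|, which gives surjectivity and handles completed
tensors. If sum_k s_k (x) t_k vanishes pointwise, expanding the s_k in the same
way and moving the coefficients to the t_k pushes the s_k into the sections
vanishing on Z_(d+1), without changing the element of the algebraic tensor
product over C_0(X); this gives injectivity.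
*)
From HB Require Import structures.
From mathcomp Require Import all_boot all_order all_algebra complex lra ring.
From mathcomp Require Import all_classical all_reals all_analysis.
From mathcomp Require Import borel_hierarchy.
(* Last, since the libraries above have another to_total. *)
Require Import Defs.

Set Implicit Arguments.
Unset Strict Implicit.
Unset Printing Implicit Defensive.

Import Order.TTheory GRing.Theory Num.Theory numFieldNormedType.Exports.

Local Open Scope classical_set_scope.
Local Open Scope ring_scope.

(** * Partitions of unity on compact sets *)

Definition bump (R : realType) (X : topologicalType) (O : set X) (f : X -> R) :=
  [/\ continuous f, forall x, 0 <= f x &
      exists2 K, compact K & K `<=` O /\ forall x, ~ K x -> f x = 0].

Lemma cvg_sum_seq (K : numFieldType) (V : normedModType K) (T : Type) (F : set_system T) (I : eqType) (s : seq I)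
    (f : I -> T -> V) (l : I -> V) : Filter F ->
  (forall y, y \in s -> f y @ F --> l y) ->
  (fun x => \sum_(y <- s) f y x) @ F --> \sum_(y <- s) l y.
Proof.
move=> FF; elim: s => [|y s IH] fl.
  rewrite big_nil; under eq_cvg do rewrite big_nil; exact: cvg_cst.
rewrite big_cons; under eq_cvg do rewrite big_cons.
apply: cvgD; first by apply: fl; rewrite mem_head.
by apply: IH => z zs; apply: fl; rewrite inE zs orbT.
Qed.

Lemma cvg_maxr (R : realType) (T : Type) (F : set_system T) (f g : T -> R) (a b : R) :
  Filter F -> f @ F --> a -> g @ F --> b ->
  (fun x => Num.max (f x) (g x)) @ F --> Num.max a b.
Proof.
move=> FF fa gb; rewrite maxr_absE; under eq_cvg do rewrite maxr_absE.
apply: cvgM; last exact: cvg_cst.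
by apply: cvgD; [exact: cvgD|apply: cvg_norm; exact: cvgB].
Qed.

Lemma cvg_minr (R : realType) (T : Type) (F : set_system T) (f g : T -> R) (a b : R) :
  Filter F -> f @ F --> a -> g @ F --> b ->
  (fun x => Num.min (f x) (g x)) @ F --> Num.min a b.
Proof.
move=> FF fa gb; rewrite minr_absE; under eq_cvg do rewrite minr_absE.
apply: cvgM; last exact: cvg_cst.
by apply: cvgB; [exact: cvgD|apply: cvg_norm; exact: cvgB].
Qed.

Section bumps.
Context {R : realType} {X : topologicalType}.
Hypothesis X_hausdorff : hausdorff_space X.
Hypothesis X_lc : locally_compact [set: X].

Lemma bump_cases (O : set X) (f : X -> R) : bump O f ->
  forall x, O x \/ \forall y \near x, f y = 0.
Proof.
move=> [_ _ [K cK [KO K0]]] x; have [Kx|Kx] := pselect (K x); first by left; apply: KO.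
right; have oK : open (~` K) by apply: closed_openC; apply: compact_closed.
by apply: filterS (open_nbhs_nbhs (conj oK Kx)) => y; apply: K0.
Qed.

Lemma exists_bump (x : X) (O : set X) : nbhs x O ->
  exists2 f : X -> R, bump O f &
    (forall y, f y <= 1) /\ \forall y \near x, f y = 1.
Proof.
move=> xO; have [V] := X_lc (x := x) I; rewrite withinET => xV [cV clV].
have oOU : open (interior (O `&` V)) by apply: open_interior.
have OUx : interior (O `&` V) x.
  by apply: filterI.
have := @locally_compact_completely_regular X R X_lc X_hausdorff x _ (open_closedC oOU).
move=> /(_ (fun h => h OUx))/(@uniform_separatorP X R)[g [gc _ gx gO]].
have gx0 : g x = 0 by apply: gx; exists x.
have gO1 y : ~ interior (O `&` V) y -> g y = 1 by move=> h; apply: gO; exists y.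
pose h y := (2%:R - g y *+ 3).
have hc : continuous h.
  move=> y; apply: cvgB; first exact: cvg_cst.
  by apply: cvgMn; exact: gc.
pose f y := Num.min 1 (Num.max 0 (h y)).
exists f; last split.
- split.
  + move=> y; apply: cvg_minr; first exact: cvg_cst.
    by apply: cvg_maxr; [exact: cvg_cst|exact: hc].
  + by move=> y; rewrite le_min ler01/= le_max lexx.
  + have KO : [set y | 0 <= h y] `<=` interior (O `&` V).
      move=> y; apply: contraPP => /gO1 gy.
      rewrite /= /h gy => h0; have : (2%:R - 1 *+ 3 : R) < 0 by lra.
      by rewrite ltNge h0.
    exists [set y | 0 <= h y].
      apply: (@subclosed_compact _ _ V) => //.
        have -> : [set y | 0 <= h y] = h @^-1` [set z | 0 <= z] by [].
        apply: closed_comp => //; exact: closed_ge.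
      by move=> y /KO /interior_subset[].
    split; first by move=> y /KO /interior_subset[].
    move=> y /= /negP; rewrite -ltNge /f => /ltW hy.
    by rewrite (max_idPl hy) (min_idPr ler01).
- by move=> y; rewrite ge_min lexx.
have : \forall y \near x, 1 < h y.
  have hx : 1 < h x by rewrite /h gx0 mul0rn subr0 ltr1n.
  exact: (cvgr_gt _ (hc x) _ hx).
apply: filterS => y hy; have h0 : 0 <= h y by apply: le_trans (ltW hy); exact: ler01.
by rewrite /f (max_idPr h0) (min_idPl (ltW hy)).
Qed.

Lemma finite_partition (K : set X) (O : X -> set X) : compact K ->
  (forall x, K x -> nbhs x (O x)) ->
  exists (s : seq X) (f : X -> X -> R),
    [/\ forall y, y \in s -> [/\ K y, bump (O y) (f y) & forall x, f y x <= 1],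
        forall x, \sum_(y <- s) f y x <= 1 &
        forall x, K x -> \sum_(y <- s) f y x = 1].
Proof.
move=> cK KO.
have /choice[g gP] : forall x, exists f : X -> R, K x ->
    [/\ bump (O x) f, forall y, f y <= 1 & \forall y \near x, f y = 1].
  move=> x; have [Kx|Kx] := pselect (K x); last by exists (fun=> 0).
  by have [f fO [f1 fx]] := exists_bump (KO x Kx); exists f => _; split.
pose F : set_system (seq X) := [set A | exists2 s : seq X,
  (forall y, y \in s -> K y) & forall t : seq X, (forall y, y \in t -> K y) ->
  {subset s <= t} -> A t].
have FF : Filter F.
  split; first by exists [::].
  - move=> A B [s sK sA] [t tK tB]; exists (s ++ t).
      by move=> y; rewrite mem_cat => /orP[/sK|/tK].
    move=> r rK srt; split; [apply: sA|apply: tB] => // y yr; apply: srt;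
      by rewrite mem_cat yr ?orbT.
  - by move=> A B AB [s sK sA]; exists s => // t tK st; apply/AB/sA.
have [|s sK /(_ s sK) sP] :=
    (compact_near_coveringP K).1 cK _ F (fun s x => exists2 y, y \in s & g y x = 1) FF.
  move=> x Kx; exists ([set y | g x y = 1], [set s : seq X | x \in s]) => /=.
    split; first by have [] := gP x Kx.
    exists [:: x] => [y|t _ xt]; first by rewrite inE => /eqP->.
    by apply: xt; rewrite mem_head.
  by move=> [y s]/= [gy xs]; exists x.
have KD x : K x -> exists2 y, y \in s & g y x = 1 by apply: sP.
pose S x := \sum_(y <- s) g y x.
have g0 y x : y \in s -> 0 <= g y x by move=> /sK/gP[[_ + _] _ _]; apply.
have S0 x : 0 <= S x by rewrite /S big_seq; apply: sumr_ge0 => y; apply: g0.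
have SK x : K x -> 1 <= S x.
  move=> /KD[y Dy gy1].
  rewrite -gy1 /S (perm_big _ (perm_to_rem Dy)) big_cons lerDl big_seq.
  by apply: sumr_ge0 => z /mem_rem; apply: g0.
have S1 x : 0 < Num.max 1 (S x) by rewrite lt_max ltr01.
have gc y : y \in s -> continuous (g y) by move=> /sK/gP[[]].
have Sc : continuous S by move=> x; apply: (@cvg_sum_seq R R^o) => y /gc; apply.
exists s, (fun y x => g y x / Num.max 1 (S x)); split.
- move=> y ys; have [[_ _ [C cC [CO C0]]] g1 _] := gP y (sK _ ys).
  split; first exact: sK; last first.
    move=> x; rewrite ler_pdivrMr// mul1r.
    by apply: le_trans (g1 x) _; rewrite le_max lexx.
  split; last first.
  + by exists C => //; split=> // x /C0 ->; rewrite mul0r.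
  + by move=> x; rewrite divr_ge0 ?g0// ltW.
  move=> x; apply: cvgM; first exact: gc.
  apply: cvgV; first exact: lt0r_neq0.
  by apply: cvg_maxr; [exact: cvg_cst|exact: Sc].
- by move=> x; rewrite -mulr_suml ler_pdivrMr// mul1r le_max lexx orbT.
- move=> x /SK Sx; rewrite -mulr_suml (max_idPr Sx) divff//.
  by apply: lt0r_neq0; apply: lt_le_trans Sx; exact: ltr01.
Qed.

End bumps.

(** * Limits of sections *)

Section iteration.
Context {R : realType} {X : Type} (V : X -> completeNormedModType (C R)).
Implicit Types (s : forall x, V x) (c : R).

Lemma half_pow_small c e : 0 <= c -> 0 < e -> exists n : nat, c / 2 ^+ n < e.
Proof.
move=> c0 e0; exists (Num.bound (c / e)); set n := Num.bound _.
rewrite ltr_pdivrMr ?exprn_gt0// mulrC -ltr_pdivrMr//.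
apply: (lt_le_trans (archi_boundP _)); first by rewrite divr_ge0// ltW.
by rewrite -natrX ler_nat ltnW// ltn_expl.
Qed.

Lemma half_pow_ge0 c n : 0 <= c -> 0 <= c / 2 ^+ n.
Proof. by move=> c0; rewrite divr_ge0// exprn_ge0. Qed.

Lemma half_pow_le c m n : 0 <= c -> (m <= n)%N -> c / 2 ^+ n <= c / 2 ^+ m.
Proof.
move=> c0 mn; rewrite ler_wpM2l// lef_pV2 ?posrE ?exprn_gt0//.
by rewrite ler_eXn2l// ltr1n.
Qed.

Lemma sup_iteration (P : nat -> (forall x, V x) -> Prop) c s0 : 0 <= c -> P 0 s0 ->
  (forall n s, P n s -> exists2 t, P n.+1 t & forall x, rnorm (t x - s x) <= c / 2 ^+ n) ->
  exists (u : nat -> forall x, V x) (l : forall x, V x), [/\ u 0 = s0,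
    forall n, P n (u n),
    forall n x, rnorm (u n.+1 x - u n x) <= c / 2 ^+ n &
    forall n x, rnorm (l x - u n x) <= 2 * c / 2 ^+ n].
Proof.
move=> c0 P0 Pstep.
have /choice[st stP] : forall ns : nat * (forall x, V x), exists t, P ns.1 ns.2 ->
    P ns.1.+1 t /\ forall x, rnorm (t x - ns.2 x) <= c / 2 ^+ ns.1.
  move=> [n s]; have [/Pstep[t]|] := pselect (P n s); first by exists t.
  by exists s.
pose u := fix u n := if n is m.+1 then st (m, u m) else s0.
have uP n : P n (u n) by elim: n => [//|n IH]; have [] := stP (n, u n) IH.
have uS n x : rnorm (u n.+1 x - u n x) <= c / 2 ^+ n.
  by have [_] := stP (n, u n) (uP n); apply.
have uD n k x : rnorm (u (k + n)%N x - u n x) <= 2 * c / 2 ^+ n - 2 * c / 2 ^+ (k + n).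
  elim: k => [|k IH]; first by rewrite add0n !subrr rnorm0.
  rewrite addSn -(subrKA (u (k + n)%N x)); apply: le_trans (rnormD _ _) _.
  have := uS (k + n)%N x.
  have -> : c / 2 ^+ (k + n) = 2 * c / 2 ^+ (k + n) - 2 * c / 2 ^+ (k + n).+1.
    by rewrite exprS; field; rewrite expf_neq0.
  move: IH; lra.
have uB m n x : (n <= m)%N -> rnorm (u m x - u n x) <= 2 * c / 2 ^+ n.
  move=> nm; rewrite -(subnK nm); apply: le_trans (uD _ _ _) _.
  by rewrite gerBl half_pow_ge0// mulr_ge0.
have uc x : rcauchy (@rnorm _ (V x)) (fun n => u n x).
  move=> e e0; have [k ke] : exists k : nat, 2 * (2 * c) / 2 ^+ k < e.
    by apply: half_pow_small => //; rewrite !mulr_ge0.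
  exists k => m n km kn; apply: le_lt_trans ke.
  rewrite -(subrKA (u k x)); apply: le_trans (rnormD _ _) _.
  rewrite -mulrA mulrDl mul1r lerD ?uB//.
  by rewrite rnormB uB.
exists u, (fun x => lim ((fun n => u n x) @ \oo)); split=> // n x.
apply/ler_addgt0Pr => e e0; have [k ku] := cvg_rcvg (rcauchy_cvg (uc x)) e0.
rewrite -(subrKA (u (maxn k n) x)) addrC; apply: le_trans (rnormD _ _) _.
apply: lerD; first by rewrite uB// leq_maxr.
by rewrite rnormB ltW// ku// leq_maxl.
Qed.

End iteration.

(** * The scalars *)

Section scalar_field.
Context {R : realType}.

Lemma ReC_rnorm (z : C R) : `|ReC z| <= rnorm z.
Proof. by rewrite -toC_le -rnormE; exact: (@normc_ge_Re R z). Qed.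

Lemma ReCB (z w : C R) : ReC (z - w) = ReC z - ReC w.
Proof. exact: (raddfB (@complex.Re R)). Qed.

Lemma rnormM (z w : C R) : rnorm (z * w) = rnorm z * rnorm w.
Proof. exact: (@rnormZ R (C R) z w). Qed.

Definition iC : C R := 'i%C.

Lemma rnorm_iC : rnorm iC = 1.
Proof. by rewrite /rnorm (_ : `|iC| = 1)// /iC normc_def/= expr0n/= add0r expr1n sqrtr1. Qed.

Lemma C_decomp (z : C R) : z = toC (ReC z) + iC * toC (ReC (- iC * z)).
Proof.
by case: z => a b; apply/eqP; rewrite eq_complex/= /ReC /toC /iC/=; simpc.
Qed.

Lemma rnorm_toC_norm (x : R) : rnorm (toC x : C R) = `|x|.
Proof.
by rewrite /rnorm /ReC normc_def/= expr0n/= addr0 sqrtr_sqr.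
Qed.

Lemma toCB (x y : R) : toC (x - y) = toC x - toC y.
Proof. by rewrite toCD; congr (_ + _); exact: (raddfN (real_complex R)). Qed.

Lemma cvg_toC (T : Type) (F : set_system T) (f : T -> R) (a : R) : Filter F ->
  f @ F --> a -> (fun x => toC (f x) : C R) @ F --> (toC a : C R).
Proof.
move=> FF fa W /nbhs_rnormP[e e0 eW].
have : \forall x \near F, `|a - f x| < e by move/cvgrPdist_lt : fa; apply.
rewrite !near_simpl; apply: filterS => x ax; apply: eW.
by rewrite -toCB rnorm_toC_norm.
Qed.

Lemma rnorm_parts (a b a' b' : R) :
  rnorm (toC a + iC * toC b - (toC a' + iC * toC b')) <= `|a - a'| + `|b - b'|.
Proof.
rewrite opprD addrACA -mulrBr -!toCB; apply: le_trans (rnormD _ _) _.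
by rewrite rnormM rnorm_iC mul1r !rnorm_toC_norm.
Qed.

Lemma C_complete (F : set_system (C R)) : ProperFilter F -> cauchy F -> cvg F.
Proof.
apply: rnorm_complete F => u uc.
have ReE (c : C R) : rnorm c = 1 -> exists l : R, forall e, 0 < e ->
    exists k : nat, forall n, (k <= n)%N -> `|ReC (c * u n) - l| < e.
  move=> c1.
  have : cvgn (fun n => ReC (c * u n)).
    apply/cauchy_cvgP/cauchy_ballP => e e0; have [k ku] := uc _ e0; rewrite !near_simpl.
    exists ([set n | (k <= n)%N], [set n | (k <= n)%N]) => /=; first by split; exists k.
    move=> [m n]/= [km kn]; rewrite /ball/= -ReCB -mulrBr.
    by apply: le_lt_trans (ReC_rnorm _) _; rewrite rnormM c1 mul1r ku.
  move=> /cvg_ex[l /cvgrPdist_lt ul]; exists l => e /ul[k _ ku].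
  by exists k => n kn; rewrite distrC; apply: ku.
have [a ua] := ReE 1 rnorm1.
have [|b ub] := ReE (- iC); first by rewrite rnormN rnorm_iC.
exists (toC a + iC * toC b) => e e0; have e20 : 0 < e / 2 by rewrite divr_gt0.
have [k ku] := ua _ e20; have [k' ku'] := ub _ e20.
exists (maxn k k') => n; rewrite geq_max => /andP[kn k'n].
rewrite [u n]C_decomp [e]splitr; apply: le_lt_trans (rnorm_parts _ _ _ _) _.
by rewrite ltrD ?ku'//; have := ku n kn; rewrite mul1r.
Qed.

(* C R itself carries no canonical complete structure. *)
Definition Cnormed : normedModType (C R) := C R.
Definition Ccomplete : completeNormedModType (C R) :=
  HB.pack (NormedModule.sort Cnormed) (Uniform_isComplete.Build Cnormed C_complete).

End scalar_field.

(** * Extension of sections from closed sets *)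

Section section_modules.
Context {R : realType} {X : topologicalType} (V : X -> completeNormedModType (C R)).
Implicit Types (s t : forall x, V x) (G : set (forall x, V x)) (Z : set X).

(* The properties of Gamma0 E that matter here; they let sections of a bundle
   and scalar functions be treated alike. *)
Record section_module G : Prop := SectionModule {
  smod0 : G (fun x => 0);
  smodD : forall s t, G s -> G t -> G (fun x => s x + t x);
  smodZ : forall (a : C R) s, G s -> G (fun x => a *: s x);
  smodM : forall (f : X -> R) s, continuous f -> (forall x, 0 <= f x <= 1) -> G s ->
    G (fun x => toC (f x) *: s x);
  smod_lim : forall s,
    (forall e, 0 < e -> exists2 t, G t & forall x, rnorm (s x - t x) <= e) -> G s;
  smod_usc : forall s, G s -> upper_semicontinuous (fun x => rnorm (s x));
  smod_vanish : forall s, G s -> vanishes_at_infinity (fun x => rnorm (s x)) }.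

Definition locally_in G Z s (x : X) := forall e : R, 0 < e -> exists2 t, G t &
  \forall y \near x, Z y -> rnorm (s y - t y) < e.

Definition vanishes_on Z s := forall e : R, 0 < e -> exists2 K, compact K &
  forall x, Z x -> ~ K x -> rnorm (s x) < e.

Lemma rnorm_toC (x : R) : 0 <= x -> rnorm (toC x) = x.
Proof.
move=> x0; have /ger0_norm : 0 <= toC x by rewrite -toC0 toC_le.
by rewrite /rnorm => ->; exact: toCK.
Qed.

Lemma rnorm_sum (W : normedModType (C R)) (I : Type) (l : seq I) (P : pred I) (f : I -> W) :
  rnorm (\sum_(i <- l | P i) f i) <= \sum_(i <- l | P i) rnorm (f i).
Proof.
elim/big_rec2 : _ => [|i y z _ yz]; first by rewrite rnorm0.
by apply: le_trans (rnormD _ _) _; rewrite lerD2l.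
Qed.

Lemma toC_sum (I : Type) (l : seq I) (f : I -> R) :
  toC (\sum_(i <- l) f i) = \sum_(i <- l) toC (f i).
Proof. by elim/big_rec2 : _ => [//|i y z _ <-]; rewrite toCD. Qed.

Lemma patch_le (W : normedModType (C R)) (I : eqType) (l : seq I) (f : I -> R)
    (g : I -> W) (r : W) (c : R) : 0 <= c ->
  (forall i, i \in l -> 0 <= f i /\ (f i = 0 \/ rnorm (r - g i) <= c)) ->
  \sum_(i <- l) f i <= 1 -> (\sum_(i <- l) f i = 1 \/ rnorm r <= c) ->
  rnorm (r - \sum_(i <- l) toC (f i) *: g i) <= c.
Proof.
move=> c0 fg f1 fr.
have -> : r - \sum_(i <- l) toC (f i) *: g i =
    toC (1 - \sum_(i <- l) f i) *: r + \sum_(i <- l) toC (f i) *: (r - g i).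
  rewrite [X in _ = _ + X](_ : _ = \sum_(i <- l) (toC (f i) *: r - toC (f i) *: g i)).
    rewrite sumrB -scaler_suml -toC_sum addrA -scalerDl -toCD subrK.
    by rewrite (_ : toC 1 = 1)// scale1r.
  by apply: eq_bigr => i _; rewrite scalerBr.
apply: le_trans (rnormD _ _) _; rewrite rnormZ rnorm_toC ?subr_ge0//.
apply: (@le_trans _ _ ((1 - \sum_(i <- l) f i) * c + \sum_(i <- l) f i * c)).
  apply: lerD.
    case: fr => [->|rc]; first by rewrite subrr !mul0r.
    by rewrite ler_wpM2l// subr_ge0.
  apply: le_trans (rnorm_sum _ _ _) _; rewrite !big_seq.
  apply: ler_sum => i il; rewrite rnormZ; have [f0 fc] := fg i il.
  rewrite rnorm_toC//; case: fc => [->|fc]; first by rewrite !mul0r.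
  by rewrite ler_wpM2l.
by rewrite -mulr_suml -mulrDl subrK mul1r.
Qed.

Section closure.
Context {G} (HG : section_module G).

Lemma smod_sum (I : eqType) (l : seq I) (g : I -> forall x, V x) :
  (forall i, i \in l -> G (g i)) -> G (fun x => \sum_(i <- l) g i x).
Proof.
elim: l => [|i l IH] Gg.
  rewrite (_ : (fun _ => _) = (fun x => 0)); first exact: smod0.
  by apply: functional_extensionality_dep => x; rewrite big_nil.
rewrite (_ : (fun _ => _) = (fun x => g i x + \sum_(j <- l) g j x)).
  apply: smodD => //; first by apply: Gg; rewrite mem_head.
  by apply: IH => j jl; apply: Gg; rewrite inE jl orbT.
by apply: functional_extensionality_dep => x; rewrite big_cons.
Qed.

Lemma locally_in_smod Z s x : G s -> locally_in G Z s x.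
Proof.
by move=> Gs e e0; exists s => //; apply: nearW => y _; rewrite subrr rnorm0.
Qed.

Lemma locally_inD Z s t x : locally_in G Z s x -> locally_in G Z t x ->
  locally_in G Z (fun x => s x + t x) x.
Proof.
move=> sG tG e e0; have e20 : 0 < e / 2 by rewrite divr_gt0.
have [s' Gs' ss'] := sG _ e20; have [t' Gt' tt'] := tG _ e20.
exists (fun x => s' x + t' x); first exact: smodD.
apply: filterS2 ss' tt' => y sy ty Zy.
rewrite opprD addrACA [e]splitr; apply: le_lt_trans (rnormD _ _) _.
by rewrite ltrD ?sy ?ty.
Qed.

Lemma locally_inC Z s x (a : C R) : locally_in G Z s x ->
  locally_in G Z (fun x => a *: s x) x.
Proof.
move=> sG e e0; have a10 : 0 < rnorm a + 1 by rewrite ltr_wpDl ?rnorm_ge0.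
have [t Gt st] := sG (e / (rnorm a + 1)) (divr_gt0 e0 a10).
exists (fun x => a *: t x); first exact: smodZ.
apply: filterS st => y sy /sy; rewrite -scalerBr rnormZ ltr_pdivlMr//.
by apply: le_lt_trans; rewrite mulrC ler_wpM2l ?rnorm_ge0// lerDl.
Qed.

Lemma locally_in_small Z s x :
  (forall e : R, 0 < e -> \forall y \near x, Z y -> rnorm (s y) < e) -> locally_in G Z s x.
Proof.
move=> s0 e e0; exists (fun=> 0); first exact: smod0.
by apply: filterS (s0 e e0) => y sy /sy; rewrite subr0.
Qed.

Lemma locally_in_usc Z s x (e : R) : Z x -> locally_in G Z s x -> rnorm (s x) < e ->
  \forall y \near x, Z y -> rnorm (s y) < e.
Proof.
move=> Zx sG se; pose d := (e - rnorm (s x)) / 3.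
have d0 : 0 < d by rewrite divr_gt0// subr_gt0.
have [t Gt st] := sG d d0.
have tx : rnorm (t x) < rnorm (s x) + d.
  have := nbhs_singleton st Zx; rewrite rnormB => h.
  by rewrite -[t x](subrK (s x)) addrC; apply: le_lt_trans (rnormD _ _) _; rewrite ltrD2l.
apply: filterS2 st (smod_usc HG Gt tx) => y /[swap] ty /[apply] sy.
rewrite -[s y](subrK (t y)); apply: le_lt_trans (rnormD _ _) _.
move: sy ty; rewrite /d; lra.
Qed.

Lemma locally_in_lim Z s x :
  (forall e : R, 0 < e -> exists2 t, locally_in G Z t x &
     \forall y \near x, Z y -> rnorm (s y - t y) < e) -> locally_in G Z s x.
Proof.
move=> sG e e0; have e20 : 0 < e / 2 by rewrite divr_gt0.
have [t tG st] := sG _ e20; have [u Gu tu] := tG _ e20; exists u => //.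
apply: filterS2 st tu => y sy ty Zy; rewrite -(subrKA (t y)) [e]splitr.
by apply: le_lt_trans (rnormD _ _) _; rewrite ltrD ?sy ?ty.
Qed.

Lemma locally_inM Z s x (a : X -> C R) : Z x ->
  (a @ within Z (nbhs x) --> a x) -> locally_in G Z s x ->
  locally_in G Z (fun y => a y *: s y) x.
Proof.
move=> Zx ax sG; have sx := rnorm_ge0 (s x).
apply: locally_in_lim => e e0.
exists (fun y => a x *: s y); first exact: locally_inC.
have sb : \forall y \near x, Z y -> rnorm (s y) < rnorm (s x) + 1.
  by apply: locally_in_usc => //; rewrite ltrDl.
have sx1 : 0 < rnorm (s x) + 1 by rewrite ltr_wpDl.
have ab : \forall y \near x, Z y -> rnorm (a y - a x) < e / (rnorm (s x) + 1).
  apply: (ax [set b | rnorm (b - a x) < e / (rnorm (s x) + 1)]).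
  apply/nbhs_rnormP; exists (e / (rnorm (s x) + 1)); first exact: divr_gt0.
  by move=> w; rewrite rnormB.
apply: filterS2 sb ab => y sy ay Zy; rewrite -scalerBl rnormZ.
have {}ay := ay Zy; have {}sy := sy Zy.
apply: (@le_lt_trans _ _ (rnorm (a y - a x) * (rnorm (s x) + 1))).
  by rewrite ler_wpM2l ?rnorm_ge0// ltW.
by rewrite -ltr_pdivlMr.
Qed.

End closure.

Section extension.
Context {G} (HG : section_module G).
Hypothesis X_hausdorff : hausdorff_space X.
Hypothesis X_lc : locally_compact [set: X].
Context (Z : set X) (cZ : closed Z) (s : forall x, V x).
Hypothesis sG : forall x, Z x -> locally_in G Z s x.
Hypothesis sv : vanishes_on Z s.

Let approx (t : forall x, V x) (d : R) : G t -> 0 < d ->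
  (forall x, Z x -> rnorm (s x - t x) <= d) ->
  exists2 u, G u /\ (forall x, Z x -> rnorm (s x - u x) <= d / 2) &
    forall x, rnorm (u x - t x) <= 2 * d.
Proof.
move=> Gt d0 std; have d20 : 0 < d / 2 by rewrite divr_gt0.
have d40 : 0 < d / 2 / 2 by rewrite divr_gt0.
pose r x := s x - t x.
have rG x : Z x -> locally_in G Z r x.
  move=> Zx; rewrite (_ : r = (fun x => s x + (-1) *: t x)).
    apply: (locally_inD HG); first exact: sG.
    by apply: (locally_inC HG); exact: locally_in_smod.
  by apply: functional_extensionality_dep => y; rewrite scaleN1r.
have [K1 cK1 Ks] := sv d40; have [K2 cK2 Kt] := smod_vanish HG Gt d40.
pose K := (K1 `|` K2) `&` Z.
have cK : compact K by apply: compact_closedI => //; exact: compactU.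
have Kr x : Z x -> ~ K x -> rnorm (r x) <= d / 2.
  move=> Zx nK; have [n1 n2] : ~ K1 x /\ ~ K2 x by split=> h; apply: nK; split=> //; [left|right].
  rewrite [leRHS]splitr; apply: le_trans (rnormD _ _) _; rewrite rnormN.
  by rewrite lerD// ltW// ?Ks// Kt.
have /choice[g gP] : forall x, exists g : forall x, V x, K x -> G g /\
    \forall y \near x, (Z y -> rnorm (r y - g y) < d / 2) /\ rnorm (g y) < 2 * d.
  move=> x; have [[_ Zx]|] := pselect (K x); last by exists (fun=> 0).
  have [g Gg rg] := rG x Zx _ d20; exists g => _; split=> //.
  have gx : rnorm (g x) < 2 * d.
    have := nbhs_singleton rg Zx; rewrite rnormB => h.
    rewrite -[g x](subrK (r x)); apply: le_lt_trans (rnormD _ _) _.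
    by have := std x Zx; move: h; rewrite -/(r x); lra.
  exact: filterS2 rg (smod_usc HG Gg gx).
pose O x := [set y | (Z y -> rnorm (r y - g x y) < d / 2) /\ rnorm (g x y) < 2 * d].
have KO x : K x -> nbhs x (O x) by move=> /gP[].
have [l [f [lP f1 fK]]] := finite_partition (R := R) X_hausdorff X_lc cK KO.
pose h x := \sum_(y <- l) toC (f y x) *: g y x.
have f0 y x : y \in l -> 0 <= f y x by move=> /lP[_ [_ + _] _]; apply.
have fO y x : y \in l -> f y x = 0 \/ O y x.
  move=> /lP[_ [_ _ [C' _ [C'O C'0]]] _].
  by have [/C'O|/C'0] := pselect (C' x); [right|left].
have Gh : G h.
  apply: (smod_sum HG) => y yl; have [Ky [fc fy0 _] fy1] := lP y yl.
  apply: (smodM HG) => //; first by move=> x; rewrite fy0 fy1.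
  by have [] := gP y Ky.
exists (fun x => t x + h x); first split; first exact: smodD.
- move=> x Zx; rewrite opprD addrA -/(r x); apply: patch_le => //.
  + exact: ltW.
  + move=> y yl; split; first exact: f0.
    have [->|[h1 _]] := fO y x yl; first by left.
    by right; rewrite ltW// h1.
  + by have [Kx|Kx] := pselect (K x); [left; exact: fK|right; exact: Kr].
- move=> x; rewrite addrC addKr -rnormN -sub0r; apply: patch_le => //.
  + by rewrite mulr_ge0// ltW.
  + move=> y yl; split; first exact: f0.
    have [->|[_ h1]] := fO y x yl; first by left.
    by right; rewrite sub0r rnormN ltW.
  + by right; rewrite rnorm0 mulr_ge0// ltW.
Qed.

Theorem section_extension (m : R) : 0 < m -> (forall x, Z x -> rnorm (s x) <= m) ->
  exists2 t, G t & (forall x, Z x -> t x = s x) /\ forall x, rnorm (t x) <= 4 * m.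
Proof.
move=> m0 sm.
pose P n t := G t /\ forall x, Z x -> rnorm (s x - t x) <= m / 2 ^+ n.
have [|||u [t [u0 uP uS tu]]] := @sup_iteration _ _ V P (2 * m) (fun=> 0).
- by rewrite mulr_ge0// ltW.
- by split; [exact: smod0|move=> x Zx; rewrite subr0 expr0 divr1 sm].
- move=> n v [Gv sv']; have mn0 : 0 < m / 2 ^+ n by rewrite divr_gt0// exprn_gt0.
  have [w [Gw sw] wv] := approx Gv mn0 sv'; exists w.
    by split=> // x Zx; rewrite exprSr invfM mulrA sw.
  by move=> x; rewrite -mulrA wv.
have m40 : 0 <= 2 * (2 * m) by rewrite !mulr_ge0// ltW.
exists t; last split.
- apply: (smod_lim HG) => e e0; have [n ne] := half_pow_small m40 e0.
  by exists (u n) => [|x]; [have [] := uP n|apply: le_trans (tu n x) (ltW ne)].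
- move=> x Zx; apply/eqP; rewrite -subr_eq0; apply/eqP/rnorm_eq0/le_anti.
  rewrite rnorm_ge0 andbT; apply/ler_addgt0Pr => e e0; rewrite add0r.
  have [n ne] := half_pow_small (addr_ge0 m40 (ltW m0)) e0.
  rewrite -(subrKA (u n x)); apply: le_trans (rnormD _ _) _.
  apply: le_trans (ltW ne); rewrite mulrDl; apply: lerD; first exact: tu.
  by rewrite rnormB; have [_] := uP n; apply.
- move=> x; have := tu 0%N x; rewrite u0 subr0 expr0 divr1; lra.
Qed.

End extension.
End section_modules.

Section examples.
Context {R : realType} {X : topologicalType}.

Lemma vanish_scale (V : X -> normedModType (C R)) (f : X -> R) (s : forall x, V x) :
  (forall x, 0 <= f x <= 1) -> vanishes_at_infinity (fun x => rnorm (s x)) ->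
  vanishes_at_infinity (fun x => rnorm (toC (f x) *: s x)).
Proof.
move=> f01 sv e e0; have [K cK Ks] := sv e e0; exists K => // x Kx.
have /andP[f0 f1] := f01 x; rewrite rnormZ rnorm_toC//.
by apply: le_lt_trans (Ks x Kx); rewrite ler_piMl// rnorm_ge0.
Qed.

Lemma vanish_lim (V : X -> normedModType (C R)) (s : forall x, V x) :
  (forall e : R, 0 < e -> exists2 t : forall x, V x,
    vanishes_at_infinity (fun x => rnorm (t x)) & forall x, rnorm (s x - t x) <= e) ->
  vanishes_at_infinity (fun x => rnorm (s x)).
Proof.
move=> st e e0; have e20 : 0 < e / 2 by rewrite divr_gt0.
have [t tv tst] := st _ e20; have [K cK Kt] := tv _ e20; exists K => // x Kx.
rewrite -[s x](subrK (t x)) [e]splitr; apply: le_lt_trans (rnormD _ _) _.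
by rewrite ler_ltD ?tst ?Kt.
Qed.

Section bundle.
Context (E : hbundle R X).

Definition Gamma0_set : set (forall x, E x) := [set s |
  continuous (fun x => to_total E (s x)) /\ vanishes_at_infinity (fun x => rnorm (s x))].

Lemma Gamma0_setP (s : Gamma0 E) : Gamma0_set s.
Proof. by split; [exact: Gamma0_continuous|exact: Gamma0_vanish]. Qed.

Lemma Gamma0_setE (s : forall x, E x) : Gamma0_set s ->
  exists t : Gamma0 E, (t : forall x, E x) = s.
Proof. by move=> [sc sv]; exists (MkGamma0 sc sv). Qed.

Lemma Gamma0_module : section_module Gamma0_set.
Proof.
split.
- exact: (@Gamma0_setP (0 : Gamma0 E)).
- move=> s t /Gamma0_setE[s' <-] /Gamma0_setE[t' <-].
  exact: (@Gamma0_setP (s' + t')).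
- by move=> a s /Gamma0_setE[s' <-]; exact: (@Gamma0_setP (a *: s')).
- move=> f s fc f01 [sc sv]; split; last exact: vanish_scale.
  by apply: (@sectionZ_continuous _ _ E (fun x => toC (f x))) => // x; apply: cvg_toC; exact: fc.
- move=> s st; split.
    apply: section_limit_continuous => e e0; have [|t [tc _] stx] := st (e / 2).
      by rewrite divr_gt0.
    exists t => // x; apply: le_lt_trans (stx x) _.
    by rewrite ltr_pdivrMr// ltr_pMr// ltr1n.
  by apply: vanish_lim => e e0; have [t [_ tv] stx] := st _ e0; exists t.
- move=> s [sc _] x a sxa.
  exact: sc (fiber_norm_usc (hbundleP E) (t := to_total E (s x)) sxa).
- by move=> s [].
Qed.

End bundle.

Definition C0_set : set (X -> Ccomplete) := [set a |
  continuous (a : X -> C R) /\ vanishes_at_infinity (fun x => rnorm (a x))].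

Lemma C0_module : section_module (V := fun=> Ccomplete) C0_set.
Proof.
have contP (a : X -> C R) : continuous a <-> forall x e, 0 < e ->
    \forall y \near x, rnorm (a y - a x) < e.
  split=> [ac x e e0|ac x W /nbhs_rnormP[e e0 eW]].
    apply: (ac x [set b | rnorm (b - a x) < e]); apply/nbhs_rnormP; exists e => // w.
    by rewrite rnormB.
  by apply: filterS (ac x e e0) => y; rewrite rnormB; exact: eW.
split.
- split; first by move=> x; apply: cvg_cst.
  by move=> e e0; exists set0; [exact: compact0|move=> x _; rewrite rnorm0].
- move=> s t [sc sv] [tc tv]; split.
    by move=> x; apply: (@cvgD (C R) (C R)); [exact: sc|exact: tc].
  apply: (vanish_le2 sv tv) => e e0; exists (e / 2); first by rewrite divr_gt0.
  by move=> x sx tx; apply: le_lt_trans (rnormD _ _) _; rewrite [e]splitr ltrD.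
- move=> a s [sc sv]; split.
    by move=> x; apply: (@cvgM (C R)); [exact: (@cvg_cst (C R))|exact: sc].
  move=> e e0; have a10 : 0 < rnorm a + 1 by rewrite ltr_wpDl// rnorm_ge0.
  have [K cK Ks] := sv _ (divr_gt0 e0 a10); exists K => // x Kx; rewrite rnormZ.
  apply: (@le_lt_trans _ _ ((rnorm a + 1) * rnorm (s x))).
    by rewrite ler_wpM2r ?rnorm_ge0// lerDl.
  by rewrite mulrC -ltr_pdivlMr// Ks.
- move=> f s fc f01 [sc sv]; split; last exact: vanish_scale.
  move=> x; apply: (@cvgM (C R)); last exact: sc.
  by apply: cvg_toC; exact: fc.
- move=> s st; split.
    apply/contP => x e e0; have e30 : 0 < e / 4 by rewrite divr_gt0.
    have [t [/contP tc _] stx] := st _ e30.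
    apply: filterS (tc x _ e30) => y ty.
    have := rnormD (s y - t y) (t y - t x); rewrite subrKA.
    have := rnormD (s y - t x) (t x - s x); rewrite subrKA.
    have := stx y; have := stx x; rewrite [rnorm (s x - t x)]rnormB; move: ty => /=.
    set A := rnorm _; set B := rnorm _; set C' := rnorm _; set D := rnorm _; lra.
  by apply: vanish_lim => e e0; have [t [_ tv] stx] := st _ e0; exists t.
- move=> s [/contP sc _] x a sxa.
  have d0 : 0 < a - rnorm (s x) by rewrite subr_gt0.
  apply: filterS (sc x _ d0) => y sy.
  have := rnormD (s y - s x) (s x); rewrite subrK => /le_lt_trans; apply.
  by rewrite -ltrBrDr.
- by move=> s [].
Qed.

End examples.

(** * Existence of continuous sections *)

Section selection.
Context {R : realType} {X : topologicalType} (E : hbundle R X).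
Implicit Types (s : forall x, E x) (e d : R).

Let HE := hbundleP E.

Lemma nbhs_add x (v w : E x) (W : set (total E)) : nbhs (to_total E (v + w)) W ->
  exists W1 W2, [/\ nbhs (to_total E v) W1, nbhs (to_total E w) W2 &
    forall y (a b : E y), W1 (to_total E a) -> W2 (to_total E b) -> W (to_total E (a + b))].
Proof.
move=> vW.
pose q0 : initial_topology (@fiber_pair_incl _ _ E) :=
  existT (fun x => (E x * E x)%type) x (v, w).
have [//|_ [[B oB <-] Bq BW]] := @fiber_add_continuous _ _ _ HE q0 W.
have [[B1 B2]/= [B1v B2w] B12] : nbhs (to_total E v, to_total E w) B.
  exact: (open_nbhs_nbhs (conj oB Bq)).
exists B1, B2; split=> // y a b B1a B2b.
by apply: (BW (existT (fun x => (E x * E x)%type) y (a, b))); apply: B12.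
Qed.

Lemma nbhs_scale x (a : C R) (v : E x) (W : set (total E)) : nbhs (to_total E (a *: v)) W ->
  exists A W1, [/\ nbhs a A, nbhs (to_total E v) W1 &
    forall y b (w : E y), A b -> W1 (to_total E w) -> W (to_total E (b *: w))].
Proof.
move=> vW.
have [[A W1]/= [Aa W1v] AW] := @fiber_scale_continuous _ _ _ HE (a, to_total E v) W vW.
by exists A, W1; split=> // y b w Ab W1w; apply: (AW (b, to_total E w)).
Qed.

Lemma nbhs_add_ball x (v : E x) (W : set (total E)) : nbhs (to_total E v) W ->
  exists V e, [/\ nbhs (to_total E v) V, 0 < e &
    forall y (w z : E y), V (to_total E w) -> rnorm z < e -> W (to_total E (w + z))].
Proof.
move=> vW; have : nbhs (to_total E (v + 0)) W by rewrite addr0.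
move=> /nbhs_add[W1 [W2 [W1v W20 W12]]].
have /(nbhs_zero HE)[U [e [xU e0 UW2]]] := W20.
exists (W1 `&` (proj E) @^-1` U), e; split=> //.
  apply: filterI => //; exact: (@proj_continuous _ _ _ HE (to_total E v) U xU).
by move=> y w z [W1w Uy] ze; apply: W12 => //; apply: UW2.
Qed.

Definition thin e (W : set (total E)) := forall y (a b : E y),
  W (to_total E a) -> W (to_total E b) -> rnorm (a - b) <= e.

Lemma exists_thin x (v : E x) e : 0 < e ->
  exists2 W, open W /\ thin e W & W (to_total E v).
Proof.
move=> e0; have : nbhs (to_total E (v + -1 *: v)) [set p | fiber_norm p < e].
  apply: (fiber_norm_usc HE (t := to_total E (v + -1 *: v))).
  by rewrite /fiber_norm/= scaleN1r subrr rnorm0.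
move=> /nbhs_add[W1 [W2 [W1v /nbhs_scale[A [W3 [Aa W3v AW]]] W12]]].
have : nbhs (to_total E v) (W1 `&` W3) by apply: filterI.
rewrite nbhsE => -[W [oW Wv] W13]; exists W => //; split=> // y a b /W13[W1a _] /W13[_ W3b].
rewrite -[- b]scaleN1r ltW//; apply: W12 => //; apply: AW => //.
exact: nbhs_singleton Aa.
Qed.

(* Continuity of the section s at x, up to an error e in norm. *)
Definition almost_continuous e s (x : X) := forall (W : set (total E)) d,
  nbhs (to_total E (s x)) W -> 0 < d ->
  \forall y \near x, exists2 w : E y, W (to_total E w) & rnorm (s y - w) < e + d.

Lemma almost_continuous_le e e' s x : e <= e' -> almost_continuous e s x ->
  almost_continuous e' s x.
Proof.
move=> ee' sx W d Ws d0; apply: filterS (sx W d Ws d0) => y [w Ww sw].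
by exists w => //; apply: lt_le_trans sw _; rewrite lerD2r.
Qed.

Lemma almost_continuous0 s x : (\forall y \near x, s y = 0) -> almost_continuous 0 s x.
Proof.
move=> s0 W d; rewrite (nbhs_singleton s0) => W0 d0.
have W0y : \forall y \near x, W (to_total E (0 : E y)) by exact: (@section0_continuous _ _ E x).
apply: filterS2 s0 W0y => y sy Wy; exists 0 => //.
by rewrite sy subr0 rnorm0 add0r.
Qed.

Lemma almost_continuousD e e' s t x : almost_continuous e s x ->
  almost_continuous e' t x -> almost_continuous (e + e') (fun y => s y + t y) x.
Proof.
move=> sx tx W d /nbhs_add[W1 [W2 [W1s W2t W12]]] d0.
have d20 : 0 < d / 2 by rewrite divr_gt0.
apply: filterS2 (sx _ _ W1s d20) (tx _ _ W2t d20) => y [a Wa sa] [b Wb tb].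
exists (a + b); first exact: W12.
rewrite opprD addrACA; apply: le_lt_trans (rnormD _ _) _.
by move: sa tb; lra.
Qed.

Lemma almost_continuousM e (f : X -> R) s x : 0 <= e -> {for x, continuous f} ->
  (forall y, 0 <= f y <= 1) -> almost_continuous e s x ->
  almost_continuous (f x * e) (fun y => toC (f y) *: s y) x.
Proof.
move=> e0 fx f01 sx W d /nbhs_scale[A [W1 [Aa W1s AW]]] d0.
have d20 : 0 < d / 2 by rewrite divr_gt0.
have e10 : 0 < e + 1 by rewrite ltr_wpDl.
have fA : \forall y \near x, A (toC (f y)) by exact: (cvg_toC _ fx Aa).
have fd : \forall y \near x, f y < f x + d / 2 / (e + 1).
  by apply: (cvgr_lt _ fx); rewrite ltrDl divr_gt0.
apply: filterS3 fA fd (sx _ _ W1s d20) => y Ay fy [w Ww sw].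
have /andP[fy0 fy1] := f01 y.
exists (toC (f y) *: w); first exact: AW.
rewrite -scalerBr rnormZ rnorm_toC//.
have h : f y * e <= f x * e + d / 2.
  apply: (@le_trans _ _ ((f x + d / 2 / (e + 1)) * e)); first by rewrite ler_wpM2r// ltW.
  rewrite mulrDl lerD2l -mulrA ger_pMr// mulrC ler_pdivrMr// mul1r.
  by rewrite lerDl.
have [fy00|fy0'] := eqVneq (f y) 0.
  by rewrite fy00 mul0r; move: h; rewrite fy00; lra.
have fyp : 0 < f y by rewrite lt_neqAle eq_sym fy0'.
have : f y * rnorm (s y - w) < f y * (e + d / 2) by rewrite ltr_pM2l.
have : f y * (d / 2) <= d / 2 by rewrite ler_piMl// ltW.
move: h; rewrite mulrDr; lra.
Qed.

Lemma almost_continuous_sum e (I : eqType) (l : seq I) (f : I -> X -> R)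
    (g : I -> forall x, E x) x : 0 <= e ->
  (forall i, i \in l -> [/\ continuous (f i), forall y, 0 <= f i y <= 1 &
     (\forall y \near x, f i y = 0) \/ almost_continuous e (g i) x]) ->
  almost_continuous ((\sum_(i <- l) f i x) * e)
    (fun y => \sum_(i <- l) toC (f i y) *: g i y) x.
Proof.
move=> e0; elim: l => [|i l IH] fg.
  rewrite big_nil mul0r; apply: almost_continuous0.
  by apply: nearW => y; rewrite big_nil.
have -> : (fun y => \sum_(j <- i :: l) toC (f j y) *: g j y) =
    (fun y => toC (f i y) *: g i y + \sum_(j <- l) toC (f j y) *: g j y).
  by apply: functional_extensionality_dep => y; rewrite big_cons.
rewrite big_cons mulrDl; apply: almost_continuousD; last first.
  by apply: IH => j jl; apply: fg; rewrite inE jl orbT.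
have [|fc f01 [f0|gx]] := fg i; first by rewrite mem_head.
  rewrite (nbhs_singleton f0) mul0r; apply: almost_continuous0.
  by apply: filterS f0 => y ->; rewrite toC0 scale0r.
by apply: almost_continuousM => //; exact: fc.
Qed.

Lemma thin_almost_continuous e (W : set (total E)) (O : set X) s : open W -> thin e W ->
  open O -> (forall y, O y -> W (to_total E (s y))) ->
  forall x, O x -> almost_continuous e s x.
Proof.
move=> oW tW oO sW x Ox W' d W's d0.
have oU : open (W `&` interior W') by apply: openI => //; exact: open_interior.
have oP := proj_open HE oU.
have : nbhs x (O `&` [set proj E p | p in W `&` interior W']).
  apply: open_nbhs_nbhs; split; first exact: openI.
  by split=> //; exists (to_total E (s x)) => //; split=> //; exact: sW.
apply: filterS => z [Oz [[y w] [Ww /interior_subset W'w] /= yz]]; subst z; exists w => //.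
by apply: (@le_lt_trans _ _ e); [apply: tW => //; exact: sW|rewrite ltrDl].
Qed.

Hypothesis X_hausdorff : hausdorff_space X.
Hypothesis X_lc : locally_compact [set: X].

Let smoothen e s d : 0 < e -> 0 < d -> (forall x, almost_continuous e s x) ->
  vanishes_at_infinity (fun x => rnorm (s x)) ->
  exists2 t : forall x, E x, (forall x, almost_continuous d t x) /\
    vanishes_at_infinity (fun x => rnorm (t x)) & forall x, rnorm (t x - s x) <= 2 * e.
Proof.
move=> e0 d0 sc sv.
have /choice[ O OP] : forall x, exists O : set X, [/\ open O, O x &
    exists2 g : forall x, E x, forall y, O y -> almost_continuous d g y &
      forall y, O y -> rnorm (s y - g y) <= 2 * e].
  move=> x; have [W [oW tW] Ws] := exists_thin (s x) d0.
  pose O := interior [set y | exists2 w : E y, W (to_total E w) & rnorm (s y - w) < e + e].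
  have oO : open O by exact: open_interior.
  have Ox : O x by apply: sc => //; exact: open_nbhs_nbhs.
  have gex y : exists w : E y, O y -> W (to_total E w) /\ rnorm (s y - w) < e + e.
    by have [/interior_subset[w Ww sw]|] := pselect (O y); [exists w|exists 0].
  pose g y := sval (cid (gex y)).
  have gP y : O y -> W (to_total E (g y)) /\ rnorm (s y - g y) < e + e.
    exact: (svalP (cid (gex y))).
  exists O; split=> //; exists g => y Oy; last by rewrite mulrDl mul1r ltW//; case: (gP y Oy).
  by apply: (thin_almost_continuous oW tW oO) Oy => z /gP[].
have gex x : exists g : forall x, E x, (forall y, O x y -> almost_continuous d g y) /\
      forall y, O x y -> rnorm (s y - g y) <= 2 * e.
  by have [_ _ [g ? ?]] := OP x; exists g.
have /choice[g gP] := gex.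
have e20 : 0 < 2 * e by rewrite mulr_gt0.
have [K cK Ks] := sv _ e20.
have KO x : K x -> nbhs x (O x) by move=> _; apply: open_nbhs_nbhs; have [] := OP x.
have [l [f [lP f1 fK]]] := finite_partition (R := R) X_hausdorff X_lc cK KO.
pose t x := \sum_(y <- l) toC (f y x) *: g y x.
have f0 y x : y \in l -> 0 <= f y x by move=> /lP[_ [_ + _] _]; apply.
exists t; first split.
- move=> x; apply: (@almost_continuous_le ((\sum_(y <- l) f y x) * d)).
    by rewrite ler_piMl// ltW.
  apply: almost_continuous_sum; first exact: ltW.
  move=> y yl; have [Ky bf fy1] := lP y yl; have [fc _ _] := bf.
  split=> //; first by move=> z; rewrite f0// fy1.
  by have [Oy|] := bump_cases X_hausdorff bf x; [right; apply: (gP y).1|left].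
- have [K' cK' K'0] : exists2 K' : set X, compact K' & forall x, ~ K' x -> t x = 0.
    rewrite /t; elim: l lP {f1 fK t f0} => [|y l IH] lP.
      by exists set0; [exact: compact0|move=> x _; rewrite big_nil].
    have [|K1 cK1 K1t] := IH; first by move=> z zl; apply: lP; rewrite inE zl orbT.
    have [|_ [_ _ [K2 cK2 [_ K2f]]] _] := lP y; first by rewrite mem_head.
    exists (K1 `|` K2); first exact: compactU.
    by move=> x /not_orP[n1 n2]; rewrite big_cons K2f// toC0 scale0r add0r K1t.
  by move=> r r0; exists K' => // x /K'0 ->; rewrite rnorm0.
- move=> x; rewrite rnormB; apply: patch_le; first exact: ltW.
  + move=> y yl; split; first exact: f0.
    have [_ [_ _ [C' _ [C'O C'0]]] _] := lP y yl.
    by have [/C'O Oy|/C'0] := pselect (C' x); [right; exact: (gP y).2|left].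
  + exact: f1.
  + by have [Kx|Kx] := pselect (K x); [left; exact: fK|right; rewrite ltW// Ks].
Qed.

Let limit_continuous (u : nat -> forall x, E x) (l : forall x, E x) d : 0 < d ->
  (forall n x, almost_continuous (d / 2 ^+ n) (u n) x) ->
  (forall n x, rnorm (l x - u n x) <= 4 * d / 2 ^+ n) ->
  continuous (fun x => to_total E (l x)).
Proof.
move=> d0 uc lu x W /nbhs_add_ball[V [e1 [lV e10 VW]]].
have [V' [e2 [lV' e20 VV']]] := nbhs_add_ball (nbhs_interior lV).
have e120 : 0 < Num.min e1 e2 by rewrite lt_min e10.
have d60 : 0 <= 6 * d by rewrite mulr_ge0// ltW.
have [n] := half_pow_small d60 e120; rewrite lt_min => /andP[n1 n2].
have dn0 : 0 < d / 2 ^+ n by rewrite divr_gt0// exprn_gt0.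
have uV : interior V (to_total E (u n x)).
  rewrite -[u n x](subrK (l x)) addrC; apply: VV'; first exact: nbhs_singleton lV'.
  rewrite rnormB; apply: le_lt_trans (lu n x) _; apply: le_lt_trans n2.
  by rewrite ler_pM2r ?invr_gt0 ?exprn_gt0//; lra.
have := uc n x V _ uV dn0; apply: filterS => y [w Vw uw] /=.
rewrite -[l y](subrK w) addrC; apply: VW => //.
rewrite -(subrKA (u n y)); apply: le_lt_trans (rnormD _ _) _.
apply: lt_le_trans (ltW n1); have := lu n y.
by move: uw; rewrite -(mulrA 4) -(mulrA 6); lra.
Qed.

Theorem fiber_dense x (v : E x) e : 0 < e ->
  exists2 s, Gamma0_set s & rnorm (s x - v) <= e.
Proof.
move=> e0; pose d := e / 4; have d0 : 0 < d by rewrite divr_gt0.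
have [W [oW tW] Wv] := exists_thin v d0.
pose O := [set proj E p | p in W].
have oO : open O by exact: (proj_open HE).
have Ox : O x by exists (to_total E v).
have gex y : exists w : E y, O y -> W (to_total E w).
  by have [[[z w] Ww <-]|] := pselect (O y); [exists w|exists 0].
have gex' y : exists w : E y, (O y -> W (to_total E w)) /\ forall h : x = y, w = ecast z (E z) h v.
  have [xy|] := pselect (x = y); last by have [w ?] := gex y; exists w.
  by subst y; exists v; split=> // h; rewrite (eq_irrelevance h erefl).
pose g y := sval (cid (gex' y)).
have gO y : O y -> W (to_total E (g y)) by have [] := svalP (cid (gex' y)).
have gx : g x = v by have [_ /(_ erefl)] := svalP (cid (gex' x)).
have [f bf [f1 fx]] := exists_bump (R := R) X_hausdorff X_lc (open_nbhs_nbhs (conj oO Ox)).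
have [fc f0 [K cK [KO K0]]] := bf.
pose s y := toC (f y) *: g y.
have f01 y : 0 <= f y <= 1 by rewrite f0 f1.
pose P n (t : forall x, E x) := (forall x, almost_continuous (d / 2 ^+ n) t x) /\
  vanishes_at_infinity (fun x => rnorm (t x)).
have [|||u [l [u0 uP _ lu]]] := @sup_iteration _ _ E P (2 * d) s.
- by rewrite mulr_ge0// ltW.
- split; last first.
    by move=> r r0; exists K => // y /K0 fy; rewrite /s fy toC0 scale0r rnorm0.
  rewrite expr0 divr1 => y; have [Oy|fy] := bump_cases X_hausdorff bf y; last first.
    apply: almost_continuous_le (ltW d0) _; apply: almost_continuous0.
    by apply: filterS fy => z fz; rewrite /s fz toC0 scale0r.
  apply: (@almost_continuous_le (f y * d)); first by rewrite ler_piMl// ltW.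
  apply: almost_continuousM; [exact: ltW|exact: fc|exact: f01|].
  exact: (thin_almost_continuous oW tW oO gO Oy).
- move=> n t [tc tv]; have dn k : 0 < d / 2 ^+ k by rewrite divr_gt0// exprn_gt0.
  have [t1 [t1c t1v] tt1] := @smoothen _ _ _ (dn n) (dn n.+1) tc tv.
  by exists t1 => // y; rewrite -mulrA.
exists l; first split.
- apply: (limit_continuous d0 (fun n => (uP n).1)) => n y.
  by have := lu n y; rewrite mulrA -natrM.
- apply: vanish_lim => r r0; have d4 : 0 <= 2 * (2 * d) by rewrite !mulr_ge0// ltW.
  have [n nr] := half_pow_small d4 r0.
  exists (u n); first by have [] := uP n.
  by move=> y; apply: le_trans (lu n y) (ltW nr).
have := lu 0%N x; rewrite u0 expr0 divr1 /s (nbhs_singleton fx) gx.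
by rewrite (_ : toC 1 = 1)// scale1r /d; lra.
Qed.

End selection.

Section extension_corollaries.
Context {R : realType} {X : topologicalType}.
Hypothesis X_hausdorff : hausdorff_space X.
Hypothesis X_lc : locally_compact [set: X].

Lemma Gamma0_extension (E : hbundle R X) (Z : set X) (s : forall x, E x) (m : R) :
  closed Z -> (forall x, Z x -> locally_in (@Gamma0_set R X E) Z s x) ->
  vanishes_on Z s -> 0 < m -> (forall x, Z x -> rnorm (s x) <= m) ->
  exists2 t : Gamma0 E, forall x, Z x -> t x = s x & forall x, rnorm (t x) <= 4 * m.
Proof.
move=> cZ sG sv m0 sm.
have [t /Gamma0_setE[t' <-] [ts tm]] :=
  section_extension (Gamma0_module E) X_hausdorff X_lc cZ sG sv m0 sm.
by exists t'.
Qed.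

Lemma cvg_locally_in_C0 (Z : set X) (s : X -> C R) (x : X) :
  s @ within Z (nbhs x) --> s x -> locally_in (V := fun=> Ccomplete) (@C0_set R X) Z s x.
Proof.
move=> sc e e0.
have [f [fc f0 [K cK [_ K0]]] [f1 fx]] :=
  exists_bump (R := R) X_hausdorff X_lc (@filterT _ (nbhs x) _).
exists (fun y => s x * toC (f y)); first split.
- move=> y; apply: (@cvgM (C R)); first exact: cvg_cst.
  by apply: cvg_toC; exact: fc.
- by move=> r r0; exists K => // y /K0 ->; rewrite mulr0 rnorm0.
have sx : \forall y \near x, Z y -> rnorm (s y - s x) < e.
  apply: (sc [set b | rnorm (b - s x) < e]).
  by apply/nbhs_rnormP; exists e => // w; rewrite rnormB.
by apply: filterS2 fx sx => y -> /[apply]; rewrite (_ : toC 1 = 1)// mulr1.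
Qed.

Lemma C0_extension (Z : set X) (s : X -> C R) (m : R) : closed Z ->
  (forall x, Z x -> locally_in (V := fun=> Ccomplete) (@C0_set R X) Z s x) ->
  vanishes_on (V := fun=> Ccomplete) Z s -> 0 < m -> (forall x, Z x -> rnorm (s x) <= m) ->
  exists a : C0 R X, forall x, Z x -> a x = s x.
Proof.
move=> cZ sG sv m0 sm.
have [t [tc tv] [ts _]] := section_extension C0_module X_hausdorff X_lc cZ sG sv m0 sm.
by exists (MkC0 tc tv).
Qed.

Section points.
Context (E : hbundle R X).

Lemma exists_section_through (x : X) (v : E x) : exists s : Gamma0 E, s x = v.
Proof.
have gex y : exists w : E y, forall h : x = y, w = ecast z (E z) h v.
  have [xy|] := pselect (x = y); last by exists 0.
  by subst y; exists v => h; rewrite (eq_irrelevance h erefl).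
pose g y := sval (cid (gex y)).
have gx : g x = v by have /(_ erefl) := svalP (cid (gex x)).
have v1 : 0 < rnorm v + 1 by rewrite ltr_wpDl// rnorm_ge0.
have cx : closed [set x] by apply: accessible_closed_set1; exact: hausdorff_accessible.
have [|||t tg _] := @Gamma0_extension E [set x] g (rnorm v + 1) cx _ _ v1.
- move=> _ -> e e0; have e20 : 0 < e / 2 by rewrite divr_gt0.
  have [s Gs sv] := fiber_dense X_hausdorff X_lc v e20; exists s => //.
  apply: nearW => y ->; rewrite gx rnormB; apply: le_lt_trans sv _.
  by rewrite ltr_pdivrMr// ltr_pMr// ltr1n.
- by move=> e e0; exists [set x]; [exact: compact_set1|].
- by move=> _ ->; rewrite gx lerDl.
by exists t; rewrite tg.
Qed.

Lemma cvg_locally_in (Z : set X) (s : forall x, E x) (x : X) :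
  (fun y => to_total E (s y)) @ within Z (nbhs x) --> to_total E (s x) ->
  locally_in (@Gamma0_set R X E) Z s x.
Proof.
move=> sx e e0; have [g gx] := exists_section_through (s x).
exists g; first exact: Gamma0_setP.
have : nbhs (to_total E (s x + (- g) x)) [set p | fiber_norm p < e].
  apply: (fiber_norm_usc (hbundleP E) (t := to_total E (s x + (- g) x))).
  by rewrite Gamma0N gx /fiber_norm/= subrr rnorm0.
move=> /nbhs_add[W1 [W2 [W1s W2g W12]]].
have h1 : \forall y \near x, Z y -> W1 (to_total E (s y)) by exact: sx W1s.
have h2 : \forall y \near x, W2 (to_total E ((- g) y)).
  exact: (@Gamma0_continuous _ _ _ (- g) x W2 W2g).
apply: filterS2 h1 h2 => y W1y W2y Zy.
have := W12 y (s y) ((- g) y) (W1y Zy) W2y.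
by rewrite Gamma0N.
Qed.

End points.
End extension_corollaries.

(** * Coordinates in finite-dimensional spaces *)

Section independent.
Context {R : realType} (V : normedModType (C R)).

Definition independent d (b : nat -> V) := forall c : nat -> C R,
  \sum_(i < d) c i *: b i = 0 -> forall i, (i < d)%N -> c i = 0.

Lemma independent_bounded d (b : nat -> V) : independent d b ->
  exists2 K : R, 0 < K & forall (c : nat -> C R) i, (i < d)%N ->
    rnorm (c i) <= K * rnorm (\sum_(i < d) c i *: b i).
Proof.
elim: d => [|d IH] b_ind; first by exists 1.
have [|K K0 bK] := IH.
  move=> c cb i id; have := b_ind (fun i => if (i < d)%N then c i else 0) _ i (ltnW id).
  rewrite id; apply; rewrite big_ord_recr/= ltnn scale0r addr0 -[RHS]cb.
  by apply: eq_bigr => j _; rewrite ltn_ord.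
have sumB (c c' : nat -> C R) : \sum_(i < d) c i *: b i - \sum_(i < d) c' i *: b i =
    \sum_(i < d) (c i - c' i) *: b i.
  by rewrite -sumrB; apply: eq_bigr => i _; rewrite scalerBl.
have [e e0 be] : exists2 e : R, 0 < e & forall c : nat -> C R,
    e <= rnorm (b d - \sum_(i < d) c i *: b i).
  apply: contrapT => nb.
  have small (e : R) : 0 < e -> exists2 c : nat -> C R, (forall i, (d <= i)%N -> c i = 0) &
      rnorm (b d - \sum_(i < d) c i *: b i) < e.
    move=> e0; apply: contrapT => nc; apply: nb; exists e => // c.
    rewrite leNgt; apply/negP => ce; apply: nc; exists (fun i => if (i < d)%N then c i else 0).
      by move=> i; rewrite leqNgt => /negbTE ->.
    rewrite (eq_bigr (fun i : 'I_d => c i *: b i))// => i _; by rewrite ltn_ord.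
  have h0 n : 0 < 1 / 2 ^+ n :> R by rewrite divr_gt0// exprn_gt0.
  pose P n (c : nat -> Ccomplete) := (forall i, (d <= i)%N -> c i = 0) /\
    rnorm (b d - \sum_(i < d) (c i : C R) *: b i) < 1 / 2 ^+ n.
  have [c0 c0d c01] := small _ (h0 0%N).
  have [|||u [l [_ uP _ lu]]] := @sup_iteration R nat (fun=> Ccomplete) P (K * 2) c0.
  - by rewrite mulr_ge0// ltW.
  - by split.
  - move=> n c [cd cn]; have [c' c'd c'n] := small _ (h0 n.+1); exists c' => // i.
    have [di|id] := leqP d i.
      rewrite cd// c'd// subrr rnorm0; apply: half_pow_ge0; by rewrite mulr_ge0// ltW.
    apply: le_trans (bK (fun i => c' i - c i) i id) _; rewrite -mulrA ler_pM2l//.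
    rewrite -sumB -(subrKA (b d)); apply: le_trans (rnormD _ _) _.
    rewrite rnormB; have := half_pow_le (@ler01 R) (leqnSn n).
    move: cn c'n; set A := rnorm _; set B := rnorm _; move=> /ltW cn /ltW c'n h.
    move: cn c'n h; rewrite !div1r; set q := 2 ^- n; set q' := 2 ^- n.+1; lra.
  have : b d - \sum_(i < d) (l i : C R) *: b i = 0.
    apply: rnorm_eq0; apply/le_anti; rewrite rnorm_ge0 andbT; apply/ler_addgt0Pr => r r0.
    rewrite add0r; pose M := 1 + 2 * (K * 2) * \sum_(i < d) rnorm (b i).
    have S0 : 0 <= \sum_(i < d) rnorm (b i) by apply: sumr_ge0 => i _; exact: rnorm_ge0.
    have M0 : 0 <= M by rewrite addr_ge0// !mulr_ge0// ltW.
    have [n nr] := half_pow_small M0 r0; apply: le_trans (ltW nr).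
    have [_ un] := uP n.
    rewrite -(subrKA (\sum_(i < d) (u n i : C R) *: b i)); apply: le_trans (rnormD _ _) _.
    rewrite /M mulrDl; apply: lerD; first exact: ltW.
    rewrite sumB; apply: le_trans (rnorm_sum _ _ _) _.
    rewrite mulrAC big_distrr/=; apply: ler_sum => i _; rewrite rnormZ.
    by rewrite ler_wpM2r ?rnorm_ge0// rnormB; exact: lu.
  move=> bl; have := b_ind (fun i => if (i < d)%N then - l i else 1) _ d (ltnSn d).
  rewrite ltnn big_ord_recr/= ltnn scale1r => h.
  have /eqP : (1 : C R) = 0.
    apply: h; rewrite -[RHS]bl addrC; congr (_ + _); rewrite -sumrN.
    by apply: eq_bigr => i _; rewrite ltn_ord scaleNr.
  by rewrite oner_eq0.
pose K' := e^-1 + K * (1 + e^-1 * rnorm (b d)).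
have bd0 : 0 <= rnorm (b d) by exact: rnorm_ge0.
have ei0 : 0 < e^-1 by rewrite invr_gt0.
have K1 : 0 <= K * (1 + e^-1 * rnorm (b d)).
  by rewrite mulr_ge0 ?addr_ge0 ?mulr_ge0// ltW.
exists K'; first by rewrite ltr_pwDl.
move=> c i; rewrite big_ord_recr/=; set S := \sum_(i < d) _; set v := S + _.
have v0 := rnorm_ge0 v.
have cd : rnorm (c d) <= e^-1 * rnorm v.
  have [->|cd0] := eqVneq (c d) 0; first by rewrite rnorm0 mulr_ge0// ltW.
  rewrite ler_pdivlMl// mulrC.
  have -> : v = c d *: (b d - \sum_(i < d) (- (c d)^-1 * c i) *: b i).
    rewrite scalerBr scaler_sumr addrC; congr (_ + _); rewrite -sumrN.
    by apply: eq_bigr => j _; rewrite scalerA mulNr mulrN scaleNr opprK mulVKf.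
  rewrite rnormZ ler_wpM2l ?rnorm_ge0//; exact: (be (fun i => - (c d)^-1 * c i)).
rewrite ltnS leq_eqVlt => /orP[/eqP->|id].
  by apply: le_trans cd _; rewrite ler_wpM2r// lerDl.
apply: le_trans (bK c i id) _; rewrite -/S /K' mulrDl.
apply: (@le_trans _ _ (K * (1 + e^-1 * rnorm (b d)) * rnorm v)); last first.
  by rewrite lerDr mulr_ge0// ltW.
rewrite -mulrA ler_pM2l// mulrDl mul1r.
rewrite -[S](addrK (c d *: b d)) -/v; apply: le_trans (rnormD _ _) _.
by rewrite lerD2l rnormN rnormZ mulrAC ler_wpM2r.
Qed.

End independent.

Section approximation.
Context {R : realType}.

Lemma real_net (d : R) : 0 < d -> exists (k : nat) (v : 'I_k -> R),
  forall r : R, `|r| <= 1 -> exists i, `|r - v i| <= d.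
Proof.
move=> d0; pose n := (Num.bound d^-1).+1.
have n0 : 0 < n%:R :> R by rewrite ltr0n.
have nd : n%:R^-1 <= d.
  rewrite -[d]invrK lef_pV2 ?posrE ?invr_gt0//; apply/ltW.
  apply: (lt_le_trans (archi_boundP _)); first by rewrite invr_ge0 ltW.
  by rewrite ler_nat.
exists (2 * n).+1, (fun i => i%:R / n%:R - 1) => r; rewrite ler_norml => /andP[r1 r2].
have rn0 : 0 <= (r + 1) * n%:R by rewrite mulr_ge0 ?ler0n//; lra.
have /andP[t1 t2] := truncn_itv rn0; set m := Num.trunc _ in t1 t2.
have mn : (m < (2 * n).+1)%N.
  rewrite ltnS -(ler_nat R); apply: le_trans t1 _.
  by rewrite natrM ler_pM2r//; lra.
exists (Ordinal mn) => /=; apply: le_trans nd.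
have -> : r - (m%:R / n%:R - 1) = ((r + 1) * n%:R - m%:R) / n%:R.
  by field; apply: lt0r_neq0.
rewrite normrM ger0_norm ?subr_ge0// ger0_norm ?invr_ge0 ?ler0n//.
by rewrite ler_piMl ?invr_ge0 ?ler0n// lerBlDr -[1]/(1%:R) -natrD add1n ltW.
Qed.

Lemma C_net (d : R) : 0 < d -> exists (I : finType) (v : I -> C R),
  forall z : C R, rnorm z <= 1 -> exists i, rnorm (z - v i) <= d.
Proof.
move=> d0; have [k [v vP]] := real_net (divr_gt0 d0 (ltr0n _ 2)).
exists ('I_k * 'I_k)%type, (fun p => toC (v p.1) + iC * toC (v p.2)) => z z1.
have [|i zi] := vP (ReC z); first by apply: le_trans (ReC_rnorm _) _.
have [|j zj] := vP (ReC (- iC * z)).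
  by apply: le_trans (ReC_rnorm _) _; rewrite rnormM rnormN rnorm_iC mul1r.
exists (i, j); rewrite [in leLHS](C_decomp z) [leRHS]splitr.
by apply: le_trans (rnorm_parts _ _ _ _) _; rewrite lerD.
Qed.

Lemma C_dense : exists q : nat -> C R, forall (z : C R) (d : R), 0 < d ->
  exists n, rnorm (z - q n) <= d.
Proof.
pose v (p : rat * rat) : C R := toC (ratr p.1) + iC * toC (ratr p.2).
exists (fun n => if unpickle n is Some p then v p else 0) => z d d0.
have d20 : 0 < d / 2 by rewrite divr_gt0.
have approx (r : R) : exists p : rat, `|r - ratr p| <= d / 2.
  have [|p] := @rat_in_itvoo R (r - d / 2) (r + d / 2); first by lra.
  by rewrite in_itv/= => /andP[p1 p2]; exists p; rewrite ler_norml; lra.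
have [a za] := approx (ReC z); have [b zb] := approx (ReC (- iC * z)).
exists (pickle (a, b)); rewrite pickleK [in leLHS](C_decomp z) [leRHS]splitr.
by apply: le_trans (rnorm_parts _ _ _ _) _; rewrite lerD.
Qed.

Lemma monic_vectors_dense (j : nat) : exists u : nat -> nat -> C R,
  (forall n, u n j = 1 /\ forall i, (j < i)%N -> u n i = 0) /\
  forall (a : nat -> C R) (d : R), 0 < d -> a j = 1 -> (forall i, (j < i)%N -> a i = 0) ->
    exists n, forall i, rnorm (a i - u n i) <= d.
Proof.
have [q qP] := C_dense.
pose w (s : seq nat) i : C R := if (i < j)%N then q (nth 0%N s i) else (i == j)%:R.
exists (fun n => w (odflt [::] (unpickle n))); split.
  move=> n; rewrite /w ltnn eqxx; split=> // i ji.
  by rewrite ltnNge (ltnW ji)/= gtn_eqF.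
move=> a d d0 aj a0.
have /choice[m mP] : forall i, exists m, rnorm (a i - q m) <= d by move=> i; exact: qP.
exists (pickle (mkseq m j)) => i; rewrite pickleK /= /w.
case: ltngtP => [ij|ji|->]; first by rewrite nth_mkseq.
  by rewrite a0// subrr rnorm0 ltW.
by rewrite aj subrr rnorm0 ltW.
Qed.

End approximation.

Section frame_norms.
Context {R : realType} {X : topologicalType} (V : X -> normedModType (C R)).
Context (d : nat) (e : nat -> forall x, V x) (U : set X).

Definition frame_norm (x : X) (a : nat -> C R) : R := rnorm (\sum_(i < d) a i *: e i x).

Local Notation N := frame_norm.

Definition within_cvg (T : topologicalType) (f : X -> T) (x : X) :=
  f @ within U (nbhs x) --> f x.

Lemma frame_norm_ge0 x a : 0 <= N x a. Proof. exact: rnorm_ge0. Qed.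

Lemma frame_normD x a b : N x (fun i => a i + b i) <= N x a + N x b.
Proof.
apply: le_trans (rnormD _ _); rewrite /N -big_split/=.
by under eq_bigr do rewrite scalerDl.
Qed.

Lemma frame_normZ x t a : N x (fun i => t * a i) = rnorm t * N x a.
Proof.
rewrite -rnormZ scaler_sumr; congr rnorm.
by apply: eq_bigr => i _; rewrite scalerA.
Qed.

Lemma frame_norm_dist x a b : `|N x a - N x b| <= \sum_(i < d) rnorm (a i - b i) * rnorm (e i x).
Proof.
have h (a' b' : nat -> C R) : N x a' - N x b' <= \sum_(i < d) rnorm (a' i - b' i) * rnorm (e i x).
  apply: (@le_trans _ _ (N x (fun i => a' i - b' i))).
    rewrite lerBlDr; apply: le_trans (frame_normD _ _ _).
    by rewrite (_ : (fun i => _) = a')//; apply/funext => i; rewrite subrK.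
  apply: le_trans (rnorm_sum _ _ _) _.
  by apply: ler_sum => i _; rewrite rnormZ.
rewrite ler_norml h andbT lerNl opprB; apply: le_trans (h _ _) _.
by apply: ler_sum => i _; rewrite rnormB.
Qed.

Lemma frame_norm_unit x i : (i < d)%N -> N x (fun k => (k == i)%:R) = rnorm (e i x).
Proof.
move=> id; rewrite /N (bigD1 (Ordinal id))//= eqxx scale1r big1 ?addr0// => k ki.
by rewrite (_ : (k == i :> nat) = false) ?scale0r//; apply/negbTE.
Qed.

Lemma frame_norm_near x (r : R) : U x -> independent d (e ^~ x) ->
  (forall a, within_cvg (N ^~ a) x) -> 0 < r ->
  \forall y \near x, U y -> forall a, `|N y a - N x a| <= r * N x a.
Proof.
move=> Ux e_ind Nc r0; have [K K0 aK] := independent_bounded e_ind.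
have FF : Filter (within U (nbhs x)) by exact: within_filter.
pose L := \sum_(i < d) (rnorm (e i x) + 1).
have L0 : 0 <= L by apply: sumr_ge0 => i _; rewrite addr_ge0 ?rnorm_ge0.
pose t := r / K / 3; have t0 : 0 < t by rewrite !divr_gt0.
have L1 : 0 < L + 1 by rewrite ltr_wpDl.
have td0 : 0 < t / (L + 1) by rewrite divr_gt0.
have [I [v vP]] := C_net td0.
pose w (f : {ffun 'I_d -> I}) (i : nat) : C R := oapp (fun k : 'I_d => v (f k)) 0 (insub i).
have wE f (i : 'I_d) : w f i = v (f i) by rewrite /w valK.
have near1 : \forall y \near within U (nbhs x), forall f, `|N y (w f) - N x (w f)| < t.
  apply: filter_forall => f; have /cvgrPdist_lt/(_ _ t0) := Nc (w f).
  by apply: filterS => y; rewrite distrC.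
have near2 : \forall y \near within U (nbhs x), forall i : 'I_d, rnorm (e i y) < rnorm (e i x) + 1.
  apply: filter_forall => i.
  have := cvgr_lt _ (Nc (fun k => (k == i :> nat)%:R)) (rnorm (e i x) + 1).
  rewrite frame_norm_unit// ltrDl ltr01 => /(_ _ isT).
  by apply: filterS => y; rewrite frame_norm_unit.
have : \forall y \near within U (nbhs x), forall a, `|N y a - N x a| <= r * N x a.
  apply: filterS2 near1 near2 => y y1 y2.
  have unit_le a : (forall i, (i < d)%N -> rnorm (a i) <= 1) -> `|N y a - N x a| <= 3 * t.
    move=> a1; have /fin_all_exists[f fP] : forall i : 'I_d, exists k, rnorm (a i - v k) <= t / (L + 1).
      by move=> i; apply/vP/a1.
    have dist z : (forall i : 'I_d, rnorm (e i z) <= rnorm (e i x) + 1) ->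
        `|N z a - N z (w (finfun f))| <= t.
      move=> zx; apply: le_trans (frame_norm_dist _ _ _) _.
      apply: (@le_trans _ _ (\sum_(i < d) t / (L + 1) * (rnorm (e i x) + 1))).
        by apply: ler_sum => i _; rewrite ler_pM ?rnorm_ge0// wE ffunE fP.
      rewrite -big_distrr/= -/L mulrAC ler_pdivrMr// ler_wpM2l ?lerDl//; exact: ltW.
    have d1 : `|N y a - N y (w (finfun f))| <= t by apply: dist => i; apply/ltW/y2.
    have d2 : `|N x a - N x (w (finfun f))| <= t by apply: dist => i; rewrite lerDl.
    have d3 := y1 (finfun f).
    move: d1 d2 d3; rewrite !ler_norml ltr_norml.
    set A := N y a; set B := N y _; set C1 := N x a; set D := N x _.
    by move=> /andP[? ?] /andP[? ?] /andP[? ?]; apply/andP; split; lra.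
  move=> a; have Na0 := frame_norm_ge0 x a.
  have [Na|Na] := eqVneq (N x a) 0.
    have a0 i : (i < d)%N -> a i = 0.
      move=> /(aK a); rewrite -/(N x a) Na mulr0 => h.
      by apply: rnorm_eq0; apply/le_anti; rewrite h rnorm_ge0.
    by rewrite Na mulr0 /N big1 ?rnorm0 ?subrr ?normr0// => i _; rewrite a0// scale0r.
  have Nap : 0 < N x a by rewrite lt_neqAle eq_sym Na.
  pose s := K * N x a; have s0 : 0 < s by rewrite mulr_gt0.
  pose b i := toC s^-1 * a i.
  have ab : a = (fun i => toC s * b i).
    apply/funext => i; rewrite /b mulrA -toCM divff ?lt0r_neq0//.
    by rewrite (_ : toC 1 = 1)// mul1r.
  have b1 i : (i < d)%N -> rnorm (b i) <= 1.
    move=> id; rewrite rnormM rnorm_toC ?invr_ge0 ?(ltW s0)//.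
    by rewrite ler_pdivrMl// mulr1; exact: (aK a i id).
  have Ns z : N z a = s * N z b by rewrite {1}ab frame_normZ rnorm_toC ?(ltW s0).
  have -> : r * N x a = s * (3 * t).
    by rewrite /s /t; field; apply: lt0r_neq0.
  rewrite !Ns -mulrBr normrM gtr0_norm// ler_pM2l//; exact: unit_le.
by rewrite near_withinE.
Qed.


End frame_norms.

(** * Well-conditioned frames *)

Section near_minimizer.
Context {R : realType} {X : topologicalType} (V : X -> normedModType (C R)).
Context (d : nat) (e : nat -> forall x, V x) (U : set X).
Local Notation N := (frame_norm d e).
Hypothesis e_ind : forall x, U x -> independent d (e ^~ x).
Hypothesis N_cvg : forall x a, U x -> within_cvg U (N ^~ a) x.

Definition monic (j : nat) (a : nat -> C R) := a j = 1 /\ forall i, (j < i)%N -> a i = 0.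

Lemma half_pow_le0 (r c : R) : 0 <= c -> (forall n, r <= c / 2 ^+ n) -> r <= 0.
Proof.
move=> c0 rc; apply/ler_addgt0Pr => t t0; rewrite add0r.
by have [n nt] := half_pow_small c0 t0; apply: le_trans (rc n) (ltW nt).
Qed.

Lemma frame_norm_sum x (I : Type) (l : seq I) (c : I -> C R) (u : I -> nat -> C R) :
  N x (fun i => \sum_(n <- l) c n * u n i) <= \sum_(n <- l) rnorm (c n) * N x (u n).
Proof.
elim: l => [|n l IH].
  rewrite big_nil /frame_norm big1 ?rnorm0// => i _; by rewrite big_nil scale0r.
rewrite big_cons; have -> : (fun i => \sum_(k <- n :: l) c k * u k i) =
    (fun i => c n * u n i + \sum_(k <- l) c k * u k i).
  by apply/funext => i; rewrite big_cons.
by apply: le_trans (frame_normD _ _ _ _ _) _; rewrite frame_normZ lerD2l.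
Qed.

Context (j : nat) (jd : (j < d)%N).

Let D (x : X) : R := inf [set N x a | a in monic j].

Let unit_monic : monic j (fun i => (i == j)%:R).
Proof. by split=> [|i ji]; rewrite ?eqxx// gtn_eqF. Qed.

Let D_le x a : monic j a -> D x <= N x a.
Proof.
move=> aj; apply: ge_inf; last by exists a.
by exists 0 => _ [b _ <-]; exact: frame_norm_ge0.
Qed.

Let D_ge x r : (forall a, monic j a -> r <= N x a) -> r <= D x.
Proof.
move=> ra; apply: lb_le_inf; first by exists (N x (fun i => (i == j)%:R)), (fun i => (i == j)%:R).
by move=> _ [a aj <-]; exact: ra.
Qed.

Let D_gt0 x : U x -> 0 < D x.
Proof.
move=> Ux; have [K K0 aK] := independent_bounded (e_ind Ux).
apply: (@lt_le_trans _ _ K^-1); first by rewrite invr_gt0.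
apply: D_ge => a [aj _]; rewrite -[K^-1]mulr1 ler_pdivrMl//.
by have := aK a j jd; rewrite aj rnorm1.
Qed.

Let D_near x : U x -> exists2 a, monic j a & N x a < 2 * D x.
Proof.
move=> Ux; apply: contrapT => na; have D0 := D_gt0 Ux.
suff : 2 * D x <= D x by lra.
by apply: D_ge => a aj; rewrite leNgt; apply/negP => h; apply: na; exists a.
Qed.

Let D_cvg x : U x -> within_cvg U D x.
Proof.
move=> Ux; apply/cvgrPdist_le => t t0.
have D0 := D_gt0 Ux; pose r := Num.min 1 (t / D x).
have r0 : 0 < r by rewrite lt_min ltr01 divr_gt0.
have r1 : r <= 1 by rewrite ge_min lexx.
have rt : r * D x <= t by rewrite -ler_pdivlMr// ge_min lexx orbT.
have FF : Filter (within U (nbhs x)) by exact: within_filter.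
have near1 : \forall y \near within U (nbhs x), forall a, `|N y a - N x a| <= r * N x a.
  by rewrite near_withinE; apply: frame_norm_near (e_ind Ux) _ r0 => // a; exact: N_cvg.
apply: filterS near1 => y yx.
have h1 : (1 - r) * D x <= D y.
  apply: D_ge => a aj; have := yx a; rewrite ler_norml => /andP[h _].
  apply: (@le_trans _ _ ((1 - r) * N x a)); last by move: h; lra.
  by rewrite ler_wpM2l ?subr_ge0// D_le.
have h2 : (1 + r)^-1 * D y <= D x.
  have r10 : 0 < 1 + r by rewrite ltr_wpDl.
  apply: D_ge => a aj; rewrite ler_pdivrMl//; apply: le_trans (D_le y aj) _.
  by have := yx a; rewrite ler_norml => /andP[_ h]; move: h; lra.
have r10 : 0 < 1 + r by rewrite ltr_wpDl.
by rewrite ler_pdivrMl// in h2; rewrite ler_norml; apply/andP; split; lra.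
Qed.

(* The convex combination of a dense sequence of competitors, each weighted by
   how well it does; it depends continuously on the norm. *)
Theorem continuous_near_minimizer : exists p : X -> nat -> C R, forall x, U x ->
  [/\ monic j (p x), forall i, within_cvg U (p ^~ i) x &
      forall a, monic j a -> N x (p x) <= 2 * N x a].
Proof.
have [u [u_monic u_dense]] := @monic_vectors_dense R j.
pose S n := 1 + \sum_(i < j.+1) rnorm (u n i).
have S0 n : 0 < S n by rewrite ltr_wpDr// sumr_ge0// => i _; exact: rnorm_ge0.
have uS n i : rnorm (u n i) <= S n.
  have [ij|ji] := leqP i j; last first.
    by have [_ /(_ _ ji) ->] := u_monic n; rewrite rnorm0 ltW.
  rewrite /S (bigD1 (Ordinal (ij : (i < j.+1)%N)))//= addrCA lerDl.
  by rewrite addr_ge0// sumr_ge0// => k _; exact: rnorm_ge0.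
pose w n x := Num.max 0 (1 - N x (u n) / (2 * D x)) / S n.
have w0 n x : 0 <= w n x by rewrite divr_ge0 ?le_max ?lexx// ltW.
have wu n x i : U x -> w n x * rnorm (u n i) <= 1.
  move=> Ux; rewrite /w mulrAC ler_pdivrMr// mul1r.
  apply: (@le_trans _ _ (1 * S n)); last by rewrite mul1r.
  rewrite ler_pM ?rnorm_ge0// ?le_max ?lexx// ge_max ler01/= gerBl.
  by rewrite divr_ge0 ?frame_norm_ge0// mulr_ge0// ltW// D_gt0.
have w_cvg n x : U x -> within_cvg U (w n) x.
  move=> Ux; have D0 := D_gt0 Ux.
  apply: cvgM; last exact: cvg_cst.
  apply: cvg_maxr; first exact: cvg_cst.
  apply: cvgB; first exact: cvg_cst.
  apply: cvgM; first exact: N_cvg.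
  apply: cvgV; first by rewrite mulf_neq0 ?lt0r_neq0.
  by apply: cvgM; [exact: cvg_cst|exact: D_cvg].
pose W n (x : X) := if pselect (U x) then w n x else 0.
have WE n x : U x -> W n x = w n x by rewrite /W; case: pselect.
have W0 n x : 0 <= W n x by rewrite /W; case: (pselect (U x)) => h /=; rewrite ?w0 ?lexx.
pose q m (p : X * nat) : Ccomplete := \sum_(n < m) toC (W n p.1 / 2 ^+ n) * u n p.2.
have h0 n : 0 < (2 ^+ n)^-1 :> R by rewrite invr_gt0 exprn_gt0.
have [|||v [l [v0 vP _ lv]]] :=
  @sup_iteration R _ (fun=> Ccomplete) (fun m s => s = q m) 1 (q 0%N); [exact: ler01|by []| |].
  move=> m _ ->; exists (q m.+1) => // -[x i]; rewrite /q big_ord_recr/= addrC addrK.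
  have Wm : 0 <= W m x / 2 ^+ m by rewrite mulr_ge0// ltW.
  rewrite rnormM rnorm_toC// mulrAC ler_pM2r//.
  rewrite /W; case: pselect => Ux; first exact: wu.
  by rewrite mul0r.
have {vP v0} lq m p : rnorm (l p - q m p) <= 2 / 2 ^+ m.
  by have := lv m p; rewrite (vP m) mulr1.
have qj m x : q m (x, j) = toC (\sum_(n < m) W n x / 2 ^+ n).
  by rewrite /q toC_sum; apply: eq_bigr => n _; have [-> _] := u_monic n; rewrite mulr1.
have qj_norm m x : rnorm (q m (x, j)) = \sum_(n < m) W n x / 2 ^+ n.
  by rewrite qj rnorm_toC// sumr_ge0// => n _; rewrite mulr_ge0// ltW.
have l_gt0 x : U x -> 0 < rnorm (l (x, j)).
  move=> Ux; have [a aj aD] := D_near Ux; have D0 := D_gt0 Ux.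
  pose L := \sum_(i < d) rnorm (e i x).
  have L0 : 0 <= L by apply: sumr_ge0 => i _; exact: rnorm_ge0.
  have t0 : 0 < (2 * D x - N x a) / (L + 1) by rewrite divr_gt0 ?subr_gt0// ltr_wpDl.
  have [n an] := u_dense a _ t0 aj.1 aj.2.
  have nD : N x (u n) < 2 * D x.
    have : N x (u n) <= N x a + (2 * D x - N x a) / (L + 1) * L.
      rewrite -lerBlDl; apply: le_trans (ler_norm _) _.
      apply: le_trans (frame_norm_dist _ _ _ _ _) _; rewrite big_distrr/=.
      by apply: ler_sum => i _; rewrite ler_wpM2r ?rnorm_ge0// rnormB.
    move=> /le_lt_trans; apply; rewrite -ltrBrDl mulrAC ltr_pdivrMr ?ltr_wpDl//.
    by rewrite ltr_pM2l ?subr_gt0// ltrDl.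
  have wn : 0 < w n x.
    by rewrite divr_gt0// lt_max subr_gt0 ltr_pdivrMr ?mulr_gt0// mul1r nD orbT.
  have r0 : 0 < w n x / 2 ^+ n by rewrite mulr_gt0.
  have [m mr] := half_pow_small (ltW (ltr0n R 2)) r0.
  pose k := maxn m n.+1.
  have kr : 2 / 2 ^+ k < w n x / 2 ^+ n.
    by apply: le_lt_trans mr; rewrite half_pow_le// leq_maxl.
  have : w n x / 2 ^+ n <= rnorm (q k (x, j)).
    rewrite qj_norm (bigD1 (Ordinal (leq_maxr m n.+1 : (n < k)%N)))//= WE// lerDl.
    by rewrite sumr_ge0// => i _; rewrite mulr_ge0// ltW.
  have := rnormD (q k (x, j) - l (x, j)) (l (x, j)); rewrite subrK rnormB.
  have := lq k (x, j); move: kr.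
  by set A := w n x / _; set B := rnorm (l _ - _); set C' := rnorm (q _ _); lra.
have l0 x i : (j < i)%N -> l (x, i) = 0.
  move=> ji; apply/rnorm_eq0/le_anti; rewrite rnorm_ge0 andbT.
  apply: (@half_pow_le0 _ 2) => // m; have := lq m (x, i).
  by rewrite /q big1 ?subr0// => n _; have [_ ->] := u_monic n; rewrite ?mulr0.
have l_cvg x i : U x -> (fun y => l (y, i) : C R) @ within U (nbhs x) --> (l (x, i) : C R).
  move=> Ux B /nbhs_rnormP[t t0 tB].
  have FF : Filter (within U (nbhs x)) by exact: within_filter.
  have t30 : 0 < t / 3 by rewrite divr_gt0.
  have [m mt] := half_pow_small (ltW (ltr0n R 2)) t30.
  have : (fun y => \sum_(n < m) toC (w n y / 2 ^+ n) * u n i : C R) @ within U (nbhs x) -->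
      (\sum_(n < m) toC (w n x / 2 ^+ n) * u n i : C R).
    apply: (@cvg_sum_seq (C R) (C R)) => n _; apply: (@cvgM (C R)); last exact: cvg_cst.
    by apply: cvg_toC; apply: cvgM; [exact: w_cvg|exact: cvg_cst].
  move=> /(_ [set b | rnorm (b - \sum_(n < m) toC (w n x / 2 ^+ n) * u n i) < t / 3]) h.
  have {}h : \forall y \near within U (nbhs x), rnorm (\sum_(n < m) toC (w n y / 2 ^+ n) * u n i -
      \sum_(n < m) toC (w n x / 2 ^+ n) * u n i) < t / 3.
    apply: h; apply/nbhs_rnormP; exists (t / 3) => // b; by rewrite rnormB.
  have qE y : U y -> q m (y, i) = \sum_(n < m) toC (w n y / 2 ^+ n) * u n i.
    by move=> Uy; apply: eq_bigr => n _; rewrite WE.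
  move: h; rewrite !near_withinE; apply: filterS => y /[swap] Uy /(_ Uy); rewrite -!qE// => h.
  apply: tB; have := lq m (x, i); have := lq m (y, i).
  have := rnormD (l (x, i) - q m (x, i)) (q m (x, i) - l (y, i)); rewrite subrKA.
  have := rnormD (q m (x, i) - q m (y, i)) (q m (y, i) - l (y, i)); rewrite subrKA.
  move: h; rewrite [rnorm (q m (y, i) - q m (x, i))]rnormB [rnorm (q m (y, i) - l (y, i))]rnormB.
  move: mt; lra.
exists (fun x i => l (x, i) / l (x, j)) => x Ux; have lj0 := l_gt0 x Ux.
have ljn0 : l (x, j) != 0 :> C R.
  by apply/eqP => lj; move: lj0; rewrite lj rnorm0 ltxx.
split.
- by split=> [|i ji]; [rewrite divff|rewrite l0// mul0r].
- move=> i; apply: (@cvgM (C R)); first exact: l_cvg.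
  by apply: cvgV => //; exact: l_cvg.
- move=> a aj.
  have -> : (fun i => l (x, i) / l (x, j) : C R) = (fun i => (l (x, j))^-1 * l (x, i) : C R).
    by apply/funext => i; rewrite mulrC.
  rewrite frame_normZ.
  have lV : rnorm (l (x, j))^-1 = (rnorm (l (x, j)))^-1.
    apply: (mulfI (lt0r_neq0 lj0)); rewrite divff ?lt0r_neq0// -rnormM divff//.
    exact: rnorm1.
  rewrite lV ler_pdivrMl// mulrC.
  apply: (@le_trans _ _ (2 * D x * rnorm (l (x, j)))); last first.
    by rewrite ler_pM2r// ler_pM2l// D_le.
  have D0 := D_gt0 Ux.
  pose L := \sum_(i < d) rnorm (e i x).
  have L0 : 0 <= L by apply: sumr_ge0 => i _; exact: rnorm_ge0.
  rewrite -subr_le0; apply: (@half_pow_le0 _ (2 * L + 2 * D x * 2)) => [|m].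
    by rewrite addr_ge0// !mulr_ge0// ltW.
  have h1 : N x (fun i => l (x, i)) <= N x (fun i => q m (x, i)) + 2 * L / 2 ^+ m.
    rewrite -lerBlDl; apply: le_trans (ler_norm _) _.
    apply: le_trans (frame_norm_dist _ _ _ _ _) _; rewrite mulrAC big_distrr/=.
    by apply: ler_sum => i _; rewrite ler_wpM2r ?rnorm_ge0// lq.
  have h2 : N x (fun i => q m (x, i)) <= 2 * D x * rnorm (q m (x, j)).
    rewrite qj_norm; apply: le_trans (frame_norm_sum x (index_enum 'I_m)
      (fun n => toC (W n x / 2 ^+ n)) (fun n => u n)) _.
    rewrite big_distrr/=; apply: ler_sum => n _.
    have Wn : 0 <= W n x / 2 ^+ n by rewrite mulr_ge0// ltW.
    rewrite rnorm_toC// mulrC; have [wn|wn] := eqVneq (w n x) 0.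
      by rewrite WE// wn mul0r !mulr0.
    rewrite ler_wpM2r//; have : 0 < w n x by rewrite lt_neqAle eq_sym wn w0.
    rewrite /w pmulr_lgt0 ?invr_gt0// lt_max ltxx/= subr_gt0 ltr_pdivrMr ?mulr_gt0// mul1r.
    exact: ltW.
  have h3 : rnorm (q m (x, j)) <= rnorm (l (x, j)) + 2 / 2 ^+ m.
    have := rnormD (q m (x, j) - l (x, j)) (l (x, j)); rewrite subrK rnormB.
    by have := lq m (x, j); set A := rnorm (l _ - _); lra.
  have h4 : 2 * D x * rnorm (q m (x, j)) <= 2 * D x * (rnorm (l (x, j)) + 2 / 2 ^+ m).
    by rewrite ler_wpM2l// mulr_ge0// ltW.
  move: h1 h2 h4; rewrite mulrDl mulrDr !mulrA; lra.
Qed.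

End near_minimizer.

Section good_coordinates.
Context {R : realType} {X : topologicalType} (V : X -> normedModType (C R)).
Context (d : nat) (e : nat -> forall x, V x) (U : set X).
Local Notation N := (frame_norm d e).
Hypothesis e_ind : forall x, U x -> independent d (e ^~ x).
Hypothesis N_cvg : forall x a, U x -> within_cvg U (N ^~ a) x.

Lemma cvg_rnormB (W : normedModType (C R)) (T : Type) (F : set_system T) (f : T -> W) (a : W) :
  Filter F -> f @ F --> a -> (fun t => rnorm (f t - a)) @ F --> (0 : R).
Proof.
move=> FF fa; apply/cvgrPdist_lt => t t0.
have : nbhs a [set b | rnorm (a - b) < t] by apply/nbhs_rnormP; exists t.
move=> /fa; rewrite !near_simpl; apply: filterS => y.
by rewrite sub0r normrN ger0_norm ?rnorm_ge0// rnormB.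
Qed.

Lemma frame_norm_cvg (p : X -> nat -> C R) x : U x ->
  (forall i, within_cvg U (p ^~ i) x) -> within_cvg U (fun y => N y (p y)) x.
Proof.
move=> Ux pc; have FF : Filter (within U (nbhs x)) by exact: within_filter.
have dist0 : (fun y => \sum_(i < d) rnorm (p y i - p x i) * rnorm (e i y))
    @ within U (nbhs x) --> (0 : R).
  rewrite [X in _ --> X](_ : 0 = \sum_(i < d) 0 * rnorm (e i x)); last first.
    by rewrite big1// => i _; rewrite mul0r.
  apply: (@cvg_sum_seq R R^o) => i _; apply: cvgM; first exact: cvg_rnormB (pc i).
  have := N_cvg (a := fun k => (k == i :> nat)%:R) Ux.
  rewrite /within_cvg frame_norm_unit//.
  by under eq_cvg do rewrite frame_norm_unit//.
apply/cvgrPdist_lt => t t0; have t20 : 0 < t / 2 by rewrite divr_gt0.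
have /cvgrPdist_lt/(_ _ t20) h1 := N_cvg (a := p x) Ux.
have h2 := @cvgr_lt _ _ _ FF _ _ dist0 _ t20.
apply: filterS2 h1 h2 => y h1 h2.
have := frame_norm_dist d e y (p y) (p x).
move: h1 h2; rewrite ltr_norml ler_norml ltr_norml.
move=> /andP[? ?] ? /andP[? ?]; apply/andP; split; lra.
Qed.

Theorem good_coordinates (j : nat) : (j <= d)%N -> exists P Q : nat -> X -> nat -> C R,
  forall x, U x -> [/\
    forall k i, (k < j)%N -> within_cvg U (fun y => P k y i) x /\ within_cvg U (fun y => Q k y i) x,
    forall k, (k < j)%N -> N x (P k x) <= 1,
    forall a, (forall i, (j <= i)%N -> a i = 0) ->
      forall i, a i = \sum_(k < j) (\sum_(l < d) a l * Q k x l) * P k x i &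
    forall a k, (forall i, (j <= i)%N -> a i = 0) -> (k < j)%N ->
      rnorm (\sum_(l < d) a l * Q k x l) <= 2 * 3 ^+ j * N x a].
Proof.
elim: j => [_|j IH jd].
  by exists (fun _ _ _ => 0), (fun _ _ _ => 0) => x Ux; split=> // a a0 i; rewrite big_ord0 a0.
have [P [Q PQ]] := IH (ltnW jd).
have [p pP] := continuous_near_minimizer e_ind N_cvg jd.
pose r y := N y (p y).
have r0 x : U x -> 0 < r x.
  move=> Ux; rewrite lt_neqAle frame_norm_ge0 andbT eq_sym; apply/eqP => /rnorm_eq0 p0.
  have [[pj _] _ _] := pP x Ux; have := e_ind Ux p0 jd; rewrite pj => /eqP.
  by rewrite oner_eq0.
have r_cvg x : U x -> within_cvg U r x.
  by move=> Ux; apply: frame_norm_cvg => // i; have [_ pc _] := pP x Ux.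
pose P' k y i : C R := if (k < j)%N then P k y i else toC (r y)^-1 * p y i.
pose Q' k y l : C R := if (k < j)%N then Q k y l - (l == j)%:R * \sum_(m < d) p y m * Q k y m
  else (l == j)%:R * toC (r y).
have sum_delta (b : nat -> C R) : \sum_(l < d) b l * (l == j :> nat)%:R = b j.
  rewrite (bigD1 (Ordinal jd))//= eqxx mulr1 big1 ?addr0// => l lj.
  by rewrite (_ : (l == j :> nat) = false) ?mulr0//; apply/negbTE.
have Q'lt (a : nat -> C R) k x : (k < j)%N ->
    \sum_(l < d) a l * Q' k x l = \sum_(l < d) (a l - a j * p x l) * Q k x l.
  move=> kj; rewrite /Q' kj.
  under eq_bigr do rewrite mulrBr mulrA.
  rewrite sumrB -mulr_suml sum_delta big_distrr/= -sumrB.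
  by apply: eq_bigr => l _; rewrite mulrBl mulrA.
have Q'j (a : nat -> C R) x : \sum_(l < d) a l * Q' j x l = a j * toC (r x).
  by rewrite /Q' ltnn; under eq_bigr do rewrite mulrA; rewrite -mulr_suml sum_delta.
exists P', Q' => x Ux; have [PQc PN PQa Qa] := PQ x Ux; have [[pj p0] pc pmin] := pP x Ux.
have FF : Filter (within U (nbhs x)) by exact: within_filter.
have rx0 := r0 x Ux.
have sub0 (a : nat -> C R) : (forall i, (j.+1 <= i)%N -> a i = 0) ->
    forall i, (j <= i)%N -> a i - a j * p x i = 0.
  move=> a0 i; rewrite leq_eqVlt => /orP[/eqP<-|ji]; first by rewrite pj mulr1 subrr.
  by rewrite a0// p0// mulr0 subr0.
have aj_le (a : nat -> C R) : (forall i, (j.+1 <= i)%N -> a i = 0) ->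
    rnorm (a j) * r x <= 2 * N x a.
  move=> a0; have [aj|aj] := eqVneq (a j) 0.
    by rewrite aj rnorm0 mul0r mulr_ge0// frame_norm_ge0.
  have : monic j (fun i => (a j)^-1 * a i).
    by split=> [|i ji]; [rewrite mulVf|rewrite (a0 i ji) mulr0].
  move=> /pmin; rewrite -/(r x) => h.
  have {h} := ler_wpM2l (rnorm_ge0 (a j)) h; rewrite mulrCA
    -(frame_normZ d e x (a j) (fun i => (a j)^-1 * a i)).
  by rewrite (_ : (fun i => a j * ((a j)^-1 * a i)) = a)//; apply/funext => i; rewrite mulVKf.
split.
- move=> k i; rewrite ltnS leq_eqVlt => /orP[/eqP->|kj]; last first.
    have [Pc Qc] := PQc k i kj; rewrite /P' /Q' /within_cvg kj; split; first exact: Pc.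
    apply: (@cvgB (C R)); first exact: Qc.
    apply: (@cvgM (C R)); first exact: cvg_cst.
    apply: (@cvg_sum_seq (C R) (C R)) => l _; apply: (@cvgM (C R)); first exact: pc.
    by have [] := PQc k l kj.
  rewrite /P' /Q' /within_cvg ltnn; split.
    apply: (@cvgM (C R)); last exact: pc.
    by apply: cvg_toC; apply: cvgV; [exact: lt0r_neq0|exact: r_cvg].
  apply: (@cvgM (C R)); first exact: cvg_cst.
  by apply: cvg_toC; exact: r_cvg.
- move=> k; rewrite ltnS leq_eqVlt /P' => /orP[/eqP->|kj]; last by rewrite kj PN.
  by rewrite ltnn frame_normZ rnorm_toC ?invr_ge0 ?(ltW rx0)// mulVf// lt0r_neq0.
- move=> a a0 i; rewrite big_ord_recr/= Q'j.
  have -> : P' j x i = toC (r x)^-1 * p x i by rewrite /P' ltnn.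
  rewrite mulrA -(mulrA (a j)) -toCM divff ?lt0r_neq0// (_ : toC 1 = 1)// mulr1.
  have := PQa (fun i => a i - a j * p x i) (sub0 a a0) i.
  rewrite (eq_bigr (fun k : 'I_j => (\sum_(l < d) a l * Q' k x l) * P' k x i)).
    by move/eqP; rewrite subr_eq => /eqP.
  by move=> k _; rewrite Q'lt// /P' ltn_ord.
- move=> a k a0; have Na := frame_norm_ge0 d e x a; have ajr := aj_le a a0.
  have h3 : 1 <= (3 : R) ^+ j by rewrite exprn_ege1// ler1n.
  rewrite ltnS leq_eqVlt => /orP[/eqP->|kj].
    rewrite Q'j rnormM (rnorm_toC (ltW rx0)); apply: le_trans ajr _.
    by rewrite ler_wpM2r// ler_peMr// exprn_ege1// ler1n.
  rewrite Q'lt//; apply: le_trans (Qa _ k (sub0 a a0) kj) _.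
  rewrite exprSr mulrA -[leRHS]mulrA ler_wpM2l ?mulr_ge0 ?exprn_ge0//.
  have : N x (fun i => a i - a j * p x i) <= N x a + rnorm (a j) * r x.
    rewrite -rnormN -frame_normZ; apply: le_trans (frame_normD _ _ _ _ _).
    by under [in leRHS]eq_fun do rewrite mulNr.
  by move: ajr; lra.
Qed.

End good_coordinates.

(** * Dimension and functionals *)

Section dimension.
Context {R : realType}.

Definition spans (V : lmodType (C R)) (d : nat) (b : nat -> V) :=
  forall v, exists c : nat -> C R, v = \sum_(i < d) c i *: b i.

Lemma has_dim_basis (V : normedModType (C R)) d : has_dim V d ->
  exists2 b : nat -> V, independent d b & spans d b.
Proof.
move=> [f fP]; pose b (i : nat) := oapp f 0 (insub i : option 'I_d).
have bE (i : 'I_d) : b i = f i by rewrite /b valK.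
exists b => [c cb i id|v].
  have [c' [_ c'_uniq]] := fP 0.
  have h0 : c' = [ffun=> 0] by apply: c'_uniq; rewrite big1// => k _; rewrite ffunE scale0r.
  have h1 : c' = [ffun k : 'I_d => c k].
    by apply: c'_uniq; rewrite -[LHS]cb; apply: eq_bigr => k _; rewrite ffunE bE.
  have := congr1 (fun g : {ffun 'I_d -> C R} => g (Ordinal id)) h0.
  by rewrite h1 !ffunE.
have [c [vc _]] := fP v.
exists (fun i => oapp (fun k : 'I_d => c k) 0 (insub i)).
by rewrite {1}vc; apply: eq_bigr => k _; rewrite bE valK.
Qed.

Lemma independent_le (V : normedModType (C R)) m k (b f : nat -> V) :
  independent m b -> spans k f -> (m <= k)%N.
Proof.
move=> b_ind f_span; rewrite leqNgt; apply/negP => km.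
have /choice[M bM] : forall i, exists c : nat -> C R, b i = \sum_(l < k) c l *: f l.
  by move=> i; exact: f_span.
pose A : 'M[C R]_(m, k) := \matrix_(i, l) M i l.
have kA : kermx A != 0.
  rewrite -mxrank_eq0 mxrank_ker subn_eq0 -ltnNge.
  by apply: leq_ltn_trans km; exact: rank_leq_col.
pose u := nz_row (kermx A).
have uA : u *m A = 0 by apply/sub_kermxP; exact: nz_row_sub.
have : u != 0 by rewrite nz_row_eq0.
apply/negP; rewrite negbK; apply/eqP/rowP => i; rewrite mxE.
pose c (l : nat) : C R := oapp (fun l : 'I_m => u 0 l) 0 (insub l).
have cE (l : 'I_m) : c l = u 0 l by rewrite /c valK.
rewrite -cE; apply: b_ind => //.
transitivity (\sum_(l < k) (\sum_(j < m) u 0 j * A j l) *: f l).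
  under [RHS]eq_bigr do rewrite scaler_suml.
  rewrite exchange_big/=; apply: eq_bigr => j _; rewrite cE bM scaler_sumr.
  by apply: eq_bigr => l _; rewrite scalerA mxE.
apply: big1 => l _; move/rowP/(_ l) : uA; rewrite !mxE => ->.
by rewrite scale0r.
Qed.

Lemma has_dim_uniq (V : normedModType (C R)) m k : has_dim V m -> has_dim V k -> m = k.
Proof.
move=> /has_dim_basis[b bi bs] /has_dim_basis[f fi fs]; apply/eqP.
by rewrite eqn_leq (independent_le bi fs) (independent_le fi bs).
Qed.

End dimension.

Section module_sums.
Context {R : realType} {X : topologicalType} (V : X -> completeNormedModType (C R)).
Context (G : set (forall x, V x)) (HG : section_module G) (U : set X).

Lemma locally_in_sum (I : eqType) (l : seq I) (s : I -> forall x, V x) x :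
  (forall i, i \in l -> locally_in G U (s i) x) ->
  locally_in G U (fun y => \sum_(i <- l) s i y) x.
Proof.
elim: l => [|i l IH] sG.
  rewrite (_ : (fun _ => _) = (fun x => 0)); first exact: locally_in_smod (smod0 HG).
  by apply: functional_extensionality_dep => y; rewrite big_nil.
rewrite (_ : (fun _ => _) = (fun y => s i y + \sum_(j <- l) s j y)).
  apply: locally_inD => //; first by apply: sG; rewrite mem_head.
  by apply: IH => j jl; apply: sG; rewrite inE jl orbT.
by apply: functional_extensionality_dep => y; rewrite big_cons.
Qed.

Definition functional_field (f : forall x, V x -> C R) := forall x, U x ->
  [/\ forall a u v, f x (a *: u + v) = a * f x u + f x v,
      forall s, G s -> within_cvg U (fun y => f y (s y)) x &
      exists M : R, \forall y \near x, U y -> forall v, rnorm (f y v) <= M * rnorm v].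

Lemma functional_field_sum (d : nat) (f : nat -> forall x, V x -> C R) (q : nat -> X -> C R) :
  (forall i, (i < d)%N -> functional_field (f i)) ->
  (forall x i, U x -> (i < d)%N -> within_cvg U (q i) x) ->
  functional_field (fun x v => \sum_(i < d) f i x v * q i x).
Proof.
move=> fU qc x Ux; have FF : Filter (within U (nbhs x)) by exact: within_filter.
split.
- move=> a u v; rewrite big_distrr -big_split/=; apply: eq_bigr => i _.
  by have [-> _ _] := fU i (ltn_ord i) x Ux; rewrite mulrDl mulrA.
- move=> s Gs; apply: (@cvg_sum_seq (C R) (C R)) => i _; apply: (@cvgM (C R)).
    by have [_ + _] := fU i (ltn_ord i) x Ux; apply.
  exact: qc.
- have /choice[M MP] : forall i : 'I_d, exists M : R, \forall y \near x, U y ->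
      forall v, rnorm (f i y v * q i y) <= M * rnorm v.
    move=> i; have [_ _ [M fM]] := fU i (ltn_ord i) x Ux.
    have h0 : \forall y \near within U (nbhs x), rnorm (q i y - q i x) < 1.
      have := qc x i Ux (ltn_ord i) => /(_ [set b | rnorm (b - q i x) < 1]); apply.
      by apply/nbhs_rnormP; exists 1 => // w; rewrite rnormB.
    exists (Num.max 0 M * (rnorm (q i x) + 1)).
    have h1 : \forall y \near x, U y -> rnorm (q i y - q i x) < 1 by move: h0; rewrite near_withinE.
    apply: filterS2 fM h1 => y My qy Uy v; rewrite rnormM.
    have := rnormD (q i y - q i x) (q i x); rewrite subrK => h.
    have {}h : rnorm (q i y) <= rnorm (q i x) + 1 by have := qy Uy; move: h; lra.
    rewrite mulrAC ler_pM ?rnorm_ge0//; apply: le_trans (My Uy v) _.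
    by rewrite ler_wpM2r ?rnorm_ge0// le_max lexx orbT.
  exists (\sum_(i < d) M i).
  have : \forall y \near x, forall i : 'I_d, U y -> forall v, rnorm (f i y v * q i y) <= M i * rnorm v.
    exact: filter_forall.
  apply: filterS => y My Uy v; apply: le_trans (rnorm_sum _ _ _) _.
  by rewrite big_distrl/=; apply: ler_sum => i _; apply: My.
Qed.

Lemma locally_in_norm_cvg s x : (forall t, G t -> continuous (fun y => rnorm (t y))) ->
  U x -> locally_in G U s x -> within_cvg U (fun y => rnorm (s y)) x.
Proof.
move=> Gc Ux sG; apply/cvgrPdist_lt => e e0; have e30 : 0 < e / 3 by rewrite divr_gt0.
have [t Gt st] := sG _ e30.
have /cvgrPdist_lt/(_ _ e30) tx := Gc t Gt x.
have sx := nbhs_singleton st Ux.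
have norm_dist y : `|rnorm (s y) - rnorm (t y)| <= rnorm (s y - t y).
  rewrite ler_norml; apply/andP; split.
    have := rnormD (t y - s y) (s y); rewrite subrK rnormB; lra.
  have := rnormD (s y - t y) (t y); rewrite subrK; lra.
rewrite near_withinE; apply: filterS2 st tx => y sy ty Uy; have {}sy := sy Uy.
have := norm_dist x; have := norm_dist y; move: sx sy ty.
rewrite !ler_norml !ltr_norml => ? ? /andP[? ?] /andP[? ?] /andP[? ?].
by apply/andP; split; lra.
Qed.

End module_sums.

Section bundle_frames.
Context {R : realType} {X : topologicalType} (E : hbundle R X).
Hypothesis X_hausdorff : hausdorff_space X.
Hypothesis X_lc : locally_compact [set: X].
Local Notation G := (@Gamma0_set R X E).

Definition frame (U : set X) (d : nat) (e : nat -> forall x, E x) (f : nat -> forall x, E x -> C R) :=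
  [/\ forall i x, U x -> (i < d)%N -> locally_in G U (e i) x,
      forall i, (i < d)%N -> functional_field G U (f i) &
      forall x, U x -> forall v : E x, v = \sum_(i < d) f i x v *: e i x].

Lemma trivial_frame (U : set X) d : trivial_over E U -> (forall x, U x -> has_dim (E x) d) ->
  exists e f, frame U d e f /\ forall x, U x -> independent d (e ^~ x).
Proof.
move=> [B [phi [psi [phi_lin phiK phi_c psi_c]]]] Ud.
have [[x1 Ux1]|U0] := pselect (exists x, U x); last first.
  exists (fun i x => 0), (fun i x v => 0).
  by split; [split=> [i x Ux|i id x Ux|x Ux]|move=> x Ux]; case: U0; exists x.
have phiD x (Ux : U x) a u v : phi x (a *: u + v) = a *: phi x u + phi x v by exact: phi_lin.
have phi0 x : U x -> phi x 0 = 0.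
  by move=> Ux; have := phiD x Ux (-1) 0 0; rewrite scaler0 addr0 scaleN1r addNr.
have phi_sum x (c : nat -> C R) (w : nat -> E x) : U x ->
    phi x (\sum_(i < d) c i *: w i) = \sum_(i < d) c i *: phi x (w i).
  move=> Ux; elim: (d) => [|k IH]; first by rewrite !big_ord0 phi0.
  by rewrite !big_ord_recr/= addrC phiD// IH addrC.
have psi_sum x (c : nat -> C R) (w : nat -> B) : U x ->
    psi x (\sum_(i < d) c i *: w i) = \sum_(i < d) c i *: psi x (w i).
  move=> Ux; have [K1 K2] := phiK x Ux; apply: (can_inj K1).
  by rewrite K2 (phi_sum x c (fun i => psi x (w i)) Ux); apply: eq_bigr => i _; rewrite K2.
have [b b_ind b_span] := has_dim_basis (Ud x1 Ux1).
have [K1 K2] := phiK x1 Ux1.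
pose c i := phi x1 (b i).
have c_ind : independent d c.
  move=> a; rewrite /c -phi_sum// => h; apply: b_ind.
  by rewrite -[LHS]K1 h -{1}(phi0 _ Ux1) K1.
have /choice[k kP] : forall v : B, exists a : nat -> C R, v = \sum_(i < d) a i *: c i.
  move=> v; have [a va] := b_span (psi x1 v); exists a.
  rewrite -[LHS]K2 va; exact: (phi_sum x1 a b Ux1).
have k_lin i a u v : (i < d)%N -> k (a *: u + v) i = a * k u i + k v i.
  move=> id; apply/eqP; rewrite -subr_eq0; apply/eqP.
  apply: (c_ind (fun i => k (a *: u + v) i - (a * k u i + k v i))) => //.
  under eq_bigr do rewrite scalerBl scalerDl -scalerA.
  by rewrite sumrB big_split/= -scaler_sumr -!kP subrr.
have [K K0 cK] := independent_bounded c_ind.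
have k_bd i v : (i < d)%N -> rnorm (k v i) <= K * rnorm v.
  by move=> id; rewrite {2}(kP v); exact: cK.
have phi_cvg (s : forall x, E x) x (e : R) : U x -> 0 < e ->
    continuous (fun x => to_total E (s x)) ->
    \forall y \near x, U y -> rnorm (phi y (s y) - phi x (s x)) < e.
  move=> Ux e0 sc.
  move/subspace_continuousP : phi_c => /(_ (to_total E (s x)) Ux).
  move=> /(_ [set p | rnorm (phi x (s x) - p.2) < e]) h.
  have {}h : \forall p \near to_total E (s x), U (proj E p) ->
      rnorm (phi x (s x) - phi (proj E p) (vec p)) < e.
    have := h; rewrite /= /within/=; apply.
    exists (setT, [set w | rnorm (phi x (s x) - w) < e]) => /=; last by move=> [y w] [].
    by split; [exact: filterT|apply/nbhs_rnormP; exists e].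
  have : \forall y \near x, U (proj E (to_total E (s y))) ->
      rnorm (phi x (s x) - phi (proj E (to_total E (s y))) (vec (to_total E (s y)))) < e.
    exact: (sc x _ h).
  by apply: filterS => y /= sy Uy; rewrite rnormB sy.
exists (fun i x => psi x (c i)), (fun i x v => k (phi x v) i); split; last first.
  move=> x Ux a ae; apply: c_ind; have [_ K2x] := phiK x Ux.
  by rewrite -[LHS]K2x psi_sum// ae phi0.
split.
- move=> i x Ux id; apply: (cvg_locally_in X_hausdorff X_lc) => W Wx.
  move/subspace_continuousP : psi_c => /(_ (x, c i) (conj Ux I)) /(_ W Wx).
  rewrite /= => -[[A1 A2]/= [xA1 cA2] AW].
  apply: filterS xA1 => y A1y Uy; apply: (AW (y, c i)) => //=.
  by split=> //; exact: nbhs_singleton cA2.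
- move=> i id x Ux; split.
  + by move=> a u v; rewrite phiD// k_lin.
  + move=> s [sc _] W /nbhs_rnormP[e e0 eW].
    have := phi_cvg s x (e / K) Ux (divr_gt0 e0 K0) sc.
    move=> h; change (\forall y \near within U (nbhs x), W (k (phi y (s y)) i)).
    rewrite near_withinE; apply: filterS h => y /[apply] sy; apply: eW.
    have -> : k (phi x (s x)) i - k (phi y (s y)) i = k (phi x (s x) - phi y (s y)) i.
      by rewrite -[- phi y _]scaleN1r [in RHS]addrC k_lin// mulN1r addrC.
    by apply: le_lt_trans (k_bd _ _ id) _; rewrite mulrC -ltr_pdivlMr// rnormB.
  + move/subspace_continuousP : phi_c => /(_ (to_total E (0 : E x)) Ux).
    move=> /(_ [set p | rnorm p.2 < 1]) h.
    have {}h : \forall p \near to_total E (0 : E x), U (proj E p) -> rnorm (phi (proj E p) (vec p)) < 1.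
      have := h; rewrite /= /within/=; apply.
      exists (setT, [set w | rnorm w < 1]) => /=; last by move=> [y w] [].
      split; first exact: filterT.
      apply/nbhs_rnormP; rewrite /= phi0//; exists 1 => // w.
      by rewrite sub0r rnormN.
    have [A [t [xA t0 At]]] := (nbhs_zero (hbundleP E) _ _).1 h.
    exists (K * (2 / t)); apply: filterS xA => y Ay Uy v.
    apply: le_trans (k_bd _ _ id) _; rewrite -mulrA ler_pM2l//.
    have [->|v0] := eqVneq v 0; first by rewrite phi0// !rnorm0 mulr0.
    have rv : 0 < rnorm v.
      by rewrite lt_neqAle rnorm_ge0 andbT eq_sym; apply: contra_neq v0 => /rnorm_eq0.
    pose a := t / (2 * rnorm v); have a0 : 0 < a by rewrite divr_gt0// mulr_gt0.
    have : rnorm (phi y (toC a *: v)) < 1.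
      apply: (At (to_total E (toC a *: v))) => //; split=> //.
      rewrite /fiber_norm/= rnormZ (rnorm_toC (ltW a0)) /a invfM mulrA mulfVK ?lt0r_neq0//.
      by rewrite ltr_pdivrMr// ltr_pMr// ltr1n.
    rewrite -[_ *: v]addr0 phiD// phi0// addr0 rnormZ (rnorm_toC (ltW a0)).
    rewrite -ltr_pdivlMl// mulr1 => /ltW /le_trans; apply.
    by rewrite /a invf_div mulrAC.
- move=> x Ux v; have [K1x K2x] := phiK x Ux.
  by rewrite -psi_sum// -kP K1x.
Qed.

Hypothesis E_fbundle : is_fbundle E.

Lemma Gamma0_norm_continuous (s : forall x, E x) : G s -> continuous (fun x => rnorm (s x)).
Proof.
move=> [sc _] x; have [_ nc] := E_fbundle.
exact: (@continuous_comp _ _ _ (fun x => to_total E (s x)) (@fiber_norm R X E) x (sc x) (nc _)).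
Qed.

Lemma frame_norm_continuous (U : set X) d (e : nat -> forall x, E x) x (a : nat -> C R) : U x ->
  (forall i, (i < d)%N -> locally_in G U (e i) x) -> within_cvg U (frame_norm d e ^~ a) x.
Proof.
move=> Ux eG; apply: (locally_in_norm_cvg (G := G) (s := fun y => \sum_(i < d) a i *: e i y)) => //.
  exact: Gamma0_norm_continuous.
apply: (locally_in_sum (Gamma0_module E)) => i _; apply: (locally_inC (Gamma0_module E)).
exact: eG.
Qed.

Lemma good_frame (U : set X) d : trivial_over E U -> (forall x, U x -> has_dim (E x) d) ->
  exists e f, [/\ frame U d e f,
    forall x i, U x -> (i < d)%N -> rnorm (e i x) <= 1 &
    forall x i v, U x -> (i < d)%N -> rnorm (f i x v) <= 2 * 3 ^+ d * rnorm v].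
Proof.
move=> Utriv Ud; have [e [f [[eG fG ef] e_ind]]] := trivial_frame Utriv Ud.
have N_cvg x a : U x -> within_cvg U (frame_norm d e ^~ a) x.
  by move=> Ux; apply: frame_norm_continuous => // i; exact: eG.
have [P [Q PQ]] := good_coordinates e_ind N_cvg (leqnn d).
pose a x (v : E x) (i : nat) : C R := if (i < d)%N then f i x v else 0.
have a0 x v i : (d <= i)%N -> a x v i = 0 by rewrite leqNgt /a => /negbTE ->.
have aE x v (i : 'I_d) : a x v i = f i x v by rewrite /a ltn_ord.
have av x v : U x -> v = \sum_(i < d) a x v i *: e i x.
  by move=> Ux; rewrite {1}(ef x Ux v); apply: eq_bigr => i _; rewrite aE.
have fQ x v k : \sum_(l < d) f l x v * Q k x l = \sum_(l < d) a x v l * Q k x l.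
  by apply: eq_bigr => l _; rewrite aE.
exists (fun k x => \sum_(i < d) P k x i *: e i x), (fun k x v => \sum_(l < d) f l x v * Q k x l).
split; first split.
- move=> k x Ux kd; apply: (locally_in_sum (Gamma0_module E)) => i _.
  apply: (locally_inM (Gamma0_module E)) => //; last exact: eG.
  by have [/(_ k i kd)[Pc _] _ _ _] := PQ x Ux; exact: Pc.
- move=> k kd; apply: (functional_field_sum (q := fun l x => Q k x l) fG) => x l Ux ld.
  by have [/(_ k l kd)[_ Qc] _ _ _] := PQ x Ux; exact: Qc.
- move=> x Ux v; rewrite {1}(av x v Ux); have [_ _ PQa _] := PQ x Ux.
  under [RHS]eq_bigr do rewrite scaler_sumr.
  rewrite exchange_big/=; apply: eq_bigr => i _.
  rewrite (PQa _ (a0 x v) i) scaler_suml; apply: eq_bigr => k _.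
  by rewrite scalerA fQ.
- by move=> x k Ux kd; have [_ + _ _] := PQ x Ux => /(_ k kd).
- move=> x k v Ux kd; rewrite fQ; have [_ _ _ +] := PQ x Ux => /(_ _ k (a0 x v) kd).
  by rewrite /frame_norm -(av x v Ux).
Qed.

Hypothesis E_subhomogeneous : subhomogeneous E.

Definition dim_lt (d : nat) : set X := [set x | exists2 k, (k < d)%N & has_dim (E x) k].

Lemma dim_lt_closed d : closed (dim_lt d).
Proof.
rewrite -openC openE => x xd; have [n nP] := E_subhomogeneous.
have [m _ xm] := nP x.
have dm : (d <= m)%N by rewrite leqNgt; apply/negP => md; apply: xd; exists m.
have [b b_ind _] := has_dim_basis xm.
have /choice[g gb] : forall i, exists s : Gamma0 E, s x = b i.
  by move=> i; exact: exists_section_through.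
have gx_ind : independent m (fun i => g i x).
  by move=> a h; apply: b_ind; rewrite -[RHS]h; apply: eq_bigr => i _; rewrite gb.
pose N := @frame_norm R X (fun x => E x) m (fun i => g i).
have near1 : \forall y \near x, setT y -> forall a, `|N y a - N x a| <= 2^-1 * N x a.
  apply: frame_norm_near gx_ind _ _ => // a; apply: frame_norm_continuous => // i _.
  by apply: locally_in_smod; exact: Gamma0_setP.
apply: filterS near1 => y yP [k kd yk].
have [f _ f_span] := has_dim_basis yk.
suff /(independent_le)/(_ f_span) mk : independent m (fun i => g i y).
  by have := leq_trans dm mk; rewrite leqNgt kd.
move=> a h; have Ny : N y a = 0 by rewrite /N /frame_norm h rnorm0.
apply: gx_ind; apply: rnorm_eq0; apply/le_anti; rewrite rnorm_ge0 andbT.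
have := yP I a; rewrite Ny sub0r normrN ger0_norm ?frame_norm_ge0// /N /frame_norm; lra.
Qed.

Lemma stratumE d : stratum E d = dim_lt d.+1 `\` dim_lt d.
Proof.
apply/seteqP; split=> x.
  by move=> xd; split=> [|[k kd /(has_dim_uniq xd) dk]]; [exists d|rewrite dk ltnn in kd].
move=> [[k]]; rewrite ltnS leq_eqVlt => /orP[/eqP->//|kd xk] []; by exists k.
Qed.

End bundle_frames.

(** * Continuous majorants *)

Section majorants.
Context {R : realType} {X : topologicalType}.
Hypothesis X_hausdorff : hausdorff_space X.
Hypothesis X_lc : locally_compact [set: X].

Lemma dyadic_series (a : nat -> X -> R) (m : R) : 0 < m ->
  (forall k, continuous (a k)) -> (forall k x, 0 <= a k x <= 1) ->
  (forall k, exists2 K, compact K & forall x, ~ K x -> a k x = 0) ->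
  exists g : X -> R, [/\ continuous g, vanishes_at_infinity g, forall x, 0 <= g x <= 4 * m,
    forall k x, 2 * m / 2 ^+ k * a k x <= g x & forall x, 0 < g x -> exists k, 0 < a k x].
Proof.
move=> m0 ac a01 acpt.
have m20 : 0 <= 2 * m by rewrite mulr_ge0// ltW.
pose S n x := \sum_(k < n) 2 * m / 2 ^+ k * a k x.
have t0 k x : 0 <= 2 * m / 2 ^+ k * a k x.
  by rewrite mulr_ge0 ?half_pow_ge0//; have /andP[] := a01 k x.
have S0 n x : 0 <= S n x by apply: sumr_ge0 => k _.
have Sc n : continuous (S n).
  move=> x; apply: (@cvg_sum_seq R R^o) => k _; apply: cvgM; first exact: cvg_cst.
  exact: ac.
have Sle n k x : S n x <= S (k + n)%N x.
  elim: k => [//|k IH]; apply: le_trans IH _.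
  by rewrite /S addSn big_ord_recr/= lerDl.
have [|||u [l [_ uP _ lu]]] := @sup_iteration R X (fun=> Ccomplete)
  (fun n s => s = fun x => toC (S n x)) (2 * m) (fun x => toC (S 0%N x)); [exact: m20|by []| |].
  move=> n _ ->; exists (fun x => toC (S n.+1 x)) => // x.
  rewrite -toCB rnorm_toC_norm {1}/S big_ord_recr/= addrC addrK ger0_norm//.
  by rewrite ler_piMr ?half_pow_ge0//; have /andP[] := a01 n x.
pose g x := ReC (l x); have m40 : 0 <= 4 * m by rewrite mulr_ge0// ltW.
have gS n x : `|g x - S n x| <= 4 * m / 2 ^+ n.
  have := lu n x; rewrite (uP n) mulrA -natrM; apply: le_trans.
  by have := ReC_rnorm (l x - toC (S n x)); rewrite ReCB.
have gge n x : S n x <= g x.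
  rewrite -subr_le0; apply: (half_pow_le0 m40) => k.
  apply: (@le_trans _ _ (4 * m / 2 ^+ (k + n)%N)); last by rewrite half_pow_le// leq_addr.
  have := gS (k + n)%N x; rewrite ler_norml => /andP[h _]; have := Sle n k x; lra.
have g0 x : 0 <= g x by apply: le_trans (gge 0%N x).
exists g; split.
- move=> x; apply/cvgrPdist_lt => e e0; have e30 : 0 < e / 3 by rewrite divr_gt0.
  have [n ne] := half_pow_small m40 e30.
  have /cvgrPdist_lt/(_ _ e30) := Sc n x; apply: filterS => y.
  have := gS n x; have := gS n y; rewrite !ler_norml !ltr_norml.
  by move=> /andP[? ?] /andP[? ?] /andP[? ?]; apply/andP; split; lra.
- move=> e e0; have [n ne] := half_pow_small m40 e0.
  have [K cK KS] : exists2 K, compact K & forall x, ~ K x -> S n x = 0.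
    elim: (n) => [|k [K cK KS]].
      by exists set0; [exact: compact0|move=> x _; rewrite /S big_ord0].
    have [K' cK' K'a] := acpt k; exists (K `|` K'); first exact: compactU.
    by move=> x /not_orP[nK nK']; rewrite /S big_ord_recr/= -/(S k x) KS// K'a// mulr0 addr0.
  exists K => // x /KS Sx; have := gS n x; rewrite Sx subr0 ger0_norm//.
  by move=> /le_lt_trans; apply.
- move=> x; rewrite g0/=; have := gS 0%N x; rewrite /S big_ord0 subr0 expr0 divr1.
  by rewrite ger0_norm.
- move=> k x; apply: le_trans (gge k.+1 x); rewrite /S big_ord_recr/= lerDr.
  exact: S0.
- move=> x gx; apply: contrapT => na; have a0 k : a k x = 0.
    apply/le_anti; have /andP[-> _] := a01 k x; rewrite andbT leNgt.
    by apply/negP => ak; apply: na; exists k.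
  suff : g x <= 0 by rewrite leNgt gx.
  apply: (half_pow_le0 m40) => n; have := gS n x.
  by rewrite /S big1 ?subr0 ?ger0_norm// => k _; rewrite a0 mulr0.
Qed.

Lemma majorant (f : X -> R) (m : R) (Z : set X) (n : nat) (O : 'I_n -> set X) :
  upper_semicontinuous f -> vanishes_at_infinity f -> 0 < m -> (forall x, f x <= m) ->
  closed Z -> (forall l, open (O l)) -> (forall x, Z x -> 0 < f x -> exists l, O l x) ->
  exists g : 'I_n -> X -> R, [/\ forall l, continuous (g l),
    forall l, vanishes_at_infinity (g l), forall l x, 0 <= g l x <= 4 * m,
    forall l x, 0 < g l x -> O l x & forall x, Z x -> f x <= \sum_l g l x].
Proof.
move=> fusc fv m0 fm cZ oO ZO.
have mk0 k : 0 < m / 2 ^+ k by rewrite divr_gt0// exprn_gt0.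
pose A k := [set x | Z x /\ m / 2 ^+ k <= f x].
have A_compact k : compact (A k).
  have [K cK Kf] := fv _ (mk0 k).
  apply: (@subclosed_compact _ _ K) => //; last first.
    move=> x [_ fx]; apply: contrapT => /Kf; by rewrite ltNge fx.
  rewrite -openC openE => x; rewrite /A /= => /not_andP[nZ|nf].
    have : nbhs x (~` Z) by apply: open_nbhs_nbhs; split=> //; exact: closed_openC.
    by apply: filterS => y nZy [].
  have {nf} : f x < m / 2 ^+ k by rewrite ltNge; apply/negP.
  by move=> /fusc; apply: filterS => y fy [_]; rewrite leNgt fy.
have lamP x : exists l : option 'I_n, Z x -> 0 < f x -> exists2 l', l = Some l' & O l' x.
  have [[Zx fx]|h] := pselect (Z x /\ 0 < f x); last by exists None => Zx fx; case: h.
  by have [l Ol] := ZO x Zx fx; exists (Some l) => _ _; exists l.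
have [lam {}lamP] := choice lamP.
pose N x := if lam x is Some l then O l else set0.
have part k : exists sf : seq X * (X -> X -> R),
    [/\ forall y, y \in sf.1 -> [/\ A k y, bump (N y) (sf.2 y) & forall x, sf.2 y x <= 1],
        forall x, \sum_(y <- sf.1) sf.2 y x <= 1 &
        forall x, A k x -> \sum_(y <- sf.1) sf.2 y x = 1].
  have [|s [f' [h1 h2 h3]]] := finite_partition (R := R) X_hausdorff X_lc (A_compact k) (O := N).
    move=> x [Zx fx]; have [|l lx Ol] := lamP x Zx; first exact: lt_le_trans fx.
    by rewrite /N lx; apply: open_nbhs_nbhs.
  by exists (s, f').
have {part}[sf sfP] := choice part.
pose h k (y : X) (l : 'I_n) x : R := if lam y == Some l then (sf k).2 y x else 0.
pose chi (l : 'I_n) k x := \sum_(y <- (sf k).1) h k y l x.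
have h0 k y l x : y \in (sf k).1 -> 0 <= h k y l x.
  by move=> ys; rewrite /h; have [/(_ y ys)[_ [_ f0 _] _] _ _] := sfP k; case: ifP.
have hf k y l x : y \in (sf k).1 -> h k y l x <= (sf k).2 y x.
  by move=> ys; rewrite /h; have [/(_ y ys)[_ [_ f0 _] _] _ _] := sfP k; case: ifP.
have chi01 l k x : 0 <= chi l k x <= 1.
  apply/andP; split; first by rewrite /chi big_seq; apply: sumr_ge0 => y; exact: h0.
  have [_ + _] := sfP k => /(_ x); apply: le_trans.
  by rewrite /chi !big_seq; apply: ler_sum => y; exact: hf.
have chic l k : continuous (chi l k).
  move=> x; apply: (@cvg_sum_seq R R^o) => y ys; rewrite /h.
  have [/(_ y ys)[_ [fc _ _] _] _ _] := sfP k; case: ifP => _; first exact: fc.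
  exact: cvg_cst.
have chicpt l k : exists2 K, compact K & forall x, ~ K x -> chi l k x = 0.
  rewrite /chi; have [+ _ _] := sfP k; elim: (sf k).1 => [|y s IH] sP.
    by exists set0; [exact: compact0|move=> x _; rewrite big_nil].
  have [|K cK Ks] := IH; first by move=> z zs; apply: sP; rewrite inE zs orbT.
  have [|_ [_ _ [K' cK' [_ K'f]]] _] := sP y; first by rewrite mem_head.
  exists (K `|` K'); first exact: compactU.
  move=> x /not_orP[nK nK']; rewrite big_cons Ks// addr0 /h K'f//.
  by case: ifP.
have chiO l k x : 0 < chi l k x -> O l x.
  move=> c0; apply: contrapT => nO; move: c0; rewrite /chi big1_seq ?ltxx// => y /andP[_ ys].
  have [/(_ y ys)[_ [_ _ [K _ [KN K0]]] _] _ _] := sfP k; rewrite /h.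
  case: ifP => // /eqP ly; apply: K0 => /KN; by rewrite /N ly.
have chiA k x : A k x -> \sum_l chi l k x = 1.
  move=> Ax; have [sP _ /(_ x Ax) <-] := sfP k; rewrite exchange_big/= !big_seq.
  apply: eq_bigr => y ys; rewrite /h.
  have [[Zy fy] _ _] := sP y ys; have [|l ly _] := lamP y Zy; first exact: lt_le_trans fy.
  rewrite (bigD1 l)//= ly eqxx big1 ?addr0// => l' l'l.
  by rewrite (_ : (Some l == Some l') = false)//; apply/negbTE; rewrite (inj_eq Some_inj) eq_sym.
have /choice[g gP] l := dyadic_series m0 (chic l) (chi01 l) (chicpt l).
exists g; split.
- by move=> l; have [] := gP l.
- by move=> l; have [] := gP l.
- by move=> l; have [] := gP l.
- by move=> l x gx; have [_ _ _ _ /(_ x gx)[k /chiO]] := gP l.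
- move=> x Zx; have g0 l : 0 <= g l x by have [_ _ /(_ x)/andP[]] := gP l.
  have [fx|fx] := leP (f x) 0; first by apply: le_trans fx _; exact: sumr_ge0.
  have ex_k : exists k, m / 2 ^+ k <= f x.
    by have [k /ltW] := half_pow_small (ltW m0) fx; exists k.
  pose k := ex_minn ex_k.
  have [kf fk] : m / 2 ^+ k <= f x /\ f x <= 2 * m / 2 ^+ k.
    rewrite /k; case: ex_minnP => -[|j] jf jmin; split=> //.
      by rewrite expr0 divr1; have := fm x; lra.
    have := jmin j; rewrite ltnn => h'; have : f x < m / 2 ^+ j.
      by rewrite ltNge; apply/negP => /h'.
    by rewrite exprS -mulf_div divff// mul1r => /ltW.
  apply: le_trans fk _.
  have -> : 2 * m / 2 ^+ k = \sum_l 2 * m / 2 ^+ k * chi l k x.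
    by rewrite -big_distrr/= chiA// mulr1.
  by apply: ler_sum => l _; have [_ _ _ /(_ k x)] := gP l.
Qed.

End majorants.

(** * Slices of projective tensor products *)

Lemma locally_in_cutoff {R : realType} {X : topologicalType} (V : X -> completeNormedModType (C R))
    (G : set (forall x, V x)) (Z O : set X) (h : X -> R) (s : forall x, V x) (c : R) :
  section_module G -> open O -> continuous h -> vanishes_at_infinity h ->
  (forall x, 0 <= h x) -> (forall x, 0 < h x -> O x) -> 0 < c ->
  (forall x, Z x -> 0 < h x -> locally_in G (Z `&` O) s x) ->
  (forall x, Z x -> rnorm (s x) <= c * h x) ->
  (forall x, Z x -> locally_in G Z s x) /\ vanishes_on Z s.
Proof.
move=> HG oO hc hv h0 hO c0 sG sh; split=> [x Zx|e e0]; last first.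
  have [K cK Kh] := hv _ (divr_gt0 e0 c0); exists K => // x Zx /Kh hx.
  by apply: le_lt_trans (sh x Zx) _; rewrite mulrC -ltr_pdivlMr.
have [hx|hx] := ltP 0 (h x).
  have Ox := hO x hx; move=> e e0; have [t Gt st] := sG x Zx hx e e0; exists t => //.
  have xO : nbhs x O by exact: open_nbhs_nbhs.
  by apply: filterS2 st xO => y sy Oy Zy; exact: sy.
apply: (locally_in_small HG) => e e0.
have := cvgr_lt _ (hc x) (e / c); rewrite (le_lt_trans hx (divr_gt0 e0 c0)) => /(_ _ isT).
apply: filterS => y hy Zy; apply: le_lt_trans (sh y Zy) _.
by rewrite mulrC -ltr_pdivlMr.
Qed.

Section slice.
Context {R : realType} (V W : completeNormedModType (C R)).

(* The extension of f (x) id to the projective tensor product, for a functional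
   f of norm at most m; ptensor_lift needs the factor m^-1 to make it contractive. *)
Definition slice (m : R) (f : V -> C R) (q : ptensor V W) : W :=
  toC m *: ptensor_lift (fun v w => (toC m^-1 * f v) *: w) q.

Context (m : R) (f : V -> C R) (m0 : 0 < m).
Hypothesis f_lin : forall a u v, f (a *: u + v) = a * f u + f v.
Hypothesis f_bound : forall v, rnorm (f v) <= m * rnorm v.

Let g v w : W := (toC m^-1 * f v) *: w.

Let fD u v : f (u + v) = f u + f v.
Proof. by rewrite -[u]scale1r f_lin mul1r scale1r. Qed.

Let f0 : f 0 = 0.
Proof. by have := f_lin (-1) 0 0; rewrite scaler0 addr0 mulN1r addNr. Qed.

Let g_bil : bilinear_map g.
Proof.
split=> [u v w|v w w'|a v w|a v w]; rewrite /g.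
- by rewrite fD mulrDr scalerDl.
- by rewrite scalerDr.
- by rewrite -[a *: v]addr0 f_lin f0 addr0 scalerA mulrCA.
- by rewrite !scalerA mulrC.
Qed.

Let g_norm v w : rnorm (g v w) <= rnorm v * rnorm w.
Proof.
have mV : 0 <= m^-1 by rewrite invr_ge0 ltW.
by rewrite rnormZ ler_wpM2r ?rnorm_ge0// rnormM (rnorm_toC mV) ler_pdivrMl.
Qed.

Lemma slice_linear a p q : slice m f (a *: p + q) = a *: slice m f p + slice m f q.
Proof.
by rewrite /slice (ptensor_lift_linear g_bil g_norm) scalerDr !scalerA mulrC.
Qed.

Lemma slice_norm q : rnorm (slice m f q) <= m * rnorm q.
Proof.
rewrite rnormZ (rnorm_toC (ltW m0)) ler_pM2l//.
exact: (ptensor_lift_norm g_bil g_norm).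
Qed.

Lemma slice_ptens v w : slice m f (ptens v w) = f v *: w.
Proof.
rewrite /slice (ptensor_lift_ptens g_bil g_norm) /g scalerA mulrA -toCM.
by rewrite divff ?lt0r_neq0// (_ : toC 1 = 1)// mul1r.
Qed.

Lemma slice0 : slice m f 0 = 0.
Proof. by have := slice_linear (-1) 0 0; rewrite scaler0 addr0 scaleN1r addNr. Qed.

Lemma slice_sum (I : Type) (l : seq I) (q : I -> ptensor V W) :
  slice m f (\sum_(i <- l) q i) = \sum_(i <- l) slice m f (q i).
Proof.
elim: l => [|i l IH]; first by rewrite !big_nil slice0.
by rewrite !big_cons -[q i]scale1r slice_linear scale1r scale1r IH.
Qed.

End slice.

Section ptensor_facts.
Context {R : realType}.

Lemma ptens_suml (V W : normedModType (C R)) (I : Type) (l : seq I) (v : I -> V) (w : W) :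
  ptens (\sum_(i <- l) v i) w = \sum_(i <- l) ptens (v i) w.
Proof.
have b := @ptens_bilinear R V W; elim: l => [|i l IH].
  by rewrite !big_nil -(scale0r 0) (bilZl b) scale0r.
by rewrite !big_cons (bilDl b) IH.
Qed.

Lemma ptens_sumr (V W : normedModType (C R)) (I : Type) (l : seq I) (v : V) (w : I -> W) :
  ptens v (\sum_(i <- l) w i) = \sum_(i <- l) ptens v (w i).
Proof.
have b := @ptens_bilinear R V W; elim: l => [|i l IH].
  by rewrite !big_nil -(scale0r 0) (bilZr b) scale0r.
by rewrite !big_cons (bilDr b) IH.
Qed.

Lemma compl_to_tensor (V W : normedModType (C R)) (s : seq (V * W)) :
  compl (proj_seminorm V W) (to_tensor s) = \sum_(p <- s) ptens p.1 p.2.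
Proof. by rewrite to_tensor_sum linear_sum. Qed.

Lemma ptens_decomp (V W : completeNormedModType (C R)) (m : R) (d : nat) (e : nat -> V) (f : nat -> V -> C R) :
  0 < m -> (forall i, (i < d)%N -> forall a u v, f i (a *: u + v) = a * f i u + f i v) ->
  (forall i v, (i < d)%N -> rnorm (f i v) <= m * rnorm v) ->
  (forall v, v = \sum_(i < d) f i v *: e i) ->
  forall q : ptensor V W, q = \sum_(i < d) ptens (e i) (slice m (f i) q).
Proof.
move=> m0 f_lin f_bound ef q.
have b := @ptens_bilinear R V W.
have fl (i : 'I_d) := f_lin i (ltn_ord i).
have fb (i : 'I_d) v := f_bound i v (ltn_ord i).
pose D (p : ptensor V W) := \sum_(i < d) ptens (e i) (slice m (f i) p).
have DB p p' : D p - D p' = D (p - p').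
  rewrite /D -sumrB; apply: eq_bigr => i _.
  have -> : slice m (f i) (p - p') = - slice m (f i) p' + slice m (f i) p.
    rewrite addrC -scaleN1r (slice_linear m0 (fl i) (fb i)).
    by rewrite scaleN1r.
  have h w : ptens (e i) (- w) = - ptens (e i) w :> ptensor V W.
    by rewrite -scaleN1r (bilZr b) scaleN1r.
  by rewrite (bilDr b) h addrC.
have Dn p : rnorm (D p) <= (\sum_(i < d) rnorm (e i) * m) * rnorm p.
  apply: le_trans (rnorm_sum _ _ _) _; rewrite big_distrl/=.
  apply: ler_sum => i _; apply: le_trans (ptens_norm_le _ _) _.
  by rewrite -mulrA ler_wpM2l ?rnorm_ge0//; exact: slice_norm m0 (fl i) (fb i) p.
have Dc s : D (compl _ (to_tensor s)) = compl _ (to_tensor s).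
  rewrite compl_to_tensor /D.
  transitivity (\sum_(i < d) \sum_(p <- s) ptens (f i p.1 *: e i) p.2).
    apply: eq_bigr => i _; rewrite (slice_sum m0 (fl i) (fb i)).
    rewrite ptens_sumr; apply: eq_bigr => p _.
    by rewrite (slice_ptens m0 (fl i) (fb i)) (bilZr b) (bilZl b).
  rewrite exchange_big/=; apply: eq_bigr => p _.
  by rewrite -ptens_suml -ef.
pose M := \sum_(i < d) rnorm (e i) * m + 1.
have M0 : 0 < M.
  by rewrite ltr_wpDl// sumr_ge0// => i _; rewrite mulr_ge0 ?rnorm_ge0// ltW.
apply/eqP; rewrite -subr_eq0; apply/eqP/rnorm_eq0/le_anti; rewrite rnorm_ge0 andbT.
apply/ler_addgt0Pr => r r0; rewrite add0r.
have [t tq] := compl_dense q (divr_gt0 r0 M0).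
rewrite -/(D q) -(subrKA (compl _ t)); apply: le_trans (rnormD _ _) _.
have -> : compl (proj_seminorm V W) t - D q = D (compl _ t - q).
  by rewrite -DB -{1 2}[t]tensor_reprK Dc.
have h1 := Dn (compl _ t - q); rewrite rnormB.
have : M * rnorm (compl (proj_seminorm V W) t - q) <= r.
  by rewrite mulrC -ler_pdivlMr// ltW.
by rewrite /M mulrDl mul1r; move: h1; lra.
Qed.

End ptensor_facts.

Section tensor_sections.
Context {R : realType} {X : topologicalType} (E F : hbundle R X).
Implicit Types (a b : seq (Gamma0 E * Gamma0 F)) (u : forall x, ptensor (E x) (F x)).

Definition tensor_value a x : ptensor (E x) (F x) := \sum_(p <- a) ptens (p.1 x) (p.2 x).

Local Notation ev := tensor_value.

Definition algebraic_sections : set (forall x, ptensor (E x) (F x)) := [set u | exists a, ev a = u].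

(* The continuous sections of E (x) F vanishing at infinity, described without
   reference to a topology on the total space. *)
Definition tensor_field u := (forall x, locally_in algebraic_sections setT u x) /\
  vanishes_at_infinity (fun x => rnorm (u x)).

Lemma tensor_valueD a b x : ev (a ++ b) x = ev a x + ev b x.
Proof. by rewrite /ev big_cat. Qed.

Lemma tensor_valueZ (c : C R) a x : ev (seq_scale c a) x = c *: ev a x.
Proof.
rewrite /ev /seq_scale big_map scaler_sumr; apply: eq_bigr => p _ /=.
exact: (bilZl (@ptens_bilinear R (E x) (F x))).
Qed.

Definition fiber_terms a x : seq (E x * F x) :=
  [seq (p.1 x, p.2 x) | p : Gamma0 E * Gamma0 F <- a].

Lemma tensor_valueE a x : ev a x = compl (proj_seminorm (E x) (F x)) (to_tensor (fiber_terms a x)).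
Proof. by rewrite compl_to_tensor big_map. Qed.

Lemma tensor_value_vanish a : vanishes_at_infinity (fun x => rnorm (ev a x)).
Proof.
elim: a => [|p a IH].
  move=> e e0; exists set0; first exact: compact0.
  by move=> x _; rewrite /ev big_nil rnorm0.
apply: (vanish_le2 (tensor_section_vanish p.1 p.2) IH) => e e0.
exists (e / 2); first by rewrite divr_gt0.
move=> x h1 h2; rewrite /ev big_cons; apply: le_lt_trans (rnormD _ _) _.
by rewrite [e]splitr ltrD.
Qed.

Lemma tensor_fieldB u a : tensor_field u -> tensor_field (fun x => u x - ev a x).
Proof.
move=> [uG uv]; split=> [x e e0|].
  have [_ [b <-] bu] := uG x e e0; exists (ev (b ++ seq_scale (-1) a)); first by eexists.
  apply: filterS bu => y /[apply]; rewrite tensor_valueD tensor_valueZ scaleN1r.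
  by rewrite opprB addrA subrK.
apply: (vanish_le2 uv (@tensor_value_vanish a)) => e e0.
exists (e / 2); first by rewrite divr_gt0.
move=> x h1 h2; apply: le_lt_trans (rnormD _ _) _.
by rewrite rnormN [e]splitr ltrD.
Qed.

Let cost x a := \sum_(p <- a) rnorm (p.1 x) * rnorm (p.2 x).

Let ev_cost x a : rnorm (ev a x) <= cost x a.
Proof.
apply: le_trans (rnorm_sum _ _ _) _; apply: ler_sum => p _; exact: ptens_norm_le.
Qed.

Lemma Gamma0_usc (B : hbundle R X) (s : Gamma0 B) : upper_semicontinuous (fun x => rnorm (s x)).
Proof. exact: (smod_usc (Gamma0_module B) (Gamma0_setP s)). Qed.

Lemma usc_mul (f g : X -> R) : (forall x, 0 <= f x) -> (forall x, 0 <= g x) ->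
  upper_semicontinuous f -> upper_semicontinuous g -> upper_semicontinuous (fun x => f x * g x).
Proof.
move=> f0 g0 fu gu x c fgc; pose A := f x; pose B := g x.
have A0 : 0 <= A := f0 x; have B0 : 0 <= B := g0 x.
pose d := Num.min 1 ((c - A * B) / (A + B + 2)).
have s0 : 0 < A + B + 2 by rewrite ltr_wpDl// addr_ge0.
have d0 : 0 < d by rewrite lt_min ltr01 divr_gt0// subr_gt0.
have d1 : d <= 1 by rewrite ge_min lexx.
have dc : d * (A + B + 2) <= c - A * B by rewrite -ler_pdivlMr// ge_min lexx orbT.
have fx : f x < A + d by rewrite ltrDl.
have gx : g x < B + d by rewrite ltrDl.
apply: filterS2 (fu _ _ fx) (gu _ _ gx) => y fy gy.
apply: (@le_lt_trans _ _ ((A + d) * (B + d))); first by rewrite ler_pM// ltW.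
have : d * d <= d by rewrite ler_piMl// ltW.
have : (A + d) * (B + d) = A * B + d * (A + B) + d * d by ring.
have : d * (A + B + 2) = d * (A + B) + 2 * d by ring.
lra.
Qed.

Lemma usc_sum (I : Type) (l : seq I) (f : I -> X -> R) :
  (forall i, upper_semicontinuous (f i)) -> upper_semicontinuous (fun x => \sum_(i <- l) f i x).
Proof.
move=> fu; elim: l => [|i l IH] x c.
  by rewrite big_nil => c0; apply: nearW => y; rewrite big_nil.
rewrite big_cons => h; pose d := (c - (f i x + \sum_(j <- l) f j x)) / 2.
have d0 : 0 < d by rewrite divr_gt0// subr_gt0.
have h1 : f i x < f i x + d by rewrite ltrDl.
have h2 : \sum_(j <- l) f j x < \sum_(j <- l) f j x + d by rewrite ltrDl.
apply: filterS2 (fu _ _ _ h1) (IH _ _ h2) => y; rewrite big_cons.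
by have : d = (c - (f i x + \sum_(j <- l) f j x)) / 2 by []; lra.
Qed.

Let cost_usc a : upper_semicontinuous (fun x => cost x a).
Proof.
apply: usc_sum => p; apply: usc_mul => [x|x||]; try exact: rnorm_ge0; exact: Gamma0_usc.
Qed.

Hypothesis X_hausdorff : hausdorff_space X.
Hypothesis X_lc : locally_compact [set: X].
Hypothesis E_subhomogeneous : subhomogeneous E.

(* Writing the first factors at x in a basis of E x, and lifting the basis to
   global sections, a becomes a sum of terms one of whose factors vanishes at x. *)
Lemma tensor_value_small a x : ev a x = 0 ->
  forall e : R, 0 < e -> \forall y \near x, rnorm (ev a y) < e.
Proof.
move=> ax e e0; have [n nP] := E_subhomogeneous; have [d _ xd] := nP x.
have [b b_ind b_span] := has_dim_basis xd.
have [K K0 bK] := independent_bounded b_ind.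
have /choice[k kP] := b_span.
have k_lin i (c : C R) v w : (i < d)%N -> k (c *: v + w) i = c * k v i + k w i.
  move=> id; apply/eqP; rewrite -subr_eq0; apply/eqP.
  apply: (b_ind (fun i => k (c *: v + w) i - (c * k v i + k w i))) => //.
  under eq_bigr do rewrite scalerBl scalerDl -scalerA.
  by rewrite sumrB big_split/= -scaler_sumr -!kP subrr.
have k_bd i v : (i < d)%N -> rnorm (k v i) <= K * rnorm v.
  by move=> id; rewrite {2}(kP v); exact: bK.
have /choice[g gb] : forall i, exists s : Gamma0 E, s x = b i.
  by move=> i; exact: exists_section_through.
pose r (p : Gamma0 E * Gamma0 F) : Gamma0 E := p.1 - \sum_(i < d) k (p.1 x) i *: g i.
pose t (i : 'I_d) : Gamma0 F := \sum_(p <- a) k (p.1 x) i *: p.2.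
have sumE (B : hbundle R X) (I : Type) (l : seq I) (s : I -> Gamma0 B) y :
    (\sum_(i <- l) s i) y = \sum_(i <- l) s i y.
  by elim: l => [|i l IH]; rewrite ?big_nil// !big_cons Gamma0D IH.
have rE p y : r p y = p.1 y - \sum_(i < d) k (p.1 x) i *: g i y by rewrite /r Gamma0B sumE.
pose a' := [seq (r p, p.2) | p <- a] ++ [seq (g i, t i) | i : 'I_d <- index_enum 'I_d].
have aa' y : ev a y = ev a' y.
  rewrite tensor_valueD /ev !big_map.
  have -> : \sum_(p <- a) ptens ((r p, p.2).1 y) ((r p, p.2).2 y) =
      \sum_(p <- a) ptens (r p y) (p.2 y) by [].
  have -> : \sum_(i < d) ptens ((g i, t i).1 y) ((g i, t i).2 y) =
      \sum_(p <- a) ptens (\sum_(i < d) k (p.1 x) i *: g i y) (p.2 y).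
    transitivity (\sum_(i < d) \sum_(p <- a) ptens (k (p.1 x) i *: g i y) (p.2 y)).
      apply: eq_bigr => i _; rewrite /t sumE ptens_sumr; apply: eq_bigr => p _.
      have B := @ptens_bilinear R (E y) (F y).
      by rewrite (bilZl B) -(bilZr B).
    by rewrite exchange_big; apply: eq_bigr => p _; rewrite ptens_suml.
  rewrite -big_split; apply: eq_bigr => p _; rewrite -[RHS](bilDl (@ptens_bilinear R (E y) (F y))).
  congr ptens.
  by rewrite rE subrK.
have rx p : r p x = 0.
  rewrite rE; apply/eqP; rewrite subr_eq0 {1}(kP (p.1 x)); apply/eqP.
  by apply: eq_bigr => i _; rewrite gb.
have tx i : t i x = 0.
  have kl c v w := k_lin i c v w (ltn_ord i).
  have kb v := k_bd i v (ltn_ord i).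
  have := congr1 (slice K (k^~ i)) ax; rewrite /ev (slice_sum K0 kl kb).
  rewrite (slice0 _ K0 kl kb) => <-; rewrite /t sumE; apply: eq_bigr => p _.
  by rewrite (slice_ptens K0 kl kb).
have cost0 : cost x a' = 0.
  transitivity (\sum_(p <- a) rnorm (r p x) * rnorm (p.2 x) +
    \sum_(i < d) rnorm (g i x) * rnorm (t i x)); first by rewrite /cost big_cat !big_map.
  rewrite !big1 ?addr0// => [i _|p _]; first by rewrite tx rnorm0 mulr0.
  by rewrite rx rnorm0 mul0r.
have := @cost_usc a' x e; rewrite cost0 => /(_ e0); apply: filterS => y.
by rewrite aa'; apply: le_lt_trans.
Qed.

Lemma tensor_value_usc a : upper_semicontinuous (fun x => rnorm (ev a x)).
Proof.
move=> x c axc; pose d := (c - rnorm (ev a x)) / 2.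
have d0 : 0 < d by rewrite divr_gt0// subr_gt0.
have [s st sc] := proj_norm_adherent (to_tensor (fiber_terms a x)) d0.
have [b bs] : exists b, fiber_terms b x = s.
  elim: (s) => [|[v w] l [b bl]]; first by exists [::].
  have [v' v'x] := exists_section_through X_hausdorff X_lc v.
  have [w' w'x] := exists_section_through X_hausdorff X_lc w.
  by exists ((v', w') :: b); rewrite /fiber_terms/= v'x w'x -bl.
have cb : cost x b < rnorm (ev a x) + d.
  move: sc; rewrite -bs /tensor_cost /cost big_map => /lt_le_trans; apply.
  by rewrite tensor_valueE compl_norm.
pose r := a ++ seq_scale (-1) b.
have evr y : ev r y = ev a y - ev b y by rewrite tensor_valueD tensor_valueZ scaleN1r.
have rx : ev r x = 0 by rewrite evr !tensor_valueE bs st subrr.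
apply: filterS2 (cost_usc cb) (tensor_value_small rx d0) => y by_ ry.
rewrite -[ev a y](subrK (ev b y)) -evr; apply: le_lt_trans (rnormD _ _) _.
have := ev_cost y b; have : d = (c - rnorm (ev a x)) / 2 by [].
by move: by_ ry; lra.
Qed.

Lemma tensor_field_usc u : tensor_field u -> upper_semicontinuous (fun x => rnorm (u x)).
Proof.
move=> [uG _] x c uxc; pose d := (c - rnorm (u x)) / 3.
have d0 : 0 < d by rewrite divr_gt0// subr_gt0.
have [_ [a <-] ua] := uG x d d0.
have ax : rnorm (ev a x) < rnorm (u x) + d.
  have := rnormD (ev a x - u x) (u x); rewrite subrK => /le_lt_trans; apply.
  by rewrite addrC ltrD2l rnormB; exact: nbhs_singleton ua I.
apply: filterS2 ua (tensor_value_usc ax) => y /(_ I) uy ay.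
have := rnormD (u y - ev a y) (ev a y); rewrite subrK.
have : d = (c - rnorm (u x)) / 3 by [].
by move: uy ay; lra.
Qed.

Lemma slice_locally_in (U : set X) (m : R) (f : forall x, E x -> C R) u x : 0 < m ->
  (forall y v, U y -> rnorm (f y v) <= m * rnorm v) ->
  functional_field (@Gamma0_set R X E) U f -> tensor_field u -> U x ->
  locally_in (@Gamma0_set R X F) U (fun y => slice m (f y) (u y)) x.
Proof.
move=> m0 fm fU [uG _] Ux; have MF := Gamma0_module F.
have fl y : U y -> forall (c : C R) v w, f y (c *: v + w) = c * f y v + f y w by move=> /fU[].
apply: (locally_in_lim (s := fun y => slice m (f y) (u y))) => e e0.
have [_ [a <-] ua] := uG x (e / m) (divr_gt0 e0 m0).
exists (fun y => \sum_(p <- a) f y (p.1 y) *: p.2 y : F y).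
  apply: (locally_in_sum MF (s := fun (p : Gamma0 E * Gamma0 F) y => f y (p.1 y) *: p.2 y)) => p _.
  apply: (locally_inM MF) => //; last by apply: locally_in_smod; exact: Gamma0_setP.
  by have [_ fc _] := fU x Ux; exact: fc (Gamma0_setP p.1).
apply: filterS ua => y uy Uy; have {}uy := uy I; have fmy v := fm y v Uy.
have -> : \sum_(p <- a) f y (p.1 y) *: p.2 y = slice m (f y) (ev a y).
  rewrite /ev (slice_sum m0 (fl y Uy) fmy); apply: eq_bigr => p _.
  by rewrite (slice_ptens m0 (fl y Uy) fmy).
rewrite -[X in _ - X]scale1r addrC -scaleNr -(slice_linear m0 (fl y Uy) fmy) scaleN1r addrC.
by apply: le_lt_trans (slice_norm m0 (fl y Uy) fmy _) _; rewrite mulrC -ltr_pdivlMr.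
Qed.

End tensor_sections.

(** * Decomposition of sections of the tensor product *)

Lemma within_continuous {X T : topologicalType} (U : set X) (f : X -> T) (x : X) :
  {for x, continuous f} -> within_cvg U f x.
Proof. by move=> fx; apply: cvg_trans fx; apply: cvg_app; exact: cvg_within. Qed.

Lemma cutoff_extension {R : realType} {X : topologicalType} (B : hbundle R X)
    (Z O : set X) (h : X -> R) (s : forall x, B x) (c b : R) :
  hausdorff_space X -> locally_compact [set: X] -> closed Z -> open O ->
  continuous h -> vanishes_at_infinity h -> (forall x, 0 <= h x) ->
  (forall x, 0 < h x -> O x) -> 0 < c -> 0 < b -> (forall x, h x <= b) ->
  (forall x, Z x -> 0 < h x -> locally_in (@Gamma0_set R X B) (Z `&` O) s x) ->
  (forall x, Z x -> rnorm (s x) <= c * h x) ->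
  exists2 t : Gamma0 B, forall x, Z x -> t x = s x & forall x, rnorm (t x) <= 4 * (c * b).
Proof.
move=> Xh Xlc cZ oO hc hv h0 hO c0 b0 hb sG sh.
have [sGZ sv] := locally_in_cutoff (Gamma0_module B) oO hc hv h0 hO c0 sG sh.
apply: Gamma0_extension => // [|x Zx]; first exact: mulr_gt0.
by apply: le_trans (sh x Zx) _; rewrite ler_pM2l.
Qed.

Lemma sqrt_vanish {R : realType} {X : topologicalType} (g : X -> R) : (forall x, 0 <= g x) -> vanishes_at_infinity g ->
  vanishes_at_infinity (fun x => Num.sqrt (g x)).
Proof.
move=> g0 gv e e0; have [K cK Kg] := gv _ (exprn_gt0 2 e0); exists K => // x /Kg gx.
by rewrite -(ltr_pXn2r (n := 2)) ?nnegrE ?sqrtr_ge0 ?sqr_sqrtr// ltW.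
Qed.

Lemma weights_scale {R : realType} (V : normedModType (C R)) n (h : 'I_n -> R) (v : V) :
  rnorm v <= \sum_l h l ^+ 2 -> \sum_l toC (h l ^+ 2 / \sum_k h k ^+ 2) *: v = v.
Proof.
rewrite -scaler_suml -toC_sum -mulr_suml; set S := \sum_k _ => vS.
have [S0|S0] := eqVneq S 0; last by rewrite divff// (_ : toC 1 = 1)// scale1r.
suff -> : v = 0 by rewrite scaler0.
by apply/rnorm_eq0/le_anti; rewrite rnorm_ge0 andbT -S0.
Qed.

Lemma weights_le {R : realType} n (h : 'I_n -> R) l (r : R) :
  0 <= h l -> r <= \sum_k h k ^+ 2 -> h l / (\sum_k h k ^+ 2) * r <= h l.
Proof.
set S := \sum_k _ => h0 rS; have S0 : 0 <= S by apply: sumr_ge0 => k _; exact: sqr_ge0.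
have [->|Sn0] := eqVneq S 0; first by rewrite invr0 mulr0 mul0r.
have Sp : 0 < S by rewrite lt_neqAle eq_sym Sn0.
by rewrite -mulrA ler_piMr// ler_pdivrMl// mulr1.
Qed.

Section stratum_frames.
Context {R : realType} {X : topologicalType} (E : hbundle R X).
Hypothesis X_hausdorff : hausdorff_space X.
Hypothesis X_lc : locally_compact [set: X].
Hypothesis E_fbundle : is_fbundle E.
Hypothesis E_subhomogeneous : subhomogeneous E.
Hypothesis E_finite_type : conditionally_of_finite_type E.

Lemma stratum_frames d : exists (n : nat) (O : 'I_n -> set X)
    (e : 'I_n -> nat -> forall x, E x) (f : 'I_n -> nat -> forall x, E x -> C R),
  [/\ forall l, open (O l),
      forall x, dim_lt E d.+1 x -> ~ dim_lt E d x -> exists l, O l x,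
      forall l, frame (dim_lt E d.+1 `&` O l) d (e l) (f l),
      forall l x i, (dim_lt E d.+1 `&` O l) x -> (i < d)%N -> rnorm (e l i x) <= 1 &
      forall l x i v, (dim_lt E d.+1 `&` O l) x -> (i < d)%N ->
        rnorm (f l i x v) <= 2 * 3 ^+ d * rnorm v].
Proof.
have [n [U [UO Ucover Utriv]]] := E_finite_type d.
have /choice[ O OP] : forall l, exists O : set X, open O /\ U l = stratum E d `&` O.
  by move=> l; have [ O ? ?] := UO l; exists O.
pose O' l := O l `\` dim_lt E d.
have UE l : dim_lt E d.+1 `&` O' l = U l.
  have [_ ->] := OP l; rewrite stratumE /O'; apply/seteqP; split=> x.
    by move=> [? []].
  by move=> [[? ?] ?].
have frames l : exists ef : (nat -> forall x, E x) * (nat -> forall x, E x -> C R),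
    [/\ frame (U l) d ef.1 ef.2,
      forall x i, U l x -> (i < d)%N -> rnorm (ef.1 i x) <= 1 &
      forall x i v, U l x -> (i < d)%N -> rnorm (ef.2 i x v) <= 2 * 3 ^+ d * rnorm v].
  have [|e [f efP]] := good_frame X_hausdorff X_lc E_fbundle (d := d) (Utriv l).
    by move=> x; have [_ ->] := OP l; case.
  by exists (e, f).
have /choice[ef efP] := frames.
exists n, O', (fun l => (ef l).1), (fun l => (ef l).2); split.
- move=> l; apply: openI; first by have [] := OP l.
  apply: closed_openC; exact: dim_lt_closed.
- move=> x xd nxd; have : stratum E d x by rewrite stratumE.
  by rewrite Ucover => -[l _]; have [_ ->] := OP l => -[_ Ox]; exists l.
- by move=> l; rewrite UE; have [] := efP l.
- by move=> l x i; rewrite UE; have [_ + _] := efP l; apply.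
- by move=> l x i v; rewrite UE; have [_ _] := efP l; apply.
Qed.

Local Notation Z := (dim_lt E).
Local Notation G := (@Gamma0_set R X E).

Lemma frame_linear (U : set X) d e f i x (c : C R) v w : @frame R X E U d e f -> U x ->
  (i < d)%N -> f i x (c *: v + w) = c * f i x v + f i x w.
Proof. by move=> [_ fU _] Ux id; have [+ _ _] := fU i id x Ux; apply. Qed.

(* The h l are square roots of a partition of a majorant of N over the part of
   Z d.+1 where the frames live; h l times the frame of index l extends to X. *)
Record frame_weights d (N : X -> R) (b : R) n (O : 'I_n -> set X)
    (f : 'I_n -> nat -> forall x, E x -> C R) (e : 'I_n -> nat -> forall x, E x)
    (h : 'I_n -> X -> R) : Prop := FrameWeights {
  fw_open : forall l, open (O l);
  fw_frame : forall l, frame (Z d.+1 `&` O l) d (e l) (f l);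
  fw_bound : forall l x i v, (Z d.+1 `&` O l) x -> (i < d)%N ->
    rnorm (f l i x v) <= 2 * 3 ^+ d * rnorm v;
  fw_continuous : forall l, continuous (h l);
  fw_vanish : forall l, vanishes_at_infinity (h l);
  fw_ge0 : forall l x, 0 <= h l x;
  fw_le : forall l x, h l x <= b;
  fw_supp : forall l x, 0 < h l x -> O l x;
  fw_major : forall x, Z d.+1 x -> N x <= \sum_l h l x ^+ 2;
  fw_section : forall (l : 'I_n) (i : 'I_d), exists2 t : Gamma0 E,
    forall x, Z d.+1 x -> t x = toC (h l x) *: e l i x & forall x, rnorm (t x) <= 4 * b }.

Lemma exists_frame_weights d : exists n : nat, forall (N : X -> R) (m : R),
  upper_semicontinuous N -> vanishes_at_infinity N -> 0 < m -> (forall x, N x <= m) ->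
  (forall x, Z d x -> N x <= 0) ->
  exists O f e h, @frame_weights d N (Num.sqrt (4 * m)) n O f e h.
Proof.
have [n [ O [e [f [oO ZO efP e1 fM]]]]] := stratum_frames d.
exists n => N m Nu Nv m0 Nm N0.
have cZ : closed (Z d.+1) by exact: dim_lt_closed.
have [g [gc gv g4m gO Ng]] : exists g : 'I_n -> X -> R, [/\ forall l, continuous (g l),
    forall l, vanishes_at_infinity (g l), forall l x, 0 <= g l x <= 4 * m,
    forall l x, 0 < g l x -> O l x & forall x, Z d.+1 x -> N x <= \sum_l g l x].
  apply: (majorant X_hausdorff X_lc) => // x Zx Nx; apply: ZO => // /N0.
  by rewrite leNgt Nx.
have g0 l x : 0 <= g l x by have /andP[] := g4m l x.
pose h l x := Num.sqrt (g l x); exists O, f, e, h.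
have h0 l x : 0 <= h l x by exact: sqrtr_ge0.
have hc l : continuous (h l).
  move=> x; apply: (@continuous_comp _ _ _ (g l) (@Num.sqrt R)); first exact: gc.
  exact: sqrt_continuous.
have hv l : vanishes_at_infinity (h l) by apply: sqrt_vanish.
have hO l x : 0 < h l x -> O l x by rewrite sqrtr_gt0; exact: gO.
have b0 : 0 < Num.sqrt (4 * m) by rewrite sqrtr_gt0 mulr_gt0.
have hb l x : h l x <= Num.sqrt (4 * m) by apply: ler_wsqrtr; have /andP[] := g4m l x.
split=> //.
  move=> x Zx; apply: le_trans (Ng x Zx) _; apply: ler_sum => l _.
  by rewrite sqr_sqrtr.
move=> l i; rewrite -[Num.sqrt _]mul1r.
apply: (cutoff_extension X_hausdorff X_lc cZ (oO l) (hc l) (hv l) (h0 l) (hO l) ltr01 b0 (hb l)) => x Zx.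
  move=> hx; have Ox := hO l x hx; apply: (locally_inM (Gamma0_module E)) => //.
    apply: (@within_continuous _ _ _ (fun y => toC (h l y) : C R) x).
    by apply: cvg_toC; exact: hc.
  by have [eG _ _] := efP l; apply: eG.
rewrite rnormZ rnorm_toC// mul1r; have [Ox|nO] := pselect (O l x).
  by rewrite ler_piMr// e1.
suff -> : h l x = 0 by rewrite mul0r.
by apply/eqP; rewrite eq_le h0 andbT leNgt; apply/negP => /hO.
Qed.

Section weights.
Context d N b n O f e h (H : @frame_weights d N b n O f e h).

Lemma fw_out l x : ~ O l x -> h l x = 0.
Proof.
move=> nO; apply/eqP; rewrite eq_le (fw_ge0 H) andbT leNgt.
by apply/negP => /(fw_supp H).
Qed.

Lemma fw_ratio_cvg l x : 0 < h l x ->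
  within_cvg (Z d.+1 `&` O l) (fun y => toC (h l y / \sum_k h k y ^+ 2) : C R) x.
Proof.
move=> hx; apply: within_continuous; apply: cvg_toC; apply: cvgM; first exact: (fw_continuous H).
apply: cvgV.
  apply: lt0r_neq0; apply: (@lt_le_trans _ _ (h l x ^+ 2)); first by rewrite exprn_gt0.
  by rewrite (bigD1 l)//= lerDl sumr_ge0// => k _; exact: sqr_ge0.
apply: (@cvg_sum_seq R R^o) => k _; apply: (@cvgM R) => //; exact: (fw_continuous H).
Qed.

End weights.

End stratum_frames.

Section decomposition.
Context {R : realType} {X : topologicalType} (E F : hbundle R X).
Hypothesis X_hausdorff : hausdorff_space X.
Hypothesis X_lc : locally_compact [set: X].
Hypothesis E_fbundle : is_fbundle E.
Hypothesis E_subhomogeneous : subhomogeneous E.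
Hypothesis E_finite_type : conditionally_of_finite_type E.
Local Notation ev := (@tensor_value R X E F).
Local Notation Z := (dim_lt E).

Lemma vanish_field_decomposition d : exists2 B : R, 0 < B &
  forall (u : forall x, ptensor (E x) (F x)) (m : R), tensor_field u -> 0 < m ->
    (forall x, rnorm (u x) <= m) -> (forall x, Z d x -> u x = 0) ->
    exists2 a, (forall x, Z d.+1 x -> ev a x = u x) & tensor_cost a <= B * m.
Proof.
have [n nP] := exists_frame_weights X_hausdorff X_lc E_fbundle E_subhomogeneous E_finite_type d.
pose M : R := 2 * 3 ^+ d; have M0 : 0 < M by rewrite mulr_gt0// exprn_gt0.
exists (1 + (n * d)%:R * (64 * M)).
  by rewrite ltr_pwDl// mulr_ge0// ?ler0n// mulr_ge0// ltW.
move=> u m uT m0 um u0.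
have cZ : closed (Z d.+1) by exact: dim_lt_closed.
have [|| O [f [e [h H]]]] := nP _ m (tensor_field_usc X_hausdorff X_lc E_subhomogeneous uT) _ m0 um.
- by case: uT.
- by move=> x /u0 ->; rewrite rnorm0.
pose b := Num.sqrt (4 * m).
have b0 : 0 < b by rewrite sqrtr_gt0 mulr_gt0.
pose S x := \sum_l h l x ^+ 2.
have h0 := fw_ge0 H; have ug := fw_major H.
have S0 x : 0 <= S x by apply: sumr_ge0 => l _; exact: sqr_ge0.
have tau (l : 'I_n) (i : 'I_d) : exists2 s : Gamma0 F,
    forall x, Z d.+1 x -> s x = toC (h l x / S x) *: slice M (f l i x) (u x) &
    forall x, rnorm (s x) <= 4 * (M * b).
  apply: (cutoff_extension X_hausdorff X_lc cZ (fw_open H l) (fw_continuous H (l := l)) (fw_vanish H l)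
    (h0 l) (fw_supp H (l := l)) M0 b0 (fw_le H l)) => x Zx.
    move=> hx; have Ox := fw_supp H hx; apply: (locally_inM (Gamma0_module F)) => //.
      exact: (fw_ratio_cvg H hx).
    apply: (slice_locally_in M0) => //.
      by move=> y v Uy; apply: (fw_bound H).
    by have [_ + _] := fw_frame H l; apply.
  have hS : 0 <= h l x / S x by rewrite divr_ge0.
  rewrite rnormZ (rnorm_toC hS); have [Ox|nO] := pselect (O l x); last first.
    by rewrite (fw_out H nO) !mul0r mulr0.
  have s_le : rnorm (slice M (f l i x) (u x)) <= M * rnorm (u x).
    apply: slice_norm => // [c v w|v]; first exact: (frame_linear _ _ _ (fw_frame H l)).
    exact: (fw_bound H).
  apply: le_trans (ler_wpM2l hS s_le) _; rewrite mulrCA ler_pM2l//.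
  by apply: weights_le => //; exact: ug.
have /choice[E' E'P] : forall li : 'I_n * 'I_d, exists t : Gamma0 E,
    (forall x, Z d.+1 x -> t x = toC (h li.1 x) *: e li.1 li.2 x) /\
    forall x, rnorm (t x) <= 4 * b.
  by move=> [l i]; have [t] := fw_section H l i; exists t.
have /choice[T' T'P] : forall li : 'I_n * 'I_d, exists t : Gamma0 F,
    (forall x, Z d.+1 x -> t x = toC (h li.1 x / S x) *: slice M (f li.1 li.2 x) (u x)) /\
    forall x, rnorm (t x) <= 4 * (M * b).
  by move=> [l i]; have [t] := tau l i; exists t.
have EP l i := E'P (l, i); have TP l i := T'P (l, i).
exists [seq (E' (l, i), T' (l, i)) | l <- index_enum 'I_n, i <- index_enum 'I_d].
- move=> x Zx; rewrite /ev big_allpairs_dep/=.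
  have term l (i : 'I_d) : ptens (E' (l, i) x) (T' (l, i) x) =
      toC (h l x ^+ 2 / S x) *: ptens (e l i x) (slice M (f l i x) (u x)).
    have B := @ptens_bilinear R (E x) (F x).
    by rewrite (EP l i).1// (TP l i).1// (bilZl B) (bilZr B) scalerA -toCM mulrA.
  transitivity (\sum_l toC (h l x ^+ 2 / S x) *: u x); last exact: weights_scale (ug x Zx).
  apply: eq_bigr => l _; under eq_bigr do rewrite term; rewrite -scaler_sumr.
  have [Ox|nO] := pselect (O l x); last by rewrite (fw_out H nO) expr0n/= mul0r toC0 !scale0r.
  congr (_ *: _); apply/esym; apply: (ptens_decomp (e := e l ^~ x) (f := f l ^~ x)) => //.
  + by move=> i id c v w; exact: (frame_linear _ _ _ (fw_frame H l)).
  + by move=> i v id; exact: (fw_bound H).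
  + by have [_ _ /(_ x (conj Zx Ox))] := fw_frame H l.
- rewrite /tensor_cost big_allpairs_dep/=.
  apply: (@le_trans _ _ (\sum_(l < n) \sum_(i < d) 64 * M * m)).
    apply: ler_sum => l _; apply: ler_sum => i _; rewrite !Gamma0_rnormE.
    have -> : 64 * M * m = 4 * b * (4 * (M * b)).
      have key (x y z : R) : y * y = 4 * z -> 64 * x * z = 4 * y * (4 * (x * y)).
        by move=> yz; transitivity (16 * x * (y * y)); [rewrite yz; ring|ring].
      by apply: key; rewrite -expr2 sqr_sqrtr// mulr_ge0// ltW.
    rewrite ler_pM ?sup_norm_ge0//; apply: sup_norm_le.
    + by rewrite !mulr_ge0// ltW.
    + by have [] := EP l i.
    + by rewrite !mulr_ge0// ltW.
    + by have [] := TP l i.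
  have -> : \sum_(l < n) \sum_(i < d) 64 * M * m = (n * d)%:R * (64 * M) * m.
    by rewrite !sumr_const !card_ord -mulrnA -(mulr_natl (64 * M * m)) (mulnC d) mulrA.
  by rewrite [leRHS]mulrDl mul1r lerDr ltW.
Qed.

Theorem tensor_field_decomposition : exists2 B : R, 0 < B &
  forall (u : forall x, ptensor (E x) (F x)) (m : R), tensor_field u -> 0 < m ->
    (forall x, rnorm (u x) <= m) ->
    exists2 a, (forall x, ev a x = u x) & tensor_cost a <= B * m.
Proof.
have [n nP] := E_subhomogeneous.
suff H d : exists2 B : R, 0 < B &
  forall (u : forall x, ptensor (E x) (F x)) (m : R), tensor_field u -> 0 < m ->
    (forall x, rnorm (u x) <= m) ->
    exists2 a, (forall x, Z d x -> ev a x = u x) & tensor_cost a <= B * m.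
  have [B B0 BP] := H n.+1; exists B => // u m uT m0 um.
  have [a au ac] := BP u m uT m0 um; exists a => // x; apply: au.
  by have [k kn xk] := nP x; exists k.
elim: d => [|d [B B0 BP]].
  exists 1 => // u m _ m0 _; exists [::]; first by move=> x [].
  by rewrite /tensor_cost big_nil mul1r ltW.
have [B' B'0 B'P] := vanish_field_decomposition d.
have B10 : 0 < 1 + B by rewrite addr_gt0.
exists (B + B' * (1 + B)); first by rewrite addr_gt0// mulr_gt0.
move=> u m uT m0 um; have [a au ac] := BP u m uT m0 um.
have [|||b bu bc] := B'P (fun x => u x - ev a x) ((1 + B) * m) (tensor_fieldB a uT).
- exact: mulr_gt0.
- move=> x; apply: le_trans (rnormD _ _) _; rewrite rnormN mulrDl mul1r lerD//.
  apply: le_trans ac; apply: le_trans (rnorm_sum _ _ _) _.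
  apply: ler_sum => p _; apply: le_trans (ptens_norm_le _ _) _.
  by rewrite ler_pM ?rnorm_ge0// Gamma0_rnormE sup_norm_ub.
- by move=> x Zx; rewrite au// subrr.
exists (a ++ b); first by move=> x Zx; rewrite tensor_valueD bu// addrC subrK.
by rewrite tensor_cost_cat mulrDl -mulrA lerD.
Qed.

End decomposition.

(** * Injectivity *)

Section balanced_evaluation.
Context {R : realType} {X : topologicalType} (E F : hbundle R X).
Local Notation ev := (@tensor_value R X E F).
Local Notation actE := (@Gamma0_act R X E).
Local Notation actF := (@Gamma0_act R X F).

Definition eval_pair (x : X) (s : Gamma0 E) (t : Gamma0 F) : ptensor (E x) (F x) :=
  ptens (s x) (t x).

Lemma eval_pair_bilinear x : bilinear_map (eval_pair x).
Proof.
have b := @ptens_bilinear R (E x) (F x); split=> *.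
- exact: (bilDl b).
- exact: (bilDr b).
- exact: (bilZl b).
- exact: (bilZr b).
Qed.

Lemma eval_pair_norm x s t : rnorm (eval_pair x s t) <= rnorm s * rnorm t.
Proof.
apply: le_trans (ptens_norm_le _ _) _.
by rewrite ler_pM ?rnorm_ge0// Gamma0_rnormE sup_norm_ub.
Qed.

Lemma eval_pair_balanced x a s t : eval_pair x (actE a s) t = eval_pair x s (actF a t).
Proof.
have b := @ptens_bilinear R (E x) (F x).
by rewrite /eval_pair /= (bilZl b) (bilZr b).
Qed.

Definition eval (x : X) (q : ptensor (Gamma0 E) (Gamma0 F)) : ptensor (E x) (F x) :=
  ptensor_lift (eval_pair x) q.

Lemma eval_linear x a p q : eval x (a *: p + q) = a *: eval x p + eval x q.
Proof. exact: (ptensor_lift_linear (eval_pair_bilinear x) (eval_pair_norm x)). Qed.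

Lemma evalB x p q : eval x (p - q) = eval x p - eval x q.
Proof. by rewrite -[- q]scaleN1r addrC eval_linear scaleN1r addrC. Qed.

Lemma eval_norm x q : rnorm (eval x q) <= rnorm q.
Proof. exact: (ptensor_lift_norm (eval_pair_bilinear x) (eval_pair_norm x)). Qed.

Lemma eval_compl x a : eval x (compl _ (to_tensor a)) = ev a x.
Proof.
rewrite /eval (ptensor_lift_compl (eval_pair_bilinear x) (eval_pair_norm x)).
by rewrite (tensor_lift_to (eval_pair_bilinear x)).
Qed.

Lemma eval_bprel x q : bprel actE actF q -> eval x q = 0.
Proof.
have H := bptensor_lift_to_quot (eval_pair_bilinear x) (eval_pair_norm x) (eval_pair_balanced x).
move=> qS; rewrite /eval -H.
have -> : to_quot (bprel actE actF) q = to_quot (bprel actE actF) 0.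
  by apply/to_quotP; rewrite subr0.
by rewrite H -[ptensor_lift _ _]/(eval x 0) -(subrr 0) evalB subrr.
Qed.

Lemma brel_compl t : brel actE actF t -> bprel actE actF (compl _ t).
Proof.
move=> tS; have h : to_quot (brel actE actF) t = to_quot (brel actE actF) 0.
  by apply/to_quotP; rewrite subr0.
have := bcompl_to_quot actE actF t; rewrite h bcompl_to_quot.
by move/esym/(to_quotP (bprel actE actF)); rewrite linear0 subr0.
Qed.

End balanced_evaluation.

Section quotient_tensor.
Context {R : realType} {X : topologicalType} (E F : hbundle R X).
Local Notation actE := (@Gamma0_act R X E).
Local Notation actF := (@Gamma0_act R X F).
Local Notation S := (brel actE actF).

Lemma btens_bilinear : bilinear_map (btens actE actF).
Proof.
have b := @tens_bilinear (C R) (Gamma0 E) (Gamma0 F); have q := @to_quot_is_linear _ _ S.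
split=> *; rewrite /btens.
- by rewrite (bilDl b) linearD.
- by rewrite (bilDr b) linearD.
- by rewrite (bilZl b) linearZ.
- by rewrite (bilZr b) linearZ.
Qed.

Lemma btens_balanced a s t : btens actE actF (actE a s) t = btens actE actF s (actF a t).
Proof.
by apply/to_quotP => S' S'P; apply: S'P; exists a, s, t.
Qed.

Lemma to_quot_to_tensor a : to_quot S (to_tensor a) = \sum_(p <- a) btens actE actF p.1 p.2.
Proof. by rewrite to_tensor_sum linear_sum. Qed.

Lemma btens_suml (I : Type) (l : seq I) (s : I -> Gamma0 E) t :
  btens actE actF (\sum_(i <- l) s i) t = \sum_(i <- l) btens actE actF (s i) t.
Proof.
elim: l => [|i l IH]; last by rewrite !big_cons (bilDl btens_bilinear) IH.
by rewrite !big_nil -(scale0r 0) (bilZl btens_bilinear) scale0r.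
Qed.

Lemma btens_sumr (I : Type) (l : seq I) s (t : I -> Gamma0 F) :
  btens actE actF s (\sum_(i <- l) t i) = \sum_(i <- l) btens actE actF s (t i).
Proof.
elim: l => [|i l IH]; last by rewrite !big_cons (bilDr btens_bilinear) IH.
by rewrite !big_nil -(scale0r 0) (bilZr btens_bilinear) scale0r.
Qed.

End quotient_tensor.

Lemma Gamma0_sumE {R : realType} {X : topologicalType} (B : hbundle R X) (I : Type) (l : seq I)
  (s : I -> Gamma0 B) x : (\sum_(i <- l) s i) x = \sum_(i <- l) s i x.
Proof. by elim: l => [|i l IH]; rewrite ?big_nil// !big_cons Gamma0D IH. Qed.

Section factorization.
Context {R : realType} {X : topologicalType} (F : hbundle R X).
Hypothesis X_hausdorff : hausdorff_space X.
Hypothesis X_lc : locally_compact [set: X].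

Lemma Gamma0_factor (Z : set X) (t : Gamma0 F) : closed Z -> (forall x, Z x -> t x = 0) ->
  exists (c : C0 R X) (s : Gamma0 F), t = Gamma0_act c s /\ forall x, Z x -> c x = 0.
Proof.
move=> cZ tZ; pose m := sup_norm t + 1.
have m0 : 0 < m by rewrite ltr_wpDl// sup_norm_ge0.
have [|||||g [gc gv g4m gO tg]] := @majorant R X X_hausdorff X_lc (fun x => rnorm (t x)) m setT 1
  (fun=> ~` Z) _ _ m0 _ closedT.
- exact: Gamma0_usc.
- exact: Gamma0_vanish.
- by move=> x; apply: le_trans (sup_norm_ub t x) _; rewrite lerDl.
- by move=> _; exact: closed_openC.
- by move=> x _ tx; exists ord0 => /tZ t0; rewrite t0 rnorm0 ltxx in tx.
have {}tg x : rnorm (t x) <= g ord0 x by have := tg x I; rewrite big_ord1.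
have g0 x : 0 <= g ord0 x by have /andP[] := g4m ord0 x.
pose h x := Num.sqrt (g ord0 x).
have h0 x : 0 <= h x by exact: sqrtr_ge0.
have hh x : h x * h x = g ord0 x by rewrite -expr2 sqr_sqrtr.
have hc : continuous h.
  move=> x; apply: (@continuous_comp _ _ _ (g ord0) (@Num.sqrt R)); first exact: gc.
  exact: sqrt_continuous.
have hv : vanishes_at_infinity h by apply: sqrt_vanish.
have hO x : 0 < h x -> (~` Z) x by rewrite sqrtr_gt0; exact: gO.
pose b := Num.sqrt (4 * m); have b0 : 0 < b by rewrite sqrtr_gt0 mulr_gt0.
have hb x : h x <= b by apply: ler_wsqrtr; have /andP[] := g4m ord0 x.
have cc : continuous (fun x => toC (h x) : C R) by move=> x; apply: cvg_toC; exact: hc.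
have cv : vanishes_at_infinity (fun x => rnorm (toC (h x) : C R)).
  by move=> e e0; have [K cK Kh] := hv e e0; exists K => // x /Kh; rewrite rnorm_toC.
have hV x : 0 <= (h x)^-1 by rewrite invr_ge0.
have [||s sE _] := @cutoff_extension R X F setT (~` Z) h (fun x => toC (h x)^-1 *: t x) 1 b
  X_hausdorff X_lc closedT (closed_openC cZ) hc hv h0 hO ltr01 b0 hb.
- move=> x _ hx; apply: (locally_inM (Gamma0_module F)) => //.
  + by split=> //; exact: hO.
  + apply: (@within_continuous _ _ _ (fun y => toC (h y)^-1 : C R) x).
    apply: cvg_toC; apply: cvgV; last exact: hc.
    exact: lt0r_neq0.
  + by apply: locally_in_smod; exact: Gamma0_setP.
- move=> x _; rewrite rnormZ rnorm_toC// mul1r.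
  have [hx|hx] := eqVneq (h x) 0; first by rewrite hx invr0 mul0r.
  have hp : 0 < h x by rewrite lt_neqAle eq_sym hx h0.
  by rewrite ler_pdivrMl// hh.
exists (MkC0 cc cv), s; split; last first.
  move=> x Zx /=; have -> : h x = 0; last by [].
  by apply/eqP; rewrite eq_le h0 andbT leNgt; apply/negP => /hO.
apply: Gamma0P => x /=; rewrite sE// scalerA -toCM.
have [hx|hx] := eqVneq (h x) 0; last by rewrite divff// (_ : toC 1 = 1)// scale1r.
rewrite hx mul0r toC0 scale0r; apply: rnorm_eq0; apply/le_anti; rewrite rnorm_ge0 andbT.
by apply: le_trans (tg x) _; rewrite -hh hx mul0r.
Qed.

End factorization.

Section injectivity.
Context {R : realType} {X : topologicalType} (E F : hbundle R X).
Hypothesis X_hausdorff : hausdorff_space X.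
Hypothesis X_lc : locally_compact [set: X].
Hypothesis E_fbundle : is_fbundle E.
Hypothesis E_subhomogeneous : subhomogeneous E.
Hypothesis E_finite_type : conditionally_of_finite_type E.
Local Notation ev := (@tensor_value R X E F).
Local Notation Z := (dim_lt E).
Local Notation actE := (@Gamma0_act R X E).
Local Notation actF := (@Gamma0_act R X F).
Local Notation bt := (btens actE actF).
Implicit Types a : seq (Gamma0 E * Gamma0 F).

(* The first factors are rewritten in the frames over the stratum of dimension d,
   and their coefficients moved to the second factors, which then vanish on
   Z d.+1; a square root of these goes back to the first factors. *)
Lemma vanish_stratum_step d a : (forall p x, p \in a -> Z d x -> p.1 x = 0) ->
  (forall x, ev a x = 0) ->
  exists a', (forall p x, p \in a' -> Z d.+1 x -> p.1 x = 0) /\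
    \sum_(p <- a) bt p.1 p.2 = \sum_(p <- a') bt p.1 p.2.
Proof.
move=> aZ a0.
have [n nP] := exists_frame_weights X_hausdorff X_lc E_fbundle E_subhomogeneous E_finite_type d.
pose M : R := 2 * 3 ^+ d; have M0 : 0 < M by rewrite mulr_gt0// exprn_gt0.
have cZ : closed (Z d.+1) by exact: dim_lt_closed.
pose N x := \sum_(p <- a) rnorm (p.1 x).
pose m := \sum_(p <- a) sup_norm p.1 + 1.
have m0 : 0 < m by rewrite ltr_wpDl// sumr_ge0// => p _; exact: sup_norm_ge0.
have pN p x : p \in a -> rnorm (p.1 x) <= N x.
  move=> pa; rewrite /N (perm_big _ (perm_to_rem pa)) big_cons lerDl.
  by apply: sumr_ge0 => q _; exact: rnorm_ge0.
have [|||x Zx| O [f [e [h H]]]] := nP N m _ _ m0.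
- by apply: usc_sum => p; exact: Gamma0_usc.
- rewrite /N; elim: (a) => [|p l IH].
    move=> t t0; exists set0; first exact: compact0.
    by move=> x _; rewrite big_nil.
  apply: (vanish_le2 (Gamma0_vanish p.1) IH) => t t0.
  exists (t / 2); first by rewrite divr_gt0.
  by move=> x px lx; rewrite big_cons [t]splitr ltrD.
- move=> x; rewrite /m; apply: (@le_trans _ _ (\sum_(p <- a) sup_norm p.1)); last by rewrite lerDl.
  by apply: ler_sum => p _; exact: sup_norm_ub.
- by rewrite /N big1_seq// => p /andP[_ pa]; rewrite (aZ p x pa Zx) rnorm0.
pose b := Num.sqrt (4 * m).
have b0 : 0 < b by rewrite sqrtr_gt0 mulr_gt0.
pose S x := \sum_l h l x ^+ 2.
have h0 := fw_ge0 H.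
have S0 x : 0 <= S x by apply: sumr_ge0 => l _; exact: sqr_ge0.
have pS p x : p \in a -> Z d.+1 x -> rnorm (p.1 x) <= S x.
  by move=> pa Zx; apply: le_trans (pN p x pa) _; exact: (fw_major H).
have /choice[E' EP] : forall li : 'I_n * 'I_d, exists t : Gamma0 E,
    forall x, Z d.+1 x -> t x = toC (h li.1 x) *: e li.1 li.2 x.
  by move=> [l i]; have [t] := fw_section H l i; exists t.
have coefP (pli : (Gamma0 E * Gamma0 F) * ('I_n * 'I_d)) : exists c : C0 R X, pli.1 \in a ->
    forall x, Z d.+1 x -> c x = toC (h pli.2.1 x / S x) * f pli.2.1 pli.2.2 x (pli.1.1 x).
  case: pli => [p [l i]] /=; have [pa|pa] := boolP (p \in a); last first.
    have cc : continuous (fun _ : X => 0 : C R) by move=> x; apply: cvg_cst.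
    have cv : vanishes_at_infinity (fun _ : X => rnorm (0 : C R)).
      by move=> t t0; exists set0; [exact: compact0|move=> x _; rewrite rnorm0].
    by exists (MkC0 cc cv).
  pose k x : Ccomplete := toC (h l x / S x) * f l i x (p.1 x).
  have hk x : Z d.+1 x -> rnorm (k x) <= M * h l x.
    move=> Zx; have hS : 0 <= h l x / S x by rewrite divr_ge0.
    rewrite rnormM (rnorm_toC hS); have [Ox|nO] := pselect (O l x); last first.
      by rewrite (fw_out H nO) !mul0r mulr0.
    have f_le : rnorm (f l i x (p.1 x)) <= M * rnorm (p.1 x) by exact: (fw_bound H).
    apply: le_trans (ler_wpM2l hS f_le) _; rewrite mulrCA ler_pM2l//.
    by apply: weights_le => //; exact: pS.
  have [|kG kv] := @locally_in_cutoff R X (fun=> Ccomplete) (@C0_set R X) (Z d.+1) (O l) (h l) k M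
    C0_module (fw_open H l) (fw_continuous H (l := l)) (fw_vanish H l) (h0 l) (fw_supp H (l := l)) M0 _ hk.
    move=> x Zx hx; have Ox := fw_supp H hx.
    apply: (cvg_locally_in_C0 X_hausdorff X_lc); apply: (@cvgM (C R)).
      exact: (fw_ratio_cvg H hx).
    have [_ /(_ i (ltn_ord i) x (conj Zx Ox))[_ fc _] _] := fw_frame H l.
    exact: fc (Gamma0_setP p.1).
  have Mb0 : 0 < M * b by rewrite mulr_gt0.
  have [|c cE] := C0_extension X_hausdorff X_lc cZ kG kv Mb0; last by exists c.
  by move=> x Zx; apply: le_trans (hk x Zx) _; rewrite ler_pM2l//; exact: (fw_le H).
have [c cE] := choice coefP.
pose s' (p : Gamma0 E * Gamma0 F) : Gamma0 E := p.1 - \sum_(li : 'I_n * 'I_d) actE (c (p, li)) (E' li).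
pose t' li : Gamma0 F := \sum_(p <- a) actF (c (p, li)) p.2.
have s'Z p x : p \in a -> Z d.+1 x -> s' p x = 0.
  move=> pa Zx; rewrite /s' Gamma0B Gamma0_sumE; apply/eqP; rewrite subr_eq0; apply/eqP.
  transitivity (\sum_l \sum_(i < d) (toC (h l x ^+ 2 / S x) * f l i x (p.1 x)) *: e l i x); last first.
    rewrite pair_bigA; apply: eq_bigr => -[l i] _ /=.
    rewrite (cE (p, (l, i)))//= (EP (l, i))//= scalerA; congr (_ *: _).
    by rewrite [RHS]mulrAC -toCM mulrAC.
  rewrite -{1}[p.1 x](weights_scale (pS p x pa Zx)).
  apply: eq_bigr => l _; have [Ox|nO] := pselect (O l x); last first.
    rewrite (fw_out H nO) expr0n/= mul0r toC0 scale0r big1// => i _; by rewrite mul0r scale0r.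
  have [_ _ /(_ x (conj Zx Ox) (p.1 x)) {1}->] := fw_frame H l.
  by rewrite scaler_sumr; apply: eq_bigr => i _; rewrite scalerA.
have t'Z li x : Z d.+1 x -> t' li x = 0.
  case: li => l i Zx; rewrite /t' Gamma0_sumE.
  transitivity (\sum_(p <- a) toC (h l x / S x) *: (f l i x (p.1 x) *: p.2 x)).
    rewrite !big_seq; apply: eq_bigr => p pa /=.
    by rewrite (cE (p, (l, i)))//= scalerA.
  rewrite -scaler_sumr; have [Ox|nO] := pselect (O l x); last by rewrite (fw_out H nO) mul0r toC0 scale0r.
  have fli c' v w := frame_linear c' v w (fw_frame H l) (conj Zx Ox) (ltn_ord i).
  have fbi v := fw_bound H v (conj Zx Ox) (ltn_ord i).
  have -> : \sum_(p <- a) f l i x (p.1 x) *: p.2 x = slice M (f l i x) (ev a x).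
    rewrite /ev (slice_sum M0 fli fbi); apply: eq_bigr => p _.
    by rewrite (slice_ptens M0 fli fbi).
  by rewrite a0 (slice0 _ M0 fli fbi) scaler0.
have /choice[k kP] : forall li, exists ct : C0 R X * Gamma0 F,
    t' li = actF ct.1 ct.2 /\ forall x, Z d.+1 x -> ct.1 x = 0.
  by move=> li; have [c' [t [? ?]]] := Gamma0_factor X_hausdorff X_lc cZ (t'Z li); exists (c', t).
pose B := index_enum [the finType of ('I_n * 'I_d)%type].
exists ([seq (s' p, p.2) | p <- a] ++ [seq (actE (k li).1 (E' li), (k li).2) | li <- B]); split.
  move=> q x; rewrite mem_cat => /orP[] /mapP[]; first by move=> p pa -> Zx; exact: s'Z.
  by move=> li _ -> Zx /=; have [_ ->] := kP li; rewrite ?scale0r.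
have bb := @btens_bilinear R X E F.
rewrite big_cat !big_map.
transitivity (\sum_(p <- a) bt (s' p) p.2 + \sum_(li <- B) bt (E' li) (t' li)); last first.
  congr (_ + _); apply: eq_bigr => li _; have [-> _] := kP li.
  by rewrite btens_balanced.
have -> : \sum_(li <- B) bt (E' li) (t' li) =
    \sum_(p <- a) bt (\sum_(li : 'I_n * 'I_d) actE (c (p, li)) (E' li)) p.2.
  transitivity (\sum_(li <- B) \sum_(p <- a) bt (actE (c (p, li)) (E' li)) p.2).
    apply: eq_bigr => li _; rewrite /t' btens_sumr; apply: eq_bigr => p _.
    by rewrite btens_balanced.
  by rewrite exchange_big; apply: eq_bigr => p _; rewrite btens_suml.
rewrite -big_split; apply: eq_bigr => p _.
by rewrite -[RHS](bilDl bb) /s' subrK.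
Qed.

Theorem tensor_value_injective a : (forall x, ev a x = 0) -> brel actE actF (to_tensor a).
Proof.
have [n nP] := E_subhomogeneous.
have H k d a' : (d + k = n.+1)%N -> (forall p x, p \in a' -> Z d x -> p.1 x = 0) ->
    (forall x, ev a' x = 0) -> brel actE actF (to_tensor a').
  elim: k d a' => [|k IH] d b dk bZ b0.
    rewrite addn0 in dk; subst d.
    have p0 p : p \in b -> p.1 = 0.
      by move=> pb; apply: Gamma0P => x; apply: bZ => //; have [j jn xj] := nP x; exists j.
    rewrite to_tensor_sum big_seq big1 => [|p pb]; first exact: submodule0.
    rewrite p0// -(scale0r 0) (bilZl (tens_bilinear _ _)) scale0r//.
  have [b' [b'Z bb']] := vanish_stratum_step bZ b0.
  have sum_brel : brel actE actF (to_tensor b - to_tensor b').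
    by apply/to_quotP; rewrite !to_quot_to_tensor.
  have ev_eq x : ev b' x = 0.
    have := brel_compl sum_brel => /(eval_bprel x).
    rewrite linearB evalB !eval_compl b0 sub0r => /eqP; rewrite oppr_eq0.
    by move/eqP.
  rewrite -[to_tensor b](subrK (to_tensor b')).
  apply: submoduleD => //; apply: IH b'Z ev_eq.
  by rewrite addSnnS.
by move=> a0; apply: (H n.+1 0%N) => // p x _ [].
Qed.

End injectivity.

(** * Bijectivity *)

Lemma injective_surjective_bijective (T U : Type) (f : T -> U) :
  injective f -> (forall y, exists x, f x = y) -> bijective f.
Proof. by move=> f_inj /choice[g gK]; exists g => // x; apply: f_inj; rewrite gK. Qed.

Section bijectivity.
Context {R : realType} {X : topologicalType} (E F : hbundle R X).
Hypothesis X_hausdorff : hausdorff_space X.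
Hypothesis X_lc : locally_compact [set: X].
Hypothesis E_fbundle : is_fbundle E.
Hypothesis E_subhomogeneous : subhomogeneous E.
Hypothesis E_finite_type : conditionally_of_finite_type E.
Local Notation ev := (@tensor_value R X E F).
Local Notation actE := (@Gamma0_act R X E).
Local Notation actF := (@Gamma0_act R X F).
Local Notation cplt t := (compl (proj_seminorm (Gamma0 E) (Gamma0 F)) t).

Lemma bprel_closed q :
  (forall e : R, 0 < e -> exists2 p, bprel actE actF p & rnorm (q - p) <= e) -> bprel actE actF q.
Proof.
move=> qP; apply/closureP => e e0; have e30 : 0 < e / 3 by rewrite divr_gt0.
have [p pS qp] := qP _ e30; have /closureP/(_ _ e30)[r rS pr] := pS.
exists r => //; rewrite -(subrKA p); apply: le_lt_trans (rnormD _ _) _; lra.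
Qed.

Lemma eval_field (q : ptensor (Gamma0 E) (Gamma0 F)) : tensor_field (fun x : X => eval x q).
Proof.
have approx (e : R) : 0 < e -> exists a, forall x, rnorm (eval x q - ev a x) < e.
  move=> e0; have [t tq] := compl_dense q e0.
  exists (tensor_repr t) => x; rewrite -eval_compl tensor_reprK -evalB.
  by apply: le_lt_trans (eval_norm _ _) _; rewrite rnormB.
split=> [x e e0|].
  have [a qa] := approx e e0; exists (ev a); first by exists a.
  by apply: nearW => y _; exact: qa.
apply: vanish_lim => e e0; have [a qa] := approx e e0.
by exists (ev a) => [|x]; [exact: tensor_value_vanish|exact/ltW/qa].
Qed.

Lemma eval_injective q : (forall x : X, eval x q = 0) -> bprel actE actF q.
Proof.
move=> q0; apply: bprel_closed => e e0.
have [B B0 BP] := @tensor_field_decomposition R X E F X_hausdorff X_lc E_fbundle E_subhomogeneous E_finite_type.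
have B10 : 0 < 1 + B by rewrite addr_gt0.
have d0 : 0 < e / (1 + B) by rewrite divr_gt0.
have [t tq] := compl_dense q d0; pose a := tensor_repr t.
have at_ : to_tensor a = t by exact: tensor_reprK.
have [|b ba bc] := BP (fun x => eval x (cplt t)) _ (eval_field (cplt t)) d0.
  move=> x; rewrite -[eval x _]subr0 -(q0 x) -evalB; apply: le_trans (eval_norm _ _) _; exact: ltW.
have tb : brel actE actF (to_tensor (a ++ seq_scale (-1) b)).
  apply: tensor_value_injective => // x.
  by rewrite tensor_valueD tensor_valueZ scaleN1r ba -at_ eval_compl subrr.
exists (cplt (to_tensor (a ++ seq_scale (-1) b))); first exact: brel_compl.
have -> : to_tensor (a ++ seq_scale (-1) b) = t - to_tensor b.
  by rewrite to_tensor_cat at_ to_tensorZ -[tensor_scale _ _]/(-1 *: to_tensor b) scaleN1r.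
rewrite linearB opprB addrCA addrC; apply: le_trans (rnormD _ _) _.
have h1 : rnorm (q - cplt t) <= e / (1 + B) by rewrite rnormB ltW.
have h2 : rnorm (cplt (to_tensor b)) <= B * (e / (1 + B)).
  by rewrite compl_norm; apply: le_trans (proj_norm_le _) bc.
have -> : e = e / (1 + B) + B * (e / (1 + B)).
  by rewrite -[X in X + _]mul1r -mulrDl mulrC mulfVK// lt0r_neq0.
by move: h1 h2; lra.
Qed.

Lemma field_algebraic u : tensor_field u -> (exists m : R, forall x, rnorm (u x) <= m) ->
  exists a, forall x, ev a x = u x.
Proof.
move=> uT [m um].
have [B _ BP] := @tensor_field_decomposition R X E F X_hausdorff X_lc E_fbundle E_subhomogeneous E_finite_type.
have m0 : 0 < `|m| + 1 by rewrite ltr_wpDl.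
have [|a ua _] := BP u _ uT m0; last by exists a.
by move=> x; apply: le_trans (um x) _; have := ler_norm m; lra.
Qed.

Lemma canonical_completion_bijective :
  bijective (@canonical_completion R X E F : Gamma0_tensor E F -> Gamma0_ptensor E F).
Proof.
apply: injective_surjective_bijective.
  move=> x y; elim/(@lquotW _ _ (brel actE actF)) : x => t.
  elim/(@lquotW _ _ (brel actE actF)) : y => t'.
  rewrite /canonical_completion !bcompl_to_quot => /(to_quotP (bprel actE actF)).
  rewrite -linearB => tt'; apply/(to_quotP (brel actE actF)).
  rewrite -[t - t']tensor_reprK; apply: tensor_value_injective => // x.
  by rewrite -eval_compl tensor_reprK; exact: eval_bprel.
move=> y; elim/(@lquotW _ _ (bprel actE actF)) : y => q.
have [|a aq] := field_algebraic (eval_field q).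
  by exists (rnorm q) => x; exact: eval_norm.
exists (to_quot (brel actE actF) (to_tensor a)); rewrite /canonical_completion bcompl_to_quot.
apply/(to_quotP (bprel actE actF)); apply: eval_injective => x.
by rewrite evalB eval_compl aq subrr.
Qed.

Section section_bundle.
Context (T : tensor_bundle E F).

Lemma canonical_section_compl a x :
  (canonical_section T (to_quot (bprel actE actF) (cplt (to_tensor a))) : Gamma0 T) x = ev a x.
Proof.
rewrite /canonical_section (bptensor_lift_to_quot (tensor_section_bilinear T)
  (tensor_section_norm T) (tensor_section_balanced T)).
rewrite (ptensor_lift_compl (tensor_section_bilinear T) (tensor_section_norm T)).
rewrite (tensor_lift_to (tensor_section_bilinear T)).
exact: (@Gamma0_sumE R X T).
Qed.

Lemma canonical_section_eval q x :
  (canonical_section T (to_quot (bprel actE actF) q) : Gamma0 T) x = eval x q.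
Proof.
apply/eqP; rewrite -subr_eq0; apply/eqP/rnorm_eq0/le_anti; rewrite rnorm_ge0 andbT.
apply/ler_addgt0Pr => e e0; rewrite add0r; have e20 : 0 < e / 2 by rewrite divr_gt0.
have [t tq] := compl_dense q e20.
pose L p : Gamma0 T := canonical_section T (to_quot (bprel actE actF) p).
have LE p : L p = ptensor_lift (tensor_section T) p.
  exact: (bptensor_lift_to_quot (tensor_section_bilinear T)
    (tensor_section_norm T) (tensor_section_balanced T)).
have h1 : rnorm (L q x - L (cplt t) x) <= e / 2.
  have LB : L q - L (cplt t) = ptensor_lift (tensor_section T) (q - cplt t).
    rewrite !LE; apply/esym.
    exact: (zmod_morphism_linear (ptensor_lift_linear (tensor_section_bilinear T) (tensor_section_norm T))).
  rewrite -Gamma0B LB; apply: le_trans (sup_norm_ub _ x) _; rewrite -Gamma0_rnormE.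
  apply: le_trans (ptensor_lift_norm (tensor_section_bilinear T) (tensor_section_norm T) _) _.
  by rewrite rnormB ltW.
have h2 : L (cplt t) x = eval x (cplt t).
  by rewrite -{1 2}[t]tensor_reprK /L canonical_section_compl eval_compl.
have h3 : rnorm (eval x (cplt t) - eval x q) <= e / 2.
  by rewrite -evalB; apply: le_trans (eval_norm _ _) _; exact: ltW.
rewrite -/(L q) -(subrKA (L (cplt t) x)) {2}h2; apply: le_trans (rnormD _ _) _.
by rewrite [e]splitr lerD.
Qed.

Lemma Gamma0_tensor_field (u : Gamma0 T) : tensor_field (fun x => u x : ptensor (E x) (F x)).
Proof.
split=> [x e e0|]; last exact: (Gamma0_vanish u).
have [t tu] := compl_dense (u x : ptensor (E x) (F x)) e0.
have [a at_] : exists a, to_tensor (fiber_terms a x) = t.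
  rewrite -[t]tensor_reprK; elim: (tensor_repr t) => [|[v w] l [a al]]; first by exists [::].
  have [v' v'x] := exists_section_through X_hausdorff X_lc v.
  have [w' w'x] := exists_section_through X_hausdorff X_lc w.
  exists ((v', w') :: a); rewrite /fiber_terms/= v'x w'x.
  by rewrite -cat1s to_tensor_cat al -to_tensor_cat.
exists (ev a); first by exists a.
pose s : Gamma0 T := \sum_(p <- a) tensor_section T p.1 p.2.
have sE y : s y = ev a y by exact: (@Gamma0_sumE R X T).
have usx : rnorm ((u - s) x) < e.
  by rewrite Gamma0B sE tensor_valueE at_ rnormB.
have := @Gamma0_usc R X T (u - s) x e usx; apply: filterS => y + _.
by rewrite Gamma0B sE.
Qed.

Lemma canonical_section_bijective :
  bijective (@canonical_section R X E F T : Gamma0_ptensor E F -> Gamma0 T).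
Proof.
apply: injective_surjective_bijective.
  move=> x y; elim/(@lquotW _ _ (bprel actE actF)) : x => p.
  elim/(@lquotW _ _ (bprel actE actF)) : y => q pq.
  apply/(to_quotP (bprel actE actF)); apply: eval_injective => x.
  by rewrite evalB -!canonical_section_eval pq subrr.
move=> u; have [|a au] := field_algebraic (Gamma0_tensor_field u).
  by exists (sup_norm u) => x; exact: (@sup_norm_ub R X T u x).
exists (to_quot (bprel actE actF) (cplt (to_tensor a))).
by apply: Gamma0P => x; rewrite canonical_section_compl au.
Qed.

End section_bundle.
End bijectivity.

Theorem theorem3p14 (R : realType) (X : topologicalType)
    (X_hausdorff : hausdorff_space X)
    (X_locally_compact : locally_compact [set: X])
    (X_sigma_compact : sigma_compact X)
    (E F : hbundle R X)
    (E_fbundle : is_fbundle E)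
    (F_fbundle : is_fbundle F)
    (E_subhomogeneous : subhomogeneous E)
    (F_subhomogeneous : subhomogeneous F)
    (E_finite_type : conditionally_of_finite_type E)
    (F_finite_type : conditionally_of_finite_type F)
    (E_Gdelta : forall d : nat, Gdelta (dim_le E d))
    (F_Gdelta : forall d : nat, Gdelta (dim_le F d)) :
  bijective (@canonical_completion R X E F :
    Gamma0_tensor E F -> Gamma0_ptensor E F) /\
  forall T : tensor_bundle E F,
    bijective (@canonical_section R X E F T :
      Gamma0_ptensor E F -> Gamma0 T).
Proof.
by split=> [|T]; [exact: canonical_completion_bijective|exact: canonical_section_bijective].
Qed.
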